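(* Let either ($N\ge2$ and $0<s<1$) or ($N=1$ and $0<s<1/2$), and consider $\mathcal A=-(-\Delta)^{s}$ on $\mathbb R^N$. Let $0\le\varphi\in L^1(\mathbb R^N)\cap L^\infty(\mathbb R^N)$ and let $v(x,t)=(e^{-t(-\Delta)^s}\varphi)(x)$ be the solution of $\partial_t v=-(-\Delta)^s v$ in $\mathbb R^N\times(0,\infty)$, $v(\cdot,0)=\varphi$. Then $v$ is non-negative and $v(x,\cdot)\in L^1(0,\infty)$ for every $x\in\mathbb R^N$. Consequently, let $\mathbf k$ be a non-negative kernel in $L^1_{loc}(\mathbb R_+)$ associated with a subordinator, with Laplace transform $\mathcal K(\lambda)$ and inverse-subordinator density $G_t(\tau)$ (see context), such that $\lambda\mathcal K(\lambda)\to0$ as $\lambda\to0^+$ and, for some $\varrho\ge0$, the function $L(x):=x^{-\varrho}\mathcal K(x^{-1})$ is slowly varying at infinity. Then for every $x\in\mathbb R^N$, the function $v^E(x,t)=\int_0^\infty v(x,\tau)G_t(\tau)\,d\tau$ satisfies $$\frac1t\int_0^t v^E(x,r)\,dr\ \sim\ \frac{\|v(x)\|_1}{\Gamma(\varrho+1)}\;t^{-1}\mathcal K(t^{-1})\qquad\text{as }t\to\infty,$$ where $\|v(x)\|_1=\int_0^\infty v(x,\tau)\,d\tau$; that is, $$\lim_{t\to\infty}\frac{\frac1t\int_0^t v^E(x,r)\,dr}{t^{-1}\mathcal K(t^{-1})}=\frac{\|v(x)\|_1}{\Gamma(\varrho+1)}.$$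
   Context: Fractional heat semigroup: for $t>0$, $(e^{-t(-\Delta)^s}\varphi)(x)=\int_{\mathbb R^N}\mathscr E_s(x-y,t)\varphi(y)\,dy$, where $\mathscr E_s(x,t)=t^{-\frac{N}{2s}}\mathscr K_s(t^{-\frac1{2s}}x)$ and $\mathscr K_s(x)=(2\pi)^{-N}\int_{\mathbb R^N}e^{ix\cdot\xi}e^{-|\xi|^{2s}}\,d\xi$. It is a known fact that there are constants $c_s,C_s>0$ depending only on $N,s$ with $c_s(1+|x|)^{-N-2s}\le\mathscr K_s(x)\le C_s(1+|x|)^{-N-2s}$ for all $x\in\mathbb R^N$, $0<s<1$. Subordinator and kernel: $\mathbf S=\{\mathbf S_t\}_{t\ge0}$ is a subordinator (a process with stationary independent non-negative increments, starting at $0$) with $\mathbb E(e^{-\lambda \mathbf S_t})=e^{-t\Phi(\lambda)}$, where $\Phi(\lambda)=\int_{(0,\infty)}(1-e^{-\lambda\tau})\,\sigma(d\tau)$ and $\sigma$ is a measure on $(0,\infty)$ with $\int_{(0,\infty)}(1\wedge\tau)\,\sigma(d\tau)<\infty$. The associated kernel is $\mathbf k(t)=\sigma((t,\infty))$; its Laplace transform is $\mathcal K(\lambda)=\int_0^\infty e^{-\lambda t}\mathbf k(t)\,dt=\Phi(\lambda)/\lambda$, $\lambda>0$. Inverse subordinator: $E_t=\inf\{r\ge0:\mathbf S_r\ge t\}$, and $G_t(\tau)$, $\tau>0$, is the density of the law of $E_t$. It is a known fact that $\int_0^\infty e^{-\lambda t}G_t(\tau)\,dt=\mathcal K(\lambda)e^{-\tau\lambda\mathcal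 K(\lambda)}$ for $\lambda,\tau>0$. A (positive, measurable) function $L$ is slowly varying at infinity if $\lim_{x\to\infty}L(\lambda x)/L(x)=1$ for every $\lambda>0$. *)

(* Defs.v *)
From HB Require Import structures.
From mathcomp Require Import all_boot all_order all_algebra.
From mathcomp Require Import all_classical all_reals all_analysis.
From mathcomp Require Import measurable_realfun.
From mathcomp.real_closed Require Import complex.

Set Implicit Arguments.
Unset Strict Implicit.
Unset Printing Implicit Defensive.
Set Warnings "-redundant-canonical-projection".

Import Order.TTheory GRing.Theory Num.Theory.
Import numFieldNormedType.Exports.

Local Open Scope classical_set_scope.
Local Open Scope ring_scope.

(* The sigma-algebra on 'rV[T]_n is generated by the coordinate maps, so that
   'rV[R]_n carries the Borel sigma-algebra of R^n. *)
Definition rV_display : measure_display -> measure_display.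
Proof. exact. Qed.

Section measurable_rV.
Context {d} {T : measurableType d}.
Variable n : nat.

Let coors : 'I_n -> 'rV[T]_n -> T := fun i x => x ord0 i.

Let rV_set0 : g_sigma_preimage coors set0.
Proof. exact: sigma_algebra0. Qed.

Let rV_setC A : g_sigma_preimage coors A -> g_sigma_preimage coors (~` A).
Proof. exact: sigma_algebraC. Qed.

Let rV_bigcup (F : _^nat) : (forall i, g_sigma_preimage coors (F i)) ->
  g_sigma_preimage coors (\bigcup_i (F i)).
Proof. exact: sigma_algebra_bigcup. Qed.

HB.instance Definition _ := @isMeasurable.Build (rV_display d)
  'rV[T]_n (g_sigma_preimage coors) rV_set0 rV_setC rV_bigcup.

End measurable_rV.

Lemma measurable_rV_coord d (T : measurableType d) n (i : 'I_n) :
  measurable_fun [set: 'rV[T]_n] (fun x : 'rV[T]_n => x ord0 i).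
Proof.
move=> _ Y mY; rewrite setTI; apply: sub_sigma_algebra => /=.
rewrite -bigcup_seq/=; exists i => /=; first by rewrite mem_index_enum.
by exists Y => //; rewrite setTI.
Qed.

Lemma measurable_fun_rVP d1 d2 (T1 : measurableType d1)
    (T2 : measurableType d2) n (f : T1 -> 'rV[T2]_n) :
  measurable_fun [set: T1] f <->
  forall i, measurable_fun [set: T1] (fun x => f x ord0 i).
Proof.
split=> [mf i|mf].
  by apply: (measurableT_comp (measurable_rV_coord i) mf).
suff : g_sigma_preimage (fun i (x : 'rV[T2]_n) => x ord0 i) `<=`
    [set A | measurable (f @^-1` A)].
  by move=> h _ A mA; rewrite setTI; exact: h.
apply: smallest_sub.
  split => [|A|F] /=.
  - by rewrite preimage_set0.
  - by move=> mA; rewrite setTD preimage_setC; exact: measurableC.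
  - by move=> mF; rewrite preimage_bigcup; exact: bigcupT_measurable.
rewrite -bigcup_seq/=; apply: bigcup_sub => i _ A [B mB <-] /=.
by rewrite setTI -comp_preimage; have := mf i measurableT B mB; rewrite setTI.
Qed.

Section lebesgue_rV.
Context {R : realType}.

Definition rV_cons n (p : R * 'rV[R]_n) : 'rV[R]_n.+1 :=
  \row_i (if unlift ord0 i is Some j then p.2 ord0 j else p.1).

Definition rV_behead n (x : 'rV[R]_n.+1) : 'rV[R]_n :=
  \row_j x ord0 (lift ord0 j).

Lemma rV_consK n : cancel (@rV_cons n) (fun x => (x ord0 ord0, rV_behead x)).
Proof.
case=> a x; congr pair; first by rewrite mxE unlift_none.
by apply/rowP => j; rewrite !mxE liftK.
Qed.

Lemma measurable_rV_cons n : measurable_fun setT (@rV_cons n).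
Proof.
apply/measurable_fun_rVP => i.
case: (unliftP ord0 i) => [j ->|->].
  rewrite (_ : (fun _ => _) = (fun x : 'rV[R]_n => x ord0 j) \o snd).
    exact: measurableT_comp (measurable_rV_coord j) measurable_snd.
  by apply/funext => p /=; rewrite mxE liftK.
rewrite (_ : (fun _ => _) = fst); first exact: measurable_fst.
by apply/funext => p /=; rewrite mxE unlift_none.
Qed.

Lemma measurable_rV_behead n : measurable_fun setT (@rV_behead n).
Proof.
apply/measurable_fun_rVP => i.
rewrite (_ : (fun _ => _) = (fun x : 'rV[R]_n.+1 => x ord0 (lift ord0 i))).
  exact: measurable_rV_coord.
by apply/funext => p /=; rewrite mxE.
Qed.

Section step.
Local Open Scope ereal_scope.
Variables (n : nat) (mu : {sigma_finite_measure set 'rV[R]_n -> \bar R}).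

Definition lebesgue_rV_step : set 'rV[R]_n.+1 -> \bar R :=
  pushforward (lebesgue_measure \x mu) (@rV_cons n).

Let step0 : lebesgue_rV_step set0 = 0.
Proof. by rewrite /lebesgue_rV_step /pushforward preimage_set0 measure0. Qed.

Let step_ge0 A : 0 <= lebesgue_rV_step A.
Proof. by rewrite /lebesgue_rV_step /pushforward; exact: measure_ge0. Qed.

Let step_sigma_additive : semi_sigma_additive lebesgue_rV_step.
Proof.
move=> F mF tF mUF.
rewrite /lebesgue_rV_step /pushforward preimage_bigcup.
have mcons B : measurable B -> measurable (@rV_cons n @^-1` B).
  by move=> mB; rewrite -[X in measurable X]setTI; exact: measurable_rV_cons.
apply: measure_semi_sigma_additive => [i||]; first exact: mcons.
- apply/trivIsetP => /= i j _ _ ij; rewrite -preimage_setI.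
  by move/trivIsetP : tF => /(_ _ _ _ _ ij) ->//; rewrite preimage_set0.
- by rewrite -preimage_bigcup; exact: mcons.
Qed.

HB.instance Definition _ := isMeasure.Build _ _ _ lebesgue_rV_step
  step0 step_ge0 step_sigma_additive.

Let sigma_finite_step : sigma_finite setT lebesgue_rV_step.
Proof.
have /sigma_finiteP[F [TF ndF Foo]] := sigma_finiteT (@lebesgue_measure R).
have /sigma_finiteP[G [TG ndG Goo]] := sigma_finiteT mu.
pose g (x : 'rV[R]_n.+1) := (x ord0 ord0, rV_behead x).
have mg : measurable_fun setT g.
  apply: measurable_fun_pair; first exact: measurable_rV_coord.
  exact: measurable_rV_behead.
exists (fun i => g @^-1` (F i `*` G i)).
  rewrite -preimage_bigcup; apply/seteqP; split => // x _ /=.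
  have [i _ Fi] : (\bigcup_i F i) (g x).1 by rewrite -TF.
  have [j _ Gj] : (\bigcup_i G i) (g x).2 by rewrite -TG.
  exists (maxn i j) => //; split => /=.
    by move: Fi; exact/subsetPset/ndF/leq_maxl.
  by move: Gj; exact/subsetPset/ndG/leq_maxr.
move=> i; have [mFi Fioo] := Foo i; have [mGi Gioo] := Goo i; split.
  by rewrite -[X in measurable X]setTI; apply: mg => //; exact: measurableX.
rewrite /lebesgue_rV_step /pushforward -comp_preimage.
rewrite (_ : g \o _ = id); last by apply/funext => p /=; rewrite /g rV_consK.
by rewrite preimage_id product_measure1E// lte_mul_pinfty// ge0_fin_numE.
Qed.

HB.instance Definition _ :=
  Measure_isSigmaFinite.Build _ _ _ lebesgue_rV_step sigma_finite_step.

End step.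

(* Lebesgue measure on R^n, as the n-fold product of lebesgue_measure;
   R^0 is a point of mass 1. *)
Fixpoint lebesgue_rV n : {sigma_finite_measure set 'rV[R]_n -> \bar R} :=
  match n with
  | 0 => @dirac _ 'rV[R]_0 0 R
  | n'.+1 => lebesgue_rV_step (lebesgue_rV n')
  end.

Lemma lebesgue_rV_box n (A : 'I_n -> set R) :
  (forall i, measurable (A i)) ->
  lebesgue_rV n [set x : 'rV[R]_n | forall i, A i (x ord0 i)] =
  (\prod_(i < n) lebesgue_measure (A i))%E.
Proof.
elim: n A => [|n IHn] A mA /=.
  by rewrite big_ord0 diracE mem_set//= => -[].
pose B := [set x : 'rV[R]_n | forall i, A (lift ord0 i) (x ord0 i)].
have mB : measurable B.
  rewrite (_ : B = \bigcap_(i in [set: 'I_n])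
      ((fun x : 'rV[R]_n => x ord0 i) @^-1` A (lift ord0 i))); last first.
    by apply/seteqP; split => x Ax i; [move=> _; exact: Ax|exact: (Ax i I)].
  apply: fin_bigcap_measurable => // i _; rewrite -[X in measurable X]setTI.
  exact: measurable_rV_coord.
rewrite big_ord_recl -(IHn (fun i => A (lift ord0 i)))//.
transitivity ((lebesgue_measure \x lebesgue_rV n)%E (A ord0 `*` B)); last first.
  rewrite product_measure1E //; exact: mA.
rewrite /lebesgue_rV_step /pushforward.
congr (_ _); apply/seteqP; split => -[a x] /=.
  move=> Aax; split => [|i].
    by have := Aax ord0; rewrite mxE unlift_none.
  by have := Aax (lift ord0 i); rewrite mxE liftK.
by move=> [Aa Ax] i; rewrite mxE; case: unliftP => [j ->|->] //; exact: Ax.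
Qed.

End lebesgue_rV.

Section fractional_heat.
Context {R : realType}.

Definition dotp N (x y : 'rV[R]_N) : R := \sum_(i < N) x ord0 i * y ord0 i.

(* The norm of 'rV[R]_N in the library is the sup norm. *)
Definition enorm N (x : 'rV[R]_N) : R := Num.sqrt (dotp x x).

Definition expi (theta : R) : R[i] := (cos theta +i* sin theta)%C.

Definition Cintegral d (T : measurableType d) (mu : {measure set T -> \bar R})
    (f : T -> R[i]) : R[i] :=
  ((\int[mu]_x complex.Re (f x)) +i* (\int[mu]_x complex.Im (f x)))%C.

(* K_s(x) = (2 pi)^-N int e^{i x.xi} e^{-|xi|^(2s)} dxi. The integral is real,
   its imaginary part being the integral of an odd function; Re only casts it
   to R. *)
Definition frac_profile N (s : R) (x : 'rV[R]_N) : R :=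
  (2 * pi) ^- N *
  complex.Re (Cintegral (lebesgue_rV N)
        (fun xi => expi (dotp x xi) * (expR (- (enorm xi `^ (2 * s))))%:C%C)).

Definition frac_kernel N (s : R) (x : 'rV[R]_N) (t : R) : R :=
  t `^ (- (N%:R / (2 * s))) * frac_profile s (t `^ (- (2 * s)^-1) *: x).

(* e^{-t (-Delta)^s} phi at x, for t > 0 *)
Definition frac_heat N (s : R) (phi : 'rV[R]_N -> R) (x : 'rV[R]_N) (t : R)
    : R :=
  \int[lebesgue_rV N]_y (frac_kernel s (x - y) t * phi y).

End fractional_heat.

Section subordination.
Context {R : realType}.

Definition laplace (k : R -> R) (l : R) : R :=
  \int[lebesgue_measure]_(t in `]0, +oo[) (expR (- (l * t)) * k t).

Definition Gamma (x : R) : R :=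
  \int[lebesgue_measure]_(t in `]0, +oo[) (t `^ (x - 1) * expR (- t)).

Definition slowly_varying (L : R -> R) : Prop :=
  [/\ forall x, 0 < x -> 0 < L x,
      measurable_fun (`]0, +oo[ : set R) L
    & forall l : R, 0 < l -> L (l * x) / L x @[x --> +oo] --> (1 : R)].

(* sigma is a measure on (0, oo): only its restriction to ]0, +oo[ is ever
   used. *)
Definition levy_measure (sigma : {measure set R -> \bar R}) : Prop :=
  (\int[sigma]_(tau in `]0%R, +oo[) (Num.min 1 tau)%:E < +oo)%E.

Definition laplace_exponent (sigma : {measure set R -> \bar R}) (l : R) : R :=
  \int[sigma]_(tau in `]0, +oo[) (1 - expR (- (l * tau))).

Section process.
Context d (Omega : measurableType d) (P : probability Omega R).
Variable S : R -> {RV P >-> R}.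

(* The time set is [0, oo); the values of S at negative times are irrelevant. *)
Definition independent_increments : Prop :=
  forall (n : nat) (t : nat -> R) (B : nat -> set R),
    (forall i, 0 <= t i) -> (forall i, t i <= t i.+1) ->
    (forall i, measurable (B i)) ->
    P [set w : Omega | forall i, (i < n)%N -> B i (S (t i.+1) w - S (t i) w)] =
    (\prod_(i < n) P [set w : Omega | B i (S (t i.+1) w - S (t i) w)%R])%E.

Definition stationary_increments : Prop :=
  forall (r h : R) (B : set R), 0 <= r -> 0 <= h -> measurable B ->
    P [set w : Omega | B (S (r + h) w - S r w)] = P [set w : Omega | B (S h w - S 0 w)].

Definition nonnegative_increments : Prop :=
  forall (r t : R) (w : Omega), 0 <= r -> r <= t -> 0 <= S t w - S r w.

(* No path regularity is assumed beyond the increments being nonnegative for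
   every w; this makes all paths nondecreasing. *)
Record subordinator (sigma : {measure set R -> \bar R}) : Prop := {
  subordinator0 : forall w, S 0 w = 0 ;
  subordinator_indep : independent_increments ;
  subordinator_stat : stationary_increments ;
  subordinator_ge0 : nonnegative_increments ;
  subordinator_levy : levy_measure sigma ;
  subordinator_laplace : forall t l : R, 0 <= t -> 0 < l ->
    ('E_P[fun w => expR (- (l * S t w))] =
     (expR (- (t * laplace_exponent sigma l)))%:E)%E }.

(* ereal_inf set0 = +oo. *)
Definition inverse_subordinator (t : R) (w : Omega) : \bar R :=
  ereal_inf [set r%:E | r in [set r : R | 0 <= r /\ t <= S r w]].

(* g is a version, on ]0, +oo[, of the density of the law of E_t. *)
Definition inverse_density (t : R) (g : R -> R) : Prop :=
  [/\ measurable_fun (`]0, +oo[ : set R) g,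
      forall tau, 0 < tau -> 0 <= g tau
    & forall B : set (\bar R), measurable B ->
      P (inverse_subordinator t @^-1` B) =
      (\int[lebesgue_measure]_(tau in `]0%R, +oo[ `&` EFin @^-1` B)
        (g tau)%:E)%E].

End process.

Definition kernel_of (sigma : {measure set R -> \bar R}) (k : R -> R) : Prop :=
  forall t : R, 0 < t -> sigma `]t, +oo[%classic = (k t)%:E.

(* L^1_loc([0, oo)): integrability up to the endpoint 0. *)
Definition L1loc_pos (k : R -> R) : Prop :=
  forall T : R, 0 < T -> lebesgue_measure.-integrable `]0%R, T] (EFin \o k).

Definition subordinated (v : R -> R) (G : R -> R -> R) (t : R) : R :=
  \int[lebesgue_measure]_(tau in `]0, +oo[) (v tau * G t tau).

End subordination.

(* Main.v *)
(* Write v(x, .) for the heat evolution at x. The Laplace transform of its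
   subordination v^E(x, .) at l is (Phi(l)/l) times the Laplace transform of
   v(x, .) at Phi(l), and Phi(l) = l K(l) -> 0, so it is asymptotic to
   ||v(x)||_1 K(l); Karamata's Tauberian theorem (proved by approximating the
   indicator of an interval by polynomials in e^(-x)) then gives the limit.
   Positivity of the kernel is obtained without Bochner's theorem:
   exp(-|xi|^2s) is a limit of combinations of Gaussians with nonnegative
   weights, since a^s is a multiple of the integral of
   (1 - exp(-y a)) y^(-1-s) dy. Integrability in t comes from
   v <= ||phi||_oo and v <= C t^(-N/(2s)), where N/(2s) > 1. *)
Require Import Defs.
From HB Require Import structures.
From mathcomp Require Import all_boot all_order all_algebra.
From mathcomp Require Import all_classical all_reals all_analysis.
From mathcomp Require Import measurable_realfun.
From mathcomp Require Import ring lra.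

Set Implicit Arguments.
Unset Strict Implicit.
Unset Printing Implicit Defensive.

Import Order.TTheory GRing.Theory Num.Theory.
Import numFieldNormedType.Exports HBSimple HBNNSimple.

Local Open Scope classical_set_scope.
Local Open Scope ring_scope.

(** * Measure-theoretic preliminaries *)

(** The densities [G t] are given for each [t] separately, so nothing is known about their joint
    measurability in time and tau, and Tonelli cannot be applied to [v tau * G t tau] itself. The
    inverse subordinator E_t carries the argument instead: it is jointly measurable in (t, w)
    because paths are monotone, [subordinated v G t] is the expectation of v(E_t), and the Laplace
    transform in t becomes an expectation over an independent exponential time. In the Tauberian
    step the distribution function stands in for a Stieltjes measure; monotonicity yields an
    exponential growth bound, uniform for large t, which allows the passage from exponentials to
    indicators. In the Fourier part the obstacle is that Tonelli wants nonnegative integrands while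
    cosines oscillate. Hence 1 + cos throughout, with the extra mass subtracted at the end. The
    bound v <= ||phi||_oo needs only that the kernel has integral at most 1; this comes from a
    Gaussian regularisation rather than from Fourier inversion. *)

Section measure_lemmas.
Context d (T : measurableType d) (R : realType).
Local Open Scope ereal_scope.

(** For indicators this is the hypothesis on [nu]; linearity extends it to simple functions, and
    monotone convergence along [nnsfun_approx] to every nonnegative [f]. *)
Lemma ge0_integral_density (mu nu : {measure set T -> \bar R}) (g : T -> R)
    (f : T -> \bar R) :
  measurable_fun setT g -> (forall x, (0 <= g x)%R) ->
  (forall A, measurable A -> nu A = \int[mu]_(x in A) (g x)%:E) ->
  measurable_fun setT f -> (forall x, 0 <= f x) ->
  \int[nu]_x f x = \int[mu]_x (f x * (g x)%:E).
Proof.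
move=> mg g0 nuE mf f0.
have mEg : measurable_fun setT (EFin \o g) by exact/measurable_EFinP.
pose h := nnsfun_approx measurableT mf.
have hf x : (h n x)%:E @[n --> \oo] --> f x by exact: cvg_nnsfun_approx.
have ndh x : {homo (fun n => (h n x)%:E) : m n / (m <= n)%N >-> m <= n}.
  by move=> m n mn; rewrite lee_fin; exact/lefP/nd_nnsfun_approx.
have mh n : measurable_fun setT (EFin \o h n) by exact/measurable_EFinP.
have hE n : \int[nu]_x (h n x)%:E = \int[mu]_x ((h n x)%:E * (g x)%:E).
  under eq_integral do rewrite fimfunE -fsumEFin//.
  rewrite ge0_integral_fsum//; last 2 first.
  - by move=> r; exact/measurable_EFinP/measurable_funM.
  - by move=> r x _; rewrite nnfun_muleindic_ge0.
  under [RHS]eq_integral.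
    move=> x _; rewrite fimfunE -fsumEFin// ge0_mule_fsuml; last first.
      by move=> r; rewrite nnfun_muleindic_ge0.
    over.
  rewrite ge0_integral_fsum//; last 2 first.
  - move=> r; apply: emeasurable_funM => //.
    exact/measurable_EFinP/measurable_funM.
  - by move=> r x _; rewrite mule_ge0 ?nnfun_muleindic_ge0 ?lee_fin.
  apply: eq_fsbigr => r; rewrite inE => -[t _ <-].
  rewrite integralZl_indic_nnsfun// integral_indic// setIT.
  rewrite nuE// integral_mkcond -ge0_integralZl//=; last first.
  - by rewrite lee_fin fun_ge0.
  - by move=> x _; rewrite patchE; case: ifP => // _; rewrite lee_fin.
  - exact/(measurable_restrictT _ _).1/measurable_funTS.
  apply: eq_integral => x _; rewrite patchE indicE.
  by case: ifPn; rewrite ?mulr1 ?mulr0 ?mule0 ?mul0e.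
transitivity (limn (fun n => \int[nu]_x (h n x)%:E)).
  rewrite -monotone_convergence//.
  - by apply: eq_integral => x _; apply/esym/cvg_lim => //; exact: hf.
  - by move=> n x _; rewrite lee_fin fun_ge0.
transitivity (limn (fun n => \int[mu]_x ((h n x)%:E * (g x)%:E))).
  by apply: congr_lim; apply/funext => n; exact: hE.
rewrite -monotone_convergence//.
- apply: eq_integral => x _; apply/cvg_lim => //.
  exact: (@cvgeZr _ _ _ (fun n => (h n x)%:E) (f x) (g x)%:E _ (hf x)).
- by move=> n; apply: (emeasurable_funM (mh n) mEg).
- by move=> n x _; rewrite mule_ge0 ?lee_fin ?fun_ge0.
- by move=> x _ m n mn; rewrite lee_wpmul2r ?lee_fin//; exact: ndh.
Qed.

Lemma integrable_funrB (mu : {measure set T -> \bar R}) (D : set T) (f g : T -> R) :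
  measurable D -> mu.-integrable D (EFin \o f) -> mu.-integrable D (EFin \o g) ->
  mu.-integrable D (EFin \o (fun x => f x - g x)%R).
Proof. by move=> mD If Ig; apply: eq_integrable (integrableB mD If Ig). Qed.

Lemma integrable_funrD (mu : {measure set T -> \bar R}) (D : set T) (f g : T -> R) :
  measurable D -> mu.-integrable D (EFin \o f) -> mu.-integrable D (EFin \o g) ->
  mu.-integrable D (EFin \o (fun x => f x + g x)%R).
Proof. by move=> mD If Ig; apply: eq_integrable (integrableD mD If Ig). Qed.

Lemma ge0_integrable_lty (mu : {measure set T -> \bar R}) (D : set T) (f : T -> R) :
  measurable D -> measurable_fun D f -> (forall x, D x -> (0 <= f x)%R) ->
  \int[mu]_(x in D) (f x)%:E < +oo -> mu.-integrable D (EFin \o f).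
Proof.
move=> mD mf f0 foo; apply/integrableP; split; first exact/measurable_EFinP.
rewrite (eq_integral (EFin \o f))// => x; rewrite inE => /f0 fx0.
by rewrite /= ger0_norm.
Qed.

Lemma EFin_Rintegral (mu : {measure set T -> \bar R}) (D : set T) (f : T -> R) :
  measurable D -> mu.-integrable D (EFin \o f) ->
  (\int[mu]_(x in D) f x)%:E = \int[mu]_(x in D) (f x)%:E.
Proof. by move=> mD fi; rewrite /Rintegral fineK//; exact: integrable_fin_num. Qed.

End measure_lemmas.

Section scaling.
Context {R : realType}.
Local Notation mu := (@lebesgue_measure R).
Local Open Scope ereal_scope.

Lemma lebesgue_measure_itv_lty (a b : R) : mu `]a, b]%classic < +oo.
Proof.
have [ba|ab] := leP b a; first by rewrite set_itv_ge ?measure0// -leNgt bnd_simp.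
by rewrite lebesgue_measure_itv/= lte_fin ab -EFinD ltry.
Qed.

(** The right-hand side is a measure in [A] that agrees with Lebesgue measure on half-open
    intervals, hence everywhere. *)
Lemma lebesgue_measure_scale (c : R) (c0 : (0 < c)%R) (A : set R) :
  measurable A ->
  mu A = c%:E * pushforward mu ( *%R c : _ -> measurableTypeR R) A.
Proof.
move=> mA.
have mc : measurable_fun setT ( *%R c : _ -> measurableTypeR R).
  exact: measurable_funM.
pose cn : {nonneg R} := NngNum (ltW c0).
pose nu : {measure set (measurableTypeR R) -> \bar R} :=
  mscale cn (pushforward mu ( *%R c : measurableTypeR R -> measurableTypeR R)).
transitivity (nu mc A) => //.
apply: lebesgue_measure_unique => //= _ [[a b]] _ <-.
rewrite /mscale/= /pushforward.
rewrite (_ : _ @^-1` _ = `](a / c)%R, (b / c)%R]%classic); last first.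
  apply/seteqP; split => x /=; rewrite !in_itv/= ltr_pdivrMr// ler_pdivlMr//;
  by rewrite mulrC.
rewrite !lebesgue_measure_itv/= !lte_fin ltr_pM2r ?invr_gt0//.
case: ifPn => ab; last by rewrite mule0.
by rewrite -!EFinD -EFinM -mulrBl mulrC divfK ?gt_eqF.
Qed.

Lemma ge0_integral_scale (c : R) (f : R -> \bar R) : (0 < c)%R ->
  measurable_fun setT f -> (forall x, 0 <= f x) ->
  \int[mu]_x f x = c%:E * \int[mu]_x f (c * x)%R.
Proof.
move=> c0 mf f0.
have mc : measurable_fun setT ( *%R c : _ -> measurableTypeR R).
  exact: measurable_funM.
pose cn : {nonneg R} := NngNum (ltW c0).
pose nu : {measure set (measurableTypeR R) -> \bar R} :=
  mscale cn (pushforward mu ( *%R c : measurableTypeR R -> measurableTypeR R)).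
rewrite (@eq_measure_integral _ _ _ _ (nu mc)); last first.
  by move=> A mA _; exact: lebesgue_measure_scale.
rewrite ge0_integral_mscale//= ge0_integral_pushforward//.
Qed.

Lemma ge0_integral_scaley (c : R) (f : R -> \bar R) : (0 < c)%R ->
  measurable_fun (`]0%R, +oo[ : set R) f -> (forall x, (0 < x)%R -> 0 <= f x) ->
  \int[mu]_(x in `]0%R, +oo[) f x = c%:E * \int[mu]_(x in `]0%R, +oo[) f (c * x)%R.
Proof.
move=> c0 mf f0; rewrite integral_mkcond (ge0_integral_scale c0)//=.
- congr (_ * _); rewrite [RHS]integral_mkcond; apply: eq_integral => x _.
  by rewrite !patchE !mem_setE !in_itv/= !andbT pmulr_rgt0.
- exact/(measurable_restrictT _ _).1.
- by move=> x; rewrite patchE mem_setE in_itv/= andbT; case: ifP => // /f0.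
Qed.

End scaling.

(** * Monotone functions and their Laplace transforms *)

Section halfline.
Context {R : realType}.
Local Notation mu := (@lebesgue_measure R).

Lemma expRN_le1 (x : R) : 0 <= x -> expR (- x) <= 1.
Proof. by move=> x0; rewrite -[leRHS]expR0 ler_expR oppr_le0. Qed.

Lemma expRN_lt1 (x : R) : 0 < x -> expR (- x) < 1.
Proof. by move=> x0; rewrite -[ltRHS]expR0 ltr_expR oppr_lt0. Qed.

Lemma measurable_expRNM (a : R) (D : set R) : measurable_fun D (fun x : R => expR (- (a * x))).
Proof.
apply: measurable_funTS; apply: measurableT_comp => //.
by apply: measurableT_comp => //; exact: measurable_funM.
Qed.

Lemma cvg_expRNM (l : R) : 0 < l -> expR (- (l * x)) @[x --> +oo] --> (0 : R).
Proof.
move=> l0; apply: (@cvg_comp _ _ _ _ (fun x => expR (- x)) _ (pinfty_nbhs R)).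
  exact: gt0_cvgMry.
exact: cvgr_expR.
Qed.

Lemma integral_expR_tail (l a : R) : 0 < l ->
  (\int[mu]_(x in `]a, +oo[) (expR (- (l * x)))%:E = (expR (- (l * a)) / l)%:E)%E.
Proof.
move=> l0.
rewrite integral_itv_obnd_cbnd; last by apply/measurable_EFinP; apply: measurable_expRNM.
have cF : continuous (fun x => expR (- (l * x)) : R).
  move=> x; apply: continuous_comp; last exact: continuous_expR.
  by apply: continuousN; apply: continuousM => //; exact: cvg_cst.
have dF (x : R) : is_derive x 1 (fun x => - (expR (- (l * x)) / l)) (expR (- (l * x))).
  apply: trigger_derive; rewrite scaler0 add0r /GRing.scale/= mulr1.
  by field; rewrite gt_eqF.
rewrite (@ge0_continuous_FTC2y _ _ (fun x => - (expR (- (l * x)) / l)) _ 0)//.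
- by rewrite sub0e -EFinN opprK.
- exact/continuous_subspaceT.
- rewrite -oppr0 -(mul0r l^-1); apply: cvgN; apply: cvgMl; exact: cvg_expRNM.
- apply: cvg_at_right_filter; apply: cvgN; apply: cvgMl; exact: cF.
- by move=> x _; rewrite derive1E; exact: derive_val.
Qed.

Lemma nondecreasing_measurable_oy (f : R -> R) :
  (forall x, 0 < x -> 0 <= f x) -> (forall x y, 0 < x -> x <= y -> f x <= f y) ->
  measurable_fun (`]0, +oo[ : set R) f.
Proof.
move=> f0 fnd; apply/(measurable_restrictT _ _).2 => //.
apply: nondecreasing_measurable => // x y xy; rewrite !patchE !mem_setE !in_itv/= !andbT.
case: ifP => [x0|_]; first by rewrite (lt_le_trans x0 xy) fnd.
by case: ifP => // /f0.
Qed.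

Lemma measurable_cut (T : R) (D : set R) :
  measurable_fun D (fun x : R => (x <= T)%R%:R : R).
Proof.
rewrite (_ : (fun _ => _) = \1_(`]-oo, T]%classic)) //.
by apply/funext => x; rewrite indicE mem_setE in_itv.
Qed.

End halfline.

Section onem_powers.
Context {R : realFieldType}.

(** Together with [exprn_onem_le], the two sides of Bernoulli's inequality. They bound the error of
    the exponential polynomials that approximate an indicator in [good_cut]: one to the right of the
    jump, the other to the left. *)
Lemma exprn_onem_ge (z : R) n : 0 <= z -> z <= 1 -> 1 - z *+ n <= (1 - z) ^+ n.
Proof.
move=> z0 z1; elim: n => [|n IHn]; first by rewrite mulr0n subr0 expr0.
rewrite exprS; apply: (@le_trans _ _ ((1 - z) * (1 - z *+ n))).
  rewrite mulrS mulrBl mul1r mulrBr mulr1 -subr_ge0.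
  by rewrite (_ : _ - _ = z * (z *+ n)) ?mulr_ge0 ?mulrn_wge0//; ring.
by rewrite ler_wpM2l// subr_ge0.
Qed.

Lemma exprn_onem_le (z : R) n : 0 <= z -> z <= 1 -> (1 - z) ^+ n * (1 + z *+ n) <= 1.
Proof.
move=> z0 z1; elim: n => [|n IHn]; first by rewrite mulr0n addr0 expr0 mulr1.
apply: le_trans IHn; rewrite exprSr -mulrA ler_wpM2l ?exprn_ge0 ?subr_ge0//.
rewrite -subr_ge0 mulrS (_ : _ - _ = z * (z + z *+ n)); first by rewrite mulr_ge0// addr_ge0// mulrn_wge0.
ring.
Qed.

Lemma dist3_le (x y x' y' d e : R) : `|x - x'| <= d -> `|y - y'| <= d ->
  `|x' - y'| <= e / 3 -> d <= e / 3 -> `|x - y| <= e.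
Proof.
rewrite !ler_distl => /andP[? ?] /andP[? ?] /andP[? ?] ?.
by apply/andP; split; lra.
Qed.

End onem_powers.

Section mono_laplace.
Context {R : realType}.
Local Notation mu := (@lebesgue_measure R).

(** These functions play the part of the measures in Karamata's theorem, each measure on the
    half-line being represented by its distribution function; its Laplace transform is then [a]
    times the integral of exp(-a x) f(x). *)
Definition monolap (f : R -> R) := [/\ forall x, 0 < x -> 0 <= f x,
  forall x y, 0 < x -> x <= y -> f x <= f y
  & forall a, 0 < a -> mu.-integrable `]0, +oo[ (EFin \o (fun x => expR (- (a * x)) * f x))].

Lemma monolap_measurable f : monolap f -> measurable_fun (`]0, +oo[ : set R) f.
Proof. by case=> f0 fnd _; exact: nondecreasing_measurable_oy. Qed.

(* Since f is nondecreasing, its value at x is at most its average over ]x, oo[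
   against a exp(-a(y - x)). *)
Lemma monolap_le f a x : monolap f -> 0 < a -> 0 < x ->
  f x <= a * expR (a * x) * \int[mu]_(y in `]0, +oo[) (expR (- (a * y)) * f y).
Proof.
move=> mf a0 x0; have [f0 fnd fi] := mf.
have mfe : measurable_fun (`]0, +oo[ : set R) (EFin \o (fun x => expR (- (a * x)) * f x)).
  exact: measurable_int (fi _ a0).
suff : f x * (expR (- (a * x)) / a) <= \int[mu]_(y in `]0, +oo[) (expR (- (a * y)) * f y).
  rewrite -(ler_pM2l (mulr_gt0 a0 (expR_gt0 (a * x)))); apply: le_trans.
  rewrite expRN le_eqVlt; apply/orP; left; apply/eqP; field.
  by rewrite !gt_eqF// expR_gt0.
rewrite -lee_fin /Rintegral fineK; last by apply: integrable_fin_num => //; exact: fi.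
rewrite EFinM -integral_expR_tail// -ge0_integralZl//=; last 2 first.
- by apply/measurable_EFinP; apply: measurable_expRNM.
- by rewrite lee_fin f0.
have sub : `]x, +oo[ `<=` (`]0, +oo[ : set R).
  by move=> y /=; rewrite !in_itv/= !andbT; exact: lt_trans.
apply: (@le_trans _ _ (\int[mu]_(y in `]x, +oo[) (expR (- (a * y)) * f y)%:E)%E).
  apply: ge0_le_integral => //=.
  - by move=> y _; rewrite -EFinM lee_fin mulr_ge0// f0.
  - by apply: measurable_funeM; apply/measurable_EFinP; apply: measurable_expRNM.
  - exact: measurable_funS mfe.
  - move=> y; rewrite in_itv/= andbT => xy.
    by rewrite -EFinM lee_fin mulrC ler_wpM2l// fnd// ltW.
apply: ge0_subset_integral => //.
by move=> y /=; rewrite in_itv/= andbT => y0; rewrite lee_fin mulr_ge0// f0.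
Qed.

Variables (F : R -> R -> R) (F0 : R -> R).
Hypothesis mF : forall t, 0 < t -> monolap (F t).
Hypothesis mF0 : monolap F0.
Hypothesis cvgF : forall a, 0 < a ->
  \int[mu]_(x in `]0, +oo[) (expR (- (a * x)) * F t x) @[t --> +oo] -->
  \int[mu]_(x in `]0, +oo[) (expR (- (a * x)) * F0 x).

(** The test functions against which convergence is known. The aim is to pass from exponentials to
    indicators of []0, T]]; integrability is recorded as well because linearity of the integral
    depends on it. *)
Let good h := [/\ forall t, 0 < t -> mu.-integrable `]0, +oo[ (EFin \o (fun x => h x * F t x)),
  mu.-integrable `]0, +oo[ (EFin \o (fun x => h x * F0 x)) &
  \int[mu]_(x in `]0, +oo[) (h x * F t x) @[t --> +oo] --> \int[mu]_(x in `]0, +oo[) (h x * F0 x)].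

Let good_exp a : 0 < a -> good (fun x => expR (- (a * x))).
Proof.
move=> a0; split; last exact: cvgF.
- by move=> t t0; have [_ _] := mF t0; exact.
- by have [_ _] := mF0; exact.
Qed.

Let goodB g h : good g -> good h -> good (fun x => g x - h x).
Proof.
move=> [ig ig0 cg] [ih ih0 ch].
have E (f : R -> R) : (fun x => (g x - h x) * f x) = (fun x => g x * f x - h x * f x).
  by apply/funext => x; rewrite mulrBl.
split.
- by move=> t t0; rewrite E; apply: integrable_funrB => //; [exact: ig|exact: ih].
- by rewrite E; apply: integrable_funrB.
rewrite E RintegralB//.
apply: cvg_trans (cvgB cg ch); apply: near_eq_cvg.
near=> t; rewrite E RintegralB//; [exact: ig|exact: ih].
Unshelve. all: by end_near. Qed.

Let goodD g h : good g -> good h -> good (fun x => g x + h x).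
Proof.
move=> [ig ig0 cg] [ih ih0 ch].
have E (f : R -> R) : (fun x => (g x + h x) * f x) = (fun x => g x * f x + h x * f x).
  by apply/funext => x; rewrite mulrDl.
split.
- by move=> t t0; rewrite E; apply: integrable_funrD => //; [exact: ig|exact: ih].
- by rewrite E; apply: integrable_funrD.
rewrite E RintegralD//.
apply: cvg_trans (cvgD cg ch); apply: near_eq_cvg.
near=> t; rewrite E RintegralD//; [exact: ig|exact: ih].
Unshelve. all: by end_near. Qed.

(** Stated for every rate [a], since expanding one factor shifts the rate to [a + g]. *)
Let good_pow m a g : 0 < a -> 0 < g ->
  good (fun x => expR (- (a * x)) * (1 - expR (- (g * x))) ^+ m).
Proof.
elim: m a => [|m IHm] a a0 g0.
  by under eq_fun do rewrite expr0 mulr1; exact: good_exp.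
rewrite (_ : (fun _ => _) = (fun x => expR (- (a * x)) * (1 - expR (- (g * x))) ^+ m -
  expR (- ((a + g) * x)) * (1 - expR (- (g * x))) ^+ m)); last first.
  by apply/funext => x; rewrite exprS (mulrDl a g) opprD expRD; ring.
by apply: goodB; apply: IHm => //; exact: addr_gt0.
Qed.

(** The constant 1 need not be a test function, as [F t] need not be integrable. The polynomial in q
    = exp(-g x) is therefore built up from q by adding q (1 - q)^(m+1), so that no constant term
    ever appears. *)
Let good_step m g : 0 < g -> good (fun x => 1 - (1 - expR (- (g * x))) ^+ m.+1).
Proof.
move=> g0; elim: m => [|m IHm].
  rewrite (_ : (fun _ => _) = (fun x => expR (- (g * x)))); first exact: good_exp.
  by apply/funext => x; rewrite expr1; ring.
rewrite (_ : (fun _ => _) = (fun x => (1 - (1 - expR (- (g * x))) ^+ m.+1) +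
  expR (- (g * x)) * (1 - expR (- (g * x))) ^+ m.+1)).
  by apply: goodD => //; exact: good_pow.
by apply/funext => x; rewrite (exprS _ m.+1); ring.
Qed.

(** Approximation takes place in L^1 with weight exp(a x), because [monolap_le] bounds a monotone
    function by a multiple of exp(a x). The multiple is uniform in large [t], since the Laplace
    transforms of [F t] at [a] converge. *)
Let good_lim (h : R -> R) (hn : nat -> R -> R) (a : R) : 0 < a ->
  measurable_fun (`]0, +oo[ : set R) h ->
  (forall n, measurable_fun (`]0, +oo[ : set R) (hn n)) ->
  (forall f, monolap f -> mu.-integrable `]0, +oo[ (EFin \o (fun x => h x * f x))) ->
  (forall n, good (hn n)) ->
  (\int[mu]_(x in `]0%R, +oo[) (`|h x - hn n x| * expR (a * x))%:E)%E @[n --> \oo] --> 0%E ->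
  good h.
Proof.
move=> a0 mh mhn ih ghn D0; split; [by move=> t t0; exact/ih/mF|exact: ih|].
pose C0 := \int[mu]_(x in `]0, +oo[) (expR (- (a * x)) * F0 x).
have C00 : 0 <= C0.
  apply: Rintegral_ge0 => x /=; rewrite in_itv/= andbT => x0.
  by rewrite mulr_ge0//; case: mF0 => + _ _; exact.
(* The growth constant of [monolap_le] for [F0], and for [F t] as soon as its Laplace transform at
   [a] is within 1 of [C0]. *)
pose C := a * (C0 + 1).
have Cp : 0 < C by rewrite mulr_gt0// ltr_wpDl.
have mhhn n : measurable_fun (`]0, +oo[ : set R) (fun x => `|h x - hn n x| * expR (a * x)).
  apply: measurable_funM.
    by apply: measurableT_comp => //; apply: (measurable_funB mh (mhn n)).
  by apply: measurable_funTS; apply: measurableT_comp => //; apply: measurable_funM.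
have key f n D : monolap f -> (forall x, 0 < x -> f x <= C * expR (a * x)) ->
    mu.-integrable `]0, +oo[ (EFin \o (fun x => hn n x * f x)) ->
    (\int[mu]_(x in `]0%R, +oo[) (`|h x - hn n x| * expR (a * x))%:E = D%:E)%E ->
    `|\int[mu]_(x in `]0, +oo[) (h x * f x) - \int[mu]_(x in `]0, +oo[) (hn n x * f x)| <= C * D.
  move=> mf fC ihn DE; rewrite -RintegralB//; last exact: ih.
  have mf' := monolap_measurable mf.
  have ihhn : mu.-integrable `]0, +oo[ (EFin \o (fun x => h x * f x - hn n x * f x)).
    by apply: integrable_funrB => //; exact: ih.
  rewrite -lee_fin EFin_normr_Rintegral//.
  apply: (le_trans (le_abse_integral _ _ _)) => //; first exact: measurable_int ihhn.
  rewrite EFinM -DE -ge0_integralZl//=; last 2 first.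
  - by apply/measurable_EFinP; apply: mhhn.
  - by rewrite lee_fin ltW.
  apply: ge0_le_integral => //=.
  - by apply/measurable_EFinP; apply: measurableT_comp => //; apply: (measurable_funB (measurable_funM mh mf') (measurable_funM (mhn n) mf')).
  - by apply: measurable_funeM; apply/measurable_EFinP; apply: mhhn.
  - move=> x; rewrite in_itv/= andbT => x0.
    rewrite -EFinM lee_fin -mulrBl normrM mulrCA ler_wpM2l// ger0_norm ?fC//.
    by case: mf => + _ _; exact.
apply/cvgrPdist_le => e e0.
have [n [D [DE De]]] : exists n D, (\int[mu]_(x in `]0%R, +oo[) (`|h x - hn n x| * expR (a * x))%:E = D%:E)%E /\ C * D <= e / 3.
  have /fine_cvgP[fD cD] := D0.
  have e30 : 0 < e / 3 / C by rewrite !divr_gt0.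
  have /cvgrPdist_le/(_ _ e30) cD' := cD.
  have [n [nfin nD]] := filter_ex (filterI fD cD').
  exists n, (fine (\int[mu]_(x in `]0%R, +oo[) (`|h x - hn n x| * expR (a * x))%:E)%E); split.
    by rewrite fineK.
  rewrite mulrC -ler_pdivlMr//.
  by move: nD; rewrite sub0r normrN; exact/le_trans/ler_norm.
have [ihn ihn0 chn] := ghn n.
have K0 := key F0 n D mF0 _ ihn0 DE.
have e30 : 0 < e / 3 by rewrite divr_gt0.
have /cvgrPdist_le/(_ _ e30) chn' := chn.
have /cvgrPdist_le/(_ _ ltr01) cvgFa := cvgF a0.
apply: filterS3 chn' cvgFa (nbhs_pinfty_gt (num_real (0 : R))) => t chn' KC t0.
have K1 : `|\int[mu]_(x in `]0, +oo[) (h x * F t x) - \int[mu]_(x in `]0, +oo[) (hn n x * F t x)| <= C * D.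
  apply: key => //; [exact: mF| |exact: ihn].
  move=> x x0; apply: (le_trans (monolap_le (mF t0) a0 x0)).
  rewrite /C -mulrA -[leRHS]mulrA ler_pM2l// mulrC ler_pM2r ?expR_gt0//.
  by rewrite -lerBlDl; apply: le_trans (ler_norm _) _; rewrite distrC.
have K0' : `|\int[mu]_(x in `]0, +oo[) (h x * F0 x) - \int[mu]_(x in `]0, +oo[) (hn n x * F0 x)| <= C * D.
  apply: K0 => x x0; apply: (le_trans (monolap_le mF0 a0 x0)).
  rewrite /C -mulrA -[leRHS]mulrA ler_pM2l// mulrC ler_pM2r ?expR_gt0//.
  by rewrite lerDl.
have K2 : `|\int[mu]_(x in `]0, +oo[) (hn n x * F0 x) - \int[mu]_(x in `]0, +oo[) (hn n x * F t x)| <= e / 3.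
  exact: chn'.
exact: dist3_le K0' K1 K2 De.
Qed.

Let integrable_le_cut f (T : R) : monolap f ->
  mu.-integrable `]0, +oo[ (EFin \o (fun x : R => (x <= T)%R%:R * f x)).
Proof.
move=> mf; have [f0 fnd /(_ _ ltr01) fi] := mf.
have fiT := @integrableZl _ _ _ mu _ (measurable_itv _) (expR T) _ fi.
apply: le_integrable fiT => //.
- apply/measurable_EFinP/measurable_funM; last exact: monolap_measurable.
  by apply: measurable_cut.
- move=> x /=; rewrite in_itv/= andbT => x0; rewrite lee_fin.
  rewrite [leRHS]ger0_norm ?mulr_ge0// ?f0// ger0_norm ?mulr_ge0// ?f0// mulrA ler_wpM2r ?f0//.
  case: (leP x T) => [xT|_]; last by rewrite mulr_ge0 ?expR_ge0.
  apply: (@le_trans _ _ (expR 0)); first by rewrite expR0.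
  by rewrite mul1r -expRD ler_expR subr_ge0.
Qed.

Let good_cut (T : R) : 0 < T -> good (fun x : R => (x <= T)%R%:R).
Proof.
move=> T0; pose b := ln 2 / T.
have b0 : 0 < b by rewrite divr_gt0// ln_gt0// ltr1n.
have bT : expR (b * T) = 2 by rewrite /b divfK ?gt_eqF// lnK// posrE.
(* As exp(b T) = 2, the term 2^(n+1) exp(-b (n+1) x) is exp(b (T - x))^(n+1),
   so hn n tends to the indicator of x < T. *)
pose hn n x := 1 - (1 - expR (- (b * n.+1%:R * x))) ^+ (2 ^ n.+1).
have mh : measurable_fun (`]0, +oo[ : set R) (fun x : R => (x <= T)%R%:R : R).
  by apply: measurable_cut.
have mhn n : measurable_fun (`]0, +oo[ : set R) (hn n).
  apply: measurable_funB => //; apply: measurable_funX; apply: measurable_funB => //.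
  exact: measurable_expRNM.
(* With m = 2^(n+1), the product m z is exp(b (T - x))^(n+1). To the left of [T] the error is (1 -
   z)^m <= 1 / (m z); to the right it is 1 - (1 - z)^m <= m z. *)
have hb n x : 0 < x -> `|(x <= T)%R%:R - hn n x| <= expR (- (b * `|x - T|)) ^+ n.+1.
  move=> x0; set z := expR (- (b * n.+1%:R * x)).
  have zE : z *+ (2 ^ n.+1) = expR (b * (T - x)) ^+ n.+1.
    rewrite -mulr_natr natrX -bT -!expRM_natl /z -expRD; congr expR; ring.
  have z0 : 0 <= z by exact: expR_ge0.
  have z1 : z <= 1.
    by apply: expRN_le1; apply: mulr_ge0; [apply: mulr_ge0; [exact: ltW|exact: ler0n]|exact: ltW].
  have zm m : 0 <= (1 - z) ^+ m <= 1.
    by rewrite exprn_ge0 ?subr_ge0// exprn_ile1 ?subr_ge0// gerBl.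
  rewrite /hn -/z; case: (leP x T) => xT /=.
    rewrite opprB addrC subrK ger0_norm; last by have /andP[] := zm (2 ^ n.+1)%N.
    rewrite distrC ger0_norm ?subr_ge0//.
    rewrite expRN exprVn -zE -div1r ler_pdivlMr; last by rewrite mulrn_wgt0// ?expR_gt0// expn_gt0.
    apply: le_trans (@exprn_onem_le _ z (2 ^ n.+1) z0 z1).
    by rewrite ler_wpM2l ?lerDr//; have /andP[] := zm (2 ^ n.+1)%N.
  rewrite sub0r normrN ger0_norm; last by rewrite subr_ge0; have /andP[] := zm (2 ^ n.+1)%N.
  rewrite gtr0_norm ?subr_gt0// -mulrN opprB -zE lerBlDl -lerBlDr.
  exact: exprn_onem_ge.
(* The weight must grow more slowly than the decay rate [b] of the error. With rate [b / 2] the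
   product stays below exp(b T) exp(-(b / 2) x), and exp(b T) = 2. *)
apply: (@good_lim _ hn (b / 2)) => //.
- by rewrite divr_gt0.
- by move=> f; exact: integrable_le_cut.
- move=> n; have [m mE] : exists m, (2 ^ n.+1)%N = m.+1.
    by exists (2 ^ n.+1).-1; rewrite prednK// expn_gt0.
  rewrite /hn mE.
  by apply: good_step; rewrite mulr_gt0.
have mD n : measurable_fun (`]0, +oo[ : set R)
    (fun x => (`|(x <= T)%R%:R - hn n x| * expR (b / 2 * x))%:E).
  apply/measurable_EFinP; apply: measurable_funM.
    by apply: measurableT_comp => //; apply: (measurable_funB mh (mhn n)).
  by apply: measurable_funTS; apply: measurableT_comp => //; apply: measurable_funM.
have [] := @dominated_convergence _ _ _ mu (`]0%R, +oo[ : set R) (measurable_itv _)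
  (fun n x => (`|(x <= T)%R%:R - hn n x| * expR (b / 2 * x))%:E) (cst 0%E)
  (fun x => (2 * expR (- (b / 2 * x)))%:E) mD (measurable_cst _).
(* The point [T] has to be excepted: there z = 2^-(n+1), and [hn n T] tends to 1 - 1/e instead of
   1. *)
- exists [set T]; split => //; first exact: lebesgue_measure_set1.
  move=> x /= /not_implyP[]; rewrite in_itv/= andbT => x0; apply: contra_notP => /eqP xT.
  apply/fine_cvgP; split; first exact: nearW.
  apply: (@squeeze_cvgr _ _ _ _ (cst 0) (fun n => expR (- (b * `|x - T|)) ^+ n.+1 * expR (b / 2 * x))).
  + by near=> n; rewrite /= mulr_ge0//= ler_wpM2r ?hb.
  + exact: cvg_cst.
  + rewrite -(mul0r (expR (b / 2 * x))); apply: cvgMl.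
    rewrite (cvg_shiftS (fun n => expR (- (b * `|x - T|)) ^+ n)).
    apply: cvg_expr; rewrite ger0_norm ?expR_ge0// expRN_lt1// mulr_gt0// normr_gt0 subr_eq0//.
- apply/integrableP; split.
    by apply/measurable_EFinP; apply: measurable_funM => //; apply: measurable_expRNM.
  under eq_integral do rewrite /= ger0_norm ?mulr_ge0 ?expR_ge0// EFinM.
  rewrite ge0_integralZl//; last first.
    by apply/measurable_EFinP; apply: measurable_expRNM.
  have b2 : 0 < b / 2 by rewrite divr_gt0.
  by apply: lte_mul_pinfty => //; rewrite (integral_expR_tail 0 b2) ltry.
- apply: aeW => x n; rewrite /= in_itv/= andbT => x0; rewrite lee_fin ger0_norm ?mulr_ge0//.
  apply: (@le_trans _ _ (expR (- (b * `|x - T|)) * expR (b / 2 * x))).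
    rewrite ler_wpM2r//; apply: (le_trans (hb n x x0)); rewrite exprS ler_piMr//.
    by rewrite exprn_ile1// expRN_le1// mulr_ge0// ltW.
  apply: (@le_trans _ _ (expR (b * T) * expR (- (b / 2 * x)))); last by rewrite bT.
  rewrite -!expRD ler_expR.
  have : x - T <= `|x - T| by exact: ler_norm.
  by move: b0 => /ltW/ler_wpM2l/[apply]; rewrite mulrBr; lra.
move=> _ _; rewrite integral_cst// mul0e; exact.
Unshelve. all: by end_near. Qed.

Let cut_bounds f a b : monolap f -> 0 < a -> a < b ->
  f a * (b - a) <= \int[mu]_(x in `]0, +oo[) (((x <= b)%R%:R - (x <= a)%R%:R) * f x) <= f b * (b - a).
Proof.
move=> mf a0 ab; have [f0 fnd _] := mf.
have E (x : R) : (x <= b)%R%:R - (x <= a)%R%:R = \1_(`]a, b]%classic) x :> R.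
  rewrite indicE mem_setE in_itv/=; case: (leP x a) => xa /=; last by rewrite subr0.
  by rewrite (le_trans xa (ltW ab)) subrr.
have ind_int : mu.-integrable `]0, +oo[ (EFin \o (\1_(`]a, b]%classic) : R -> R)).
  by apply: integrableS (integrable_indic_itv a b false false) => //.
have intE c : \int[mu]_(x in `]0, +oo[) (c * \1_(`]a, b]%classic) x) = c * (b - a).
  rewrite RintegralZl//; congr *%R; rewrite /Rintegral integral_indic//.
  rewrite (_ : _ `&` _ = `]a, b]%classic).
    by have := congr1 fine (lebesgue_measure_itv `]a, b]); rewrite /= lte_fin ab/=; exact.
  by apply/setIidl => x /=; rewrite !in_itv/= andbT => /andP[/(lt_trans a0)].
have fint : mu.-integrable `]0, +oo[ (EFin \o (fun x : R => ((x <= b)%R%:R - (x <= a)%R%:R) * f x)).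
  rewrite (_ : (fun _ => _) = (fun x => (x <= b)%R%:R * f x - (x <= a)%R%:R * f x)).
    by apply: integrable_funrB => //; exact: integrable_le_cut.
  by apply/funext => x; rewrite mulrBl.
have cint c : mu.-integrable `]0, +oo[ (EFin \o (fun x : R => c * \1_(`]a, b]%classic) x)).
  exact: (@integrableZl _ _ _ mu _ (measurable_itv _) c _ ind_int).
rewrite -!intE; apply/andP; split; apply: le_Rintegral => //= x; rewrite in_itv/= andbT => x0;
  rewrite E indicE mem_setE in_itv/=.
  case: (ltP a x) => ax /=; last by rewrite mulr0 mul0r.
  by case: (leP x b) => xb /=; rewrite ?mulr1 ?mulr0 ?mul1r ?mul0r//; apply: fnd => //; exact: ltW.
case: (ltP a x) => ax /=; last by rewrite mulr0 mul0r.
by case: (leP x b) => xb /=; rewrite ?mulr1 ?mulr0 ?mul1r ?mul0r//; apply: fnd.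
Qed.

(** By monotonicity [F t 1] lies between the averages of [F t] over []1 - d, 1]] and over []1, 1 +
    d]]. These converge to the averages of [F0], which continuity at 1 keeps close to [F0 1]. *)
Lemma monolap_cvg1 : {for 1, continuous F0} -> F t 1 @[t --> +oo] --> F0 1.
Proof.
move=> cF0; apply/cvgrPdist_le => e e0.
have e20 : 0 < e / 2 by rewrite divr_gt0.
have [d d0 dF0] : exists2 d, 0 < d < 1 & forall x, `|1 - x| <= d -> `|F0 1 - F0 x| <= e / 2.
  move/cvgrPdist_le : cF0 => /(_ _ e20)/nbhs_normP[d /= d0 dF0].
  exists (Num.min (d / 2) 2^-1).
    by rewrite lt_min divr_gt0//= invr_gt0 ltr0n/= gt_min invf_lt1// ltr1n orbT.
  move=> x; rewrite le_min => /andP[xd _]; apply: dF0 => /=.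
  by rewrite (le_lt_trans xd)// ltr_pdivrMr// ltr_pMr// ltr1n.
have /andP[d0' d1] := d0.
have key a b : 0 < a -> a < b ->
  \int[mu]_(x in `]0, +oo[) (((x <= b)%R%:R - (x <= a)%R%:R) * F t x) @[t --> +oo] -->
  \int[mu]_(x in `]0, +oo[) (((x <= b)%R%:R - (x <= a)%R%:R) * F0 x).
  by move=> a0 ab; have [] := goodB (good_cut (lt_trans a0 ab)) (good_cut a0).
have ed : 0 < e / 2 * d by rewrite mulr_gt0.
have l1 : 1 < 1 + d by rewrite ltrDl.
have l2 : 1 - d < 1 by rewrite ltrBlDr ltrDl.
have l0 : 0 < 1 - d by rewrite subr_gt0.
have /cvgrPdist_le/(_ _ ed) key1 := key _ _ ltr01 l1.
have /cvgrPdist_le/(_ _ ed) key2 := key _ _ l0 l2.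
apply: filterS3 key1 key2 (nbhs_pinfty_gt (num_real (0 : R))) => t key1 key2 t0.
have K1 : `|\int[mu]_(x in `]0, +oo[) (((x <= 1 + d)%R%:R - (x <= 1)%R%:R) * F0 x) -
    \int[mu]_(x in `]0, +oo[) (((x <= 1 + d)%R%:R - (x <= 1)%R%:R) * F t x)| <= e / 2 * d.
  by [].
have K2 : `|\int[mu]_(x in `]0, +oo[) (((x <= 1)%R%:R - (x <= 1 - d)%R%:R) * F0 x) -
    \int[mu]_(x in `]0, +oo[) (((x <= 1)%R%:R - (x <= 1 - d)%R%:R) * F t x)| <= e / 2 * d.
  by [].
have /andP[A1 _] := cut_bounds (mF t0) ltr01 l1.
have /andP[_ A2] := cut_bounds mF0 ltr01 l1.
have /andP[_ B1] := cut_bounds (mF t0) l0 l2.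
have /andP[B2 _] := cut_bounds mF0 l0 l2.
have G1 : `|F0 1 - F0 (1 + d)| <= e / 2.
  by apply: dF0; rewrite opprD addrA subrr sub0r normrN gtr0_norm.
have G2 : `|F0 1 - F0 (1 - d)| <= e / 2.
  by apply: dF0; rewrite opprB addrC subrK gtr0_norm.
move: K1 K2 A1 A2 B1 B2 G1 G2; rewrite !ler_distl (_ : 1 + d - 1 = d); last by ring.
rewrite (_ : 1 - (1 - d) = d); last by ring.
move=> /andP[K1 _] /andP[_ K2] A1 A2 B1 B2 /andP[G1 _] /andP[_ G2].
have H1 : F t 1 * d <= (F0 (1 + d) + e / 2) * d by rewrite mulrDl; lra.
have H2 : (F0 (1 - d) - e / 2) * d <= F t 1 * d by rewrite mulrBl; lra.
move: H1 H2; rewrite !ler_pM2r// => H1 H2.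
by apply/andP; split; lra.
Qed.

End mono_laplace.

(** * Karamata's Tauberian theorem *)

Section tauberian.
Context {R : realType}.
Local Notation mu := (@lebesgue_measure R).

Lemma measurable_ler_pair : measurable_fun setT (fun p : R * R => (p.2 <= p.1)%R%:R : R).
Proof.
rewrite (_ : (fun _ => _) = \1_[set p : R * R | p.2 <= p.1]); last first.
  by apply/funext => p; rewrite indicE; congr (nat_of_bool _)%:R; apply/idP/idP; rewrite inE.
apply: measurable_indic.
rewrite (_ : [set _ | _] = (fun p : R * R => p.2 <= p.1) @^-1` [set true]); last first.
  by apply/seteqP; split.
rewrite -[X in measurable X]setTI.
by apply: measurable_fun_ler.
Qed.

(** From y <= exp y at y = x / (2 r), raised to the power [r]; this is the origin of the constant (2
    r)^r. *)
Lemma powR_le_expR (r : R) : 0 <= r -> exists2 C, 0 < C &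
  forall x, 0 < x -> x `^ r <= C * expR (x / 2).
Proof.
rewrite le_eqVlt => /predU1P[<-|r0].
  exists 1 => // y y0; rewrite powRr0 mul1r; apply: (@le_trans _ _ (expR 0)); first by rewrite expR0.
  by rewrite ler_expR divr_ge0// ltW.
exists ((2 * r) `^ r); first by rewrite powR_gt0// mulr_gt0.
move=> y y0.
have r20 : 0 < 2 * r by rewrite mulr_gt0.
rewrite -[X in X `^ _ <= _](divfK (lt0r_neq0 r20)).
rewrite [X in X <= _]powRM ?divr_ge0 ?(ltW y0) ?(ltW r20)//.
rewrite mulrC ler_pM2l ?powR_gt0//.
have -> : expR (y / 2) = expR (y / (2 * r)) `^ r.
  rewrite /powR gt_eqF ?expR_gt0// expRK; congr expR; field.
  by rewrite gt_eqF.
apply: ge0_ler_powR; rewrite ?nnegrE ?expR_ge0// ?divr_ge0 ?(ltW y0) ?(ltW r20) ?(ltW r0)//.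
by apply: le_trans (expR_ge1Dx _); rewrite lerDr.
Qed.

Lemma integral_powR_expR1_lty (r : R) : 0 <= r ->
  (\int[mu]_(x in `]0%R, +oo[) (expR (- x) * x `^ r)%:E < +oo)%E.
Proof.
move=> r0; have [C C0 HC] := powR_le_expR r0.
have h0 : 0 < 2^-1 :> R by rewrite invr_gt0.
apply: (@le_lt_trans _ _ (C%:E * \int[mu]_(x in `]0%R, +oo[) (expR (- (2^-1 * x)))%:E)%E); last first.
  by apply: lte_mul_pinfty; rewrite ?lee_fin ?(ltW C0)//; rewrite (integral_expR_tail 0 h0) ltry.
rewrite -ge0_integralZl//=; last 2 first.
- by apply/measurable_EFinP; apply: measurable_expRNM.
- by rewrite lee_fin ltW.
apply: ge0_le_integral => //=.
- by move=> x _; rewrite lee_fin mulr_ge0 ?expR_ge0 ?powR_ge0.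
- apply/measurable_EFinP; apply: measurable_funM; last first.
    by apply: measurable_funTS; apply: measurable_powR.
  by apply: measurable_funTS; apply: measurableT_comp => //; apply: measurableT_comp.
- by apply: measurable_funeM; apply/measurable_EFinP; apply: measurable_expRNM.
move=> x; rewrite in_itv/= andbT => x0; rewrite lee_fin mulrC.
apply: (@le_trans _ _ (C * expR (x / 2) * expR (- x))).
  by rewrite ler_wpM2r ?expR_ge0// HC.
by rewrite -mulrA -expRD ler_pM2l// ler_expR; lra.
Qed.

Lemma integral_powR_expR (r a : R) : 0 <= r -> 0 < a ->
  (\int[mu]_(x in `]0%R, +oo[) (expR (- (a * x)) * x `^ r)%:E =
   (a `^ (- r) / a * Gamma (r + 1))%:E)%E.
Proof.
move=> r0 a0.
have GE : (\int[mu]_(x in `]0%R, +oo[) (expR (- x) * x `^ r)%:E = (Gamma (r + 1))%:E)%E.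
  rewrite /Gamma /Rintegral addrK; under [in RHS]eq_integral do rewrite mulrC.
  rewrite fineK// ge0_fin_numE; first exact: integral_powR_expR1_lty.
  by apply: integral_ge0 => x _; rewrite lee_fin mulr_ge0 ?expR_ge0 ?powR_ge0.
have mf : measurable_fun (`]0%R, +oo[ : set R) (fun x => (expR (- x) * x `^ r)%:E).
  apply/measurable_EFinP; apply: measurable_funM; last first.
    by apply: measurable_funTS; apply: measurable_powR.
  by apply: measurable_funTS; apply: measurableT_comp => //; apply: measurableT_comp.
have := ge0_integral_scaley a0 mf.
move=> /(_ (fun x _ => mulr_ge0 (expR_ge0 _) (powR_ge0 _ _))).
rewrite GE.
have -> : (\int[mu]_(x in `]0%R, +oo[) (expR (- (a * x)) * (a * x) `^ r)%:E =
   (a `^ r)%:E * \int[mu]_(x in `]0%R, +oo[) (expR (- (a * x)) * x `^ r)%:E)%E.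
  rewrite -ge0_integralZl//=; last 3 first.
  - apply/measurable_EFinP; apply: measurable_funM; last first.
      by apply: measurable_funTS; apply: measurable_powR.
    exact: measurable_expRNM.
  - by move=> x _; rewrite lee_fin mulr_ge0 ?expR_ge0 ?powR_ge0.
  - by rewrite lee_fin powR_ge0.
  apply: eq_integral => x; rewrite inE/= in_itv/= andbT => x0.
  by rewrite -EFinM powRM ?ltW//; congr EFin; ring.
set I := (\int[mu]_(x in _) _)%E => IE.
(* In [IE] the value of Gamma is finite and the factors of [I] are positive, so [I] cannot be
   infinite. *)
have If : I \is a fin_num.
  have : (0 <= I)%E by apply: integral_ge0 => x _; rewrite lee_fin mulr_ge0 ?expR_ge0 ?powR_ge0.
  rewrite fin_numE; case: I IE => [//| |//] IE _.
  by move: IE; rewrite gt0_muley ?lte_fin ?powR_gt0// gt0_muley ?lte_fin.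
rewrite -(fineK If) in IE *; congr EFin.
move: IE; rewrite -!EFinM => -[->]; rewrite powRN.
have pn : a `^ r != 0 by rewrite gt_eqF// powR_gt0.
have an : a != 0 by rewrite gt_eqF.
by field; apply/andP.
Qed.

Lemma monolap_powR (c r : R) : 0 <= c -> 0 <= r -> monolap (fun x => c * x `^ r).
Proof.
move=> c0 r0; split.
- by move=> x x0; rewrite mulr_ge0 ?powR_ge0.
- move=> x y x0 xy; rewrite ler_wpM2l// ge0_ler_powR// nnegrE ltW//.
  exact: lt_le_trans xy.
- move=> a a0.
  have I : mu.-integrable `]0, +oo[ (EFin \o (fun x => expR (- (a * x)) * x `^ r)).
    apply: ge0_integrable_lty => //.
    + apply: measurable_funM; first exact: measurable_expRNM.
      by apply: measurable_funTS; apply: measurable_powR.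
    + by move=> x _; rewrite mulr_ge0 ?expR_ge0 ?powR_ge0.
    + by rewrite integral_powR_expR// ltry.
  have J := @integrableZl _ _ _ mu _ (measurable_itv _) c _ I.
  apply: eq_integrable J => // x _ /=.
  by rewrite -EFinM; congr EFin; ring.
Qed.

Lemma Rintegral_powR_expR (c r a : R) : 0 <= c -> 0 <= r -> 0 < a ->
  \int[mu]_(x in `]0, +oo[) (expR (- (a * x)) * (c * x `^ r)) = c * (a `^ (- r) / a * Gamma (r + 1)).
Proof.
move=> c0 r0 a0.
have I : mu.-integrable `]0, +oo[ (EFin \o (fun x => expR (- (a * x)) * x `^ r)).
  have [_ _ /(_ _ a0)] := monolap_powR ler01 r0.
  by rewrite (_ : (fun x => _ * (1 * _)) = (fun x => expR (- (a * x)) * x `^ r))//; apply/funext => x; rewrite mul1r.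
under eq_Rintegral do rewrite mulrCA.
by rewrite RintegralZl// /Rintegral integral_powR_expR.
Qed.

(** The averaging bound [monolap_le] for x^r at a = x = 1 reads 1 <= e Gamma(r + 1). *)
Lemma Gamma_gt0 (r : R) : 0 <= r -> 0 < Gamma (r + 1).
Proof.
move=> r0; have := @monolap_le _ _ 1 1 (monolap_powR ler01 r0) ltr01 ltr01.
rewrite Rintegral_powR_expR ?ler01 ?ltr01// !powR1 !mul1r invr1 mul1r => H.
by rewrite -(pmulr_rgt0 _ (expR_gt0 (1 : R))); apply: lt_le_trans H.
Qed.

Section karamata.
Variables (u k : R -> R) (M A r : R).
Hypotheses (mu_ : measurable_fun (`]0, +oo[ : set R) u) (u0 : forall x, 0 < x -> 0 <= u x)
  (uM : forall x, 0 < x -> u x <= M) (k0 : forall l, 0 < l -> 0 < k l) (A0 : 0 <= A) (r0 : 0 <= r).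
Hypothesis k_regvar : forall c, 0 < c -> k (c / t) / k t^-1 @[t --> +oo] --> c `^ (- r).
Hypothesis u_laplace : forall c, 0 < c ->
  (\int[mu]_(x in `]0, +oo[) (expR (- (c / t * x)) * u x)) / k (c / t) @[t --> +oo] --> A.

Let U y := \int[mu]_(x in `]0, y]) u x.

Let iu y : mu.-integrable `]0, y] (EFin \o u).
Proof.
apply: measurable_bounded_integrable => //.
- exact: lebesgue_measure_itv_lty.
- by apply: measurable_funS mu_ => // x /=; rewrite !in_itv/= andbT => /andP[].
- exists M; split; first exact: num_real.
  move=> N MN x /=; rewrite in_itv/= => /andP[x0 _].
  by rewrite ger0_norm ?u0// (le_trans (uM x0))// ltW.
Qed.

Let UE y : ((U y)%:E = \int[mu]_(x in `]0%R, +oo[) (u x * (x <= y)%R%:R)%:E)%E.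
Proof.
rewrite /U (EFin_Rintegral _ (iu y))// [LHS]integral_mkcond [RHS]integral_mkcond.
apply: eq_integral => x _; rewrite !patchE !mem_setE !in_itv/= andbT.
by case: ltP => // x0; case: leP => xy /=; rewrite ?mulr1 ?mulr0.
Qed.

Let U0 y : 0 <= U y.
Proof. by apply: Rintegral_ge0 => x /=; rewrite in_itv/= => /andP[/u0]. Qed.

Let Und y z : y <= z -> U y <= U z.
Proof.
move=> yz; rewrite -lee_fin /U (EFin_Rintegral _ (iu y))// (EFin_Rintegral _ (iu z))//.
apply: ge0_subset_integral => //.
- exact: measurable_int (iu z).
- by move=> x /=; rewrite in_itv/= lee_fin => /andP[/u0].
- by move=> x /=; rewrite !in_itv/= => /andP[-> /le_trans]; apply.
Qed.

Let W a := \int[mu]_(x in `]0, +oo[) (expR (- (a * x)) * u x).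

Let iW a : 0 < a -> mu.-integrable `]0, +oo[ (EFin \o (fun x => expR (- (a * x)) * u x)).
Proof.
move=> a0; apply: ge0_integrable_lty => //.
- by apply: measurable_funM => //; exact: measurable_expRNM.
- by move=> x /=; rewrite in_itv/= andbT => /u0 ux0; rewrite mulr_ge0 ?expR_ge0.
have M0 : 0 <= M by exact: le_trans (u0 ltr01) (uM ltr01).
apply: (@le_lt_trans _ _ (M%:E * \int[mu]_(x in `]0%R, +oo[) (expR (- (a * x)))%:E)%E); last first.
  by apply: lte_mul_pinfty; rewrite ?lee_fin//; rewrite (integral_expR_tail 0 a0) ltry.
rewrite -ge0_integralZl//=; last first.
  by apply/measurable_EFinP; apply: measurable_expRNM.
apply: ge0_le_integral => //=.
- by move=> x /=; rewrite in_itv/= andbT lee_fin => /u0 ux0; rewrite mulr_ge0 ?expR_ge0.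
- by apply/measurable_EFinP; apply: measurable_funM => //; exact: measurable_expRNM.
- by apply: measurable_funeM; apply/measurable_EFinP; apply: measurable_expRNM.
by move=> x /=; rewrite in_itv/= andbT lee_fin mulrC => x0; rewrite ler_wpM2r ?expR_ge0 ?uM.
Qed.

(** Tonelli on the region y <= x takes the place of an integration by parts. *)
Let laplace_U a : 0 < a ->
  (\int[mu]_(x in `]0%R, +oo[) (expR (- (a * x)) * U x)%:E = (W a / a)%:E)%E.
Proof.
move=> a0.
pose v := u \_ `]0, +oo[.
have mv : measurable_fun setT v by apply/(measurable_restrictT _ _).1.
have v0 x : 0 <= v x by rewrite /v patchE mem_setE in_itv/= andbT; case: ifP => // /u0.
pose e := (fun x => expR (- (a * x))) \_ `]0, +oo[.
have me : measurable_fun setT e.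
  by apply/(measurable_restrictT _ _).1 => //; exact: measurable_expRNM.
have e0 x : 0 <= e x by rewrite /e patchE; case: ifP => // _; exact: expR_ge0.
pose f (p : R * R) := (e p.1 * v p.2 * (p.2 <= p.1)%R%:R)%:E.
have mf : measurable_fun setT f.
  apply/measurable_EFinP; apply: measurable_funM; last exact: measurable_ler_pair.
  by apply: measurable_funM; exact: measurableT_comp.
have f0 p : (0 <= f p)%E by rewrite lee_fin !mulr_ge0.
transitivity (\int[mu]_x \int[mu]_y f (x, y))%E.
  rewrite [LHS]integral_mkcond; apply: eq_integral => x _.
  rewrite patchE mem_setE in_itv/= andbT; case: ltP => x0; last first.
    rewrite integral0_eq// => y _; rewrite /f /e /= patchE mem_setE in_itv/= andbT ltNge x0/=.
    by rewrite !mul0r.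
  rewrite EFinM UE -ge0_integralZl//=; last 2 first.
  - by apply/measurable_EFinP; apply: measurable_funM => //; apply: measurable_cut.
  - by move=> y; rewrite in_itv/= andbT => /u0 uy; rewrite lee_fin mulr_ge0.
  rewrite [LHS]integral_mkcond; apply: eq_integral => y _.
  rewrite /f /e /v /= !patchE !mem_setE !in_itv/= !andbT x0.
  by case: ifP => _; rewrite ?mulr0 ?mul0r// -EFinM mulrA.
rewrite fubini_tonelli//.
transitivity (\int[mu]_(y in `]0%R, +oo[) ((expR (- (a * y)) * u y)%:E * (a^-1)%:E))%E; last first.
  rewrite ge0_integralZr//=.
  - by rewrite EFinM /W EFin_Rintegral//; exact: iW.
  - by apply: measurable_int (iW a0).
  - by move=> y; rewrite in_itv/= andbT => /u0 uy; rewrite lee_fin mulr_ge0 ?expR_ge0.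
  - by rewrite lee_fin invr_ge0 ltW.
rewrite [RHS]integral_mkcond; apply: eq_integral => y _.
rewrite patchE mem_setE in_itv/= andbT; case: ltP => y0; last first.
  rewrite integral0_eq// => x _; rewrite /f /v /= patchE mem_setE in_itv/= andbT ltNge y0/=.
  by rewrite mulr0 mul0r.
rewrite -EFinM mulrAC (mulrC _ (u y)) EFinM -(integral_expR_tail y a0).
rewrite integral_itv_obnd_cbnd; last by apply/measurable_EFinP; apply: measurable_expRNM.
rewrite -ge0_integralZl//=; last 2 first.
- by apply/measurable_EFinP; apply: measurable_expRNM.
- by rewrite lee_fin u0.
rewrite [RHS]integral_mkcond; apply: eq_integral => x _.
rewrite /f /e /v /= !patchE !mem_setE !in_itv/= !andbT y0.
case: (leP y x) => yx /=; last by rewrite mulr0.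
by rewrite (lt_le_trans y0 yx) mulr1 -EFinM mulrC.
Qed.

Let F t x := U (t * x) / k t^-1.

Let mUM : measurable_fun (`]0, +oo[ : set R) U.
Proof. by apply: nondecreasing_measurable_oy => // x y _; exact: Und. Qed.

Let laplace_F t a : 0 < t -> 0 < a ->
  (\int[mu]_(x in `]0%R, +oo[) (expR (- (a * x)) * F t x)%:E = (W (a / t) / k t^-1 / a)%:E)%E.
Proof.
move=> t0 a0; have at0 : 0 < a / t by rewrite divr_gt0.
have kt : 0 < k t^-1 by rewrite k0 ?invr_gt0.
pose g y := (expR (- (a / t * y)) * U y / k t^-1)%:E.
have mg : measurable_fun (`]0, +oo[ : set R) g.
  apply/measurable_EFinP; apply: measurable_funM => //; apply: measurable_funM; last exact: mUM.
  exact: measurable_expRNM.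
have g0 y : 0 < y -> (0 <= g y)%E.
  by move=> _; rewrite lee_fin !mulr_ge0 ?expR_ge0// invr_ge0 ltW.
have := ge0_integral_scaley t0 mg g0.
have -> : (\int[mu]_(x in `]0%R, +oo[) g x = (W (a / t) / (a / t) / k t^-1)%:E)%E.
  rewrite [RHS]EFinM -laplace_U// -ge0_integralZr//=.
  - by apply/measurable_EFinP; apply: measurable_funM => //; exact: measurable_expRNM.
  - by move=> y _; rewrite lee_fin mulr_ge0 ?expR_ge0.
  - by rewrite lee_fin invr_ge0 ltW.
have -> : (\int[mu]_(x in `]0%R, +oo[) g (t * x)%R =
    \int[mu]_(x in `]0%R, +oo[) (expR (- (a * x)) * F t x)%:E)%E.
  apply: eq_integral => x _; rewrite /g /F mulrA.
  by rewrite divfK ?gt_eqF// [in RHS]mulrA.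
set I := (\int[mu]_(x in _) _)%E => IE.
have : (t^-1%:E * (t%:E * I) = (W (a / t) / k t^-1 / a)%:E)%E.
  rewrite -IE -EFinM; congr EFin; field.
  by rewrite !gt_eqF.
by rewrite muleA -EFinM mulVf ?gt_eqF// mul1e.
Qed.

(** The Laplace transform of [F t] at [a] is W(a/t) / (k(1/t) a). Writing W(a/t) / k(1/t) as the
    product of W(a/t) / k(a/t) and k(a/t) / k(1/t), it tends to A a^(-r) / a, the transform of A x^r
    / Gamma(r + 1). The claim is the resulting convergence at x = 1. *)
Lemma karamata : (\int[mu]_(x in `]0, t]) u x) / k t^-1 @[t --> +oo] --> A / Gamma (r + 1).
Proof.
have G0 := Gamma_gt0 r0.
have c0 : 0 <= A / Gamma (r + 1) by rewrite divr_ge0// ltW.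
have mF t : 0 < t -> monolap (F t).
  move=> t0; have kt : 0 < k t^-1 by rewrite k0 ?invr_gt0.
  split.
  - by move=> x x0; rewrite divr_ge0 ?U0 ?(ltW kt).
  - by move=> x y x0 xy; rewrite ler_pM2r ?invr_gt0// Und// ler_pM2l.
  - move=> a a0; apply: ge0_integrable_lty => //.
    + apply: measurable_funM; first exact: measurable_expRNM.
      apply: nondecreasing_measurable_oy.
      * by move=> x x0; rewrite divr_ge0 ?U0 ?(ltW kt).
      * by move=> x y x0 xy; rewrite ler_pM2r ?invr_gt0// Und// ler_pM2l.
    + by move=> x _; rewrite mulr_ge0 ?expR_ge0// divr_ge0// ltW.
    + by rewrite laplace_F// ltry.
have := @monolap_cvg1 R F (fun x => A / Gamma (r + 1) * x `^ r) mF (monolap_powR c0 r0).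
rewrite powR1 mulr1 (_ : (fun t => F t 1) = (fun t => U t / k t^-1)); last first.
  by apply/funext => t; rewrite /F mulr1.
apply.
- move=> a a0; rewrite Rintegral_powR_expR//.
  have -> : A / Gamma (r + 1) * (a `^ (- r) / a * Gamma (r + 1)) = A * a `^ (- r) / a.
    field.
    by rewrite !gt_eqF.
  have H := cvgM (cvgM (u_laplace a0) (k_regvar a0)) (cvg_cst a^-1).
  apply: cvg_trans (H _ _ _); apply: near_eq_cvg.
  near=> t.
  have t0 : 0 < t by [].
  rewrite [RHS]/Rintegral laplace_F//= /W.
  have : k (a / t) != 0 by rewrite gt_eqF// k0 ?divr_gt0.
  have : k t^-1 != 0 by rewrite gt_eqF// k0 ?invr_gt0.
  move=> kt kat; field.
  by rewrite kt kat !gt_eqF.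
- apply: continuousM; first exact: cst_continuous.
  have H : \forall x \near (1 : R), expR (r * ln x) = x `^ r.
    near=> x; rewrite /powR gt_eqF//; near: x; exact: lt_nbhsr.
  have : {for 1, continuous (fun x : R => expR (r * ln x))}.
    apply: continuous_comp; last exact: continuous_expR.
    by apply: continuousM; [exact: cst_continuous|apply: continuous_ln].
  rewrite /prop_for /continuous_at powR1 ln1 mulr0 expR0 => C.
  by apply: cvg_trans C; exact: near_eq_cvg.
Unshelve. all: by end_near. Qed.

End karamata.
End tauberian.

(** * The inverse subordinator at an exponential time *)

Section levy_tail.
Context {R : realType} (sigma : {measure set R -> \bar R}) (k : R -> R).
Local Notation mu := (@lebesgue_measure R).
Hypothesis sigma_k : kernel_of sigma k.

Let mpos : measurable (`]0%R, +oo[%classic : set R). Proof. exact: measurable_itv. Qed.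

(** Tonelli requires a sigma-finite measure, and [sigma] is controlled only on []0, +oo[]. Its
    restriction is sigma-finite because the tails [k t] are finite. *)
Let sg : set R -> \bar R := mrestr sigma mpos.

HB.instance Definition _ := Measure.on sg.

Let sg_sigma_finite : sigma_finite setT sg.
Proof.
exists (fun n => `]-oo, 0%R]%classic `|` `]n.+1%:R^-1, +oo[%classic).
  apply/seteqP; split => // x _.
  have [x0|x0] := leP x 0; first by exists 0%N => //; left; rewrite /= in_itv.
  have [n nx] : exists n, n.+1%:R^-1 < x.
    by exists (Num.truncn x^-1); rewrite invf_plt ?posrE// truncnS_gt.
  by exists n => //; right; rewrite /= in_itv/= nx.
move=> n; split; first exact: measurableU.
rewrite /sg /mrestr setIUl (_ : _ `&` _ = set0); last first.
  by apply/seteqP; split => x //=; rewrite !in_itv/= andbT => -[] /le_lt_trans /[apply]; rewrite ltxx.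
rewrite set0U (setIidl _) ?sigma_k ?invr_gt0 ?ltry//.
by move=> x /=; rewrite !in_itv/= !andbT; apply: le_lt_trans; rewrite invr_ge0.
Qed.

HB.instance Definition _ := Measure_isSigmaFinite.Build _ _ _ sg sg_sigma_finite.

Let measurable_ltr_pair : measurable_fun setT (fun p : R * R => (p.1 < p.2)%R%:R : R).
Proof.
rewrite (_ : (fun _ => _) = \1_[set p : R * R | p.1 < p.2]); last first.
  by apply/funext => p; rewrite indicE; congr (nat_of_bool _)%:R; apply/idP/idP; rewrite inE.
apply: measurable_indic.
rewrite (_ : [set _ | _] = (fun p : R * R => p.1 < p.2) @^-1` [set true]); last first.
  by apply/seteqP; split.
rewrite -[X in measurable X]setTI.
by apply: measurable_fun_ltr.
Qed.

Let integral_expR_head (l y : R) : 0 < l -> 0 < y ->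
  (\int[mu]_(x in `]0%R, y]) (expR (- (l * x)))%:E = ((1 - expR (- (l * y))) / l)%:E)%E.
Proof.
move=> l0 y0; have := integral_expR_tail 0 l0.
rewrite mulr0 oppr0 expR0 (_ : `]0, +oo[%classic = `]0, y] `|` `]y, +oo[); last first.
  apply/seteqP; split => x /=; rewrite !in_itv/= !andbT.
    by case: (leP x y) => [? ->|]; [left|right].
  by move=> [/andP[]//|]; exact: lt_trans.
rewrite ge0_integral_setU//=; last 2 first.
- by apply/measurable_EFinP; apply: measurable_expRNM.
- apply/disj_setPS => x /= []; rewrite !in_itv/= andbT => /andP[_ /le_lt_trans/[apply]].
  by rewrite ltxx.
rewrite integral_expR_tail//.
case: (\int[mu]_(x in `]0%R, y]) _)%E => [I| |]//= [] H.
by congr EFin; rewrite mulrBl -H addrK.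
Qed.

(** Tonelli on the region 0 < t < y: integrating exp(-l t) over t < y gives (1 - exp(-l y)) / l. *)
Lemma laplace_tail l : 0 < l -> laplace k l = laplace_exponent sigma l / l.
Proof.
move=> l0.
pose e := (fun x => expR (- (l * x))) \_ `]0, +oo[.
have me : measurable_fun setT e.
  by apply/(measurable_restrictT _ _).1 => //; exact: measurable_expRNM.
have e0 x : 0 <= e x by rewrite /e patchE; case: ifP => // _; exact: expR_ge0.
pose f (p : R * R) := (e p.1 * (p.1 < p.2)%R%:R)%:E.
have mf : measurable_fun setT f.
  apply/measurable_EFinP; apply: measurable_funM; last exact: measurable_ltr_pair.
  exact: measurableT_comp.
have f0 p : (0 <= f p)%E by rewrite lee_fin !mulr_ge0.
suff : (\int[mu]_(t in `]0%R, +oo[) (expR (- (l * t)) * k t)%:E =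
    (l^-1)%:E * \int[sigma]_(y in `]0%R, +oo[) (1 - expR (- (l * y)))%:E)%E.
  rewrite /laplace /laplace_exponent /Rintegral => ->.
  have : (0 <= \int[sigma]_(y in `]0%R, +oo[) (1 - expR (- (l * y)))%:E)%E.
    apply: integral_ge0 => y /=; rewrite in_itv/= andbT => y0.
    by rewrite lee_fin subr_ge0 expRN_le1// mulr_ge0// ltW.
  case: (\int[sigma]_(y in _) _)%E => [I| |]// _; first by rewrite /= mulrC.
  (* When the integral against [sigma] is infinite, both real integrals take the default value 0. *)
  by rewrite gt0_muley ?lte_fin ?invr_gt0//= mul0r.
transitivity (\int[mu]_t \int[sg]_y f (t, y))%E.
  rewrite [LHS]integral_mkcond; apply: eq_integral => t _.
  rewrite patchE mem_setE in_itv/= andbT; case: ltP => t0; last first.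
    rewrite integral0_eq// => y _; rewrite /f /e /= patchE mem_setE in_itv/= andbT ltNge t0/=.
    by rewrite mul0r.
  rewrite EFinM -sigma_k//.
  transitivity ((expR (- (l * t)))%:E * \int[sg]_y (\1_(`]t, +oo[%classic) y)%:E)%E.
    rewrite integral_indic//= setIT; congr (_ * _)%E; rewrite /sg /mrestr setIidl//.
    by move=> x /=; rewrite !in_itv/= !andbT; exact: lt_trans.
  rewrite -ge0_integralZl//=.
  - apply: eq_integral => y _; rewrite /f /e /= patchE mem_setE in_itv/= andbT t0 EFinM indicE mem_setE.
    by rewrite in_itv/= andbT.
  - by apply/measurable_EFinP; apply: measurable_indic.
rewrite fubini_tonelli//.
transitivity (\int[sg]_(y in `]0%R, +oo[) ((l^-1)%:E * (1 - expR (- (l * y)))%:E))%E.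
  rewrite [RHS]integral_mkcond; apply: eq_integral => y _.
  rewrite patchE mem_setE in_itv/= andbT; case: ltP => y0; last first.
    rewrite integral0_eq// => t _; rewrite /f /e /= patchE mem_setE in_itv/= andbT.
    case: ltP => t0; last by rewrite mul0r.
    by rewrite ltNge (le_trans y0 (ltW t0)) mulr0.
  rewrite -EFinM mulrC -integral_expR_head//.
  rewrite -integral_itv_bndo_bndc; last by apply/measurable_EFinP; apply: measurable_expRNM.
  rewrite [RHS]integral_mkcond; apply: eq_integral => t _.
  rewrite /f /e /= !patchE !mem_setE !in_itv/= !andbT.
  by case: (ltP 0 t) => t0 /=; rewrite ?mul0r//; case: (ltP t y) => ty; rewrite ?mulr1 ?mulr0.
rewrite ge0_integralZl//=.
- congr (_ * _)%E; apply: eq_measure_integral => A mA AD.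
  by rewrite -[LHS]/(sigma (A `&` _)) setIidl.
- by apply/measurable_EFinP; apply: measurable_funB => //; apply: measurable_expRNM.
- move=> y /=; rewrite in_itv/= andbT => y0.
  by rewrite lee_fin subr_ge0 expRN_le1// mulr_ge0// ltW.
- by rewrite lee_fin invr_ge0 ltW.
Qed.

End levy_tail.

Section exponential_law.
Context {R : realType}.
Local Notation mu := (@lebesgue_measure R).

Lemma exponential_law (l : R) : 0 < l -> exists Q : probability (measurableTypeR R) R,
  forall A, measurable A -> Q A = (\int[mu]_(x in A) (exponential_pdf l x)%:E)%E.
Proof.
move=> l0.
pose Q0 : probability (measurableTypeR R) R := exponential_prob l.
by exists (Q0 l0).
Qed.

Variables (l : R) (Q : probability (measurableTypeR R) R).
Hypotheses (l0 : 0 < l)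
  (QE : forall A, measurable A -> Q A = (\int[mu]_(x in A) (exponential_pdf l x)%:E)%E).

Lemma integral_exponential_law (f : R -> \bar R) : measurable_fun setT f ->
  (forall x, (0 <= f x)%E) ->
  (\int[Q]_x f x = \int[mu]_(x in `]0%R, +oo[) (f x * (l * expR (- (l * x)))%:E))%E.
Proof.
move=> mf f0.
have me : measurable_fun setT (exponential_pdf l) by exact: measurable_exponential_pdf.
have e0 x : 0 <= exponential_pdf l x by apply: exponential_pdf_ge0; exact: ltW.
rewrite (@ge0_integral_density _ _ _ mu Q (exponential_pdf l))//.
rewrite integral_itv_obnd_cbnd; last first.
  apply: emeasurable_funM; first exact: measurable_funTS.
  apply/measurable_EFinP; apply: measurable_funM => //; exact: measurable_expRNM.
rewrite [RHS]integral_mkcond; apply: eq_integral => x _.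
rewrite /exponential_pdf !patchE; case: ifP => _; last by rewrite mule0.
by rewrite mulNr.
Qed.

Lemma exponential_law_tail x : 0 <= x -> Q `]x, +oo[%classic = (expR (- (l * x)))%:E.
Proof.
move=> x0; rewrite QE//.
transitivity (l%:E * \int[mu]_(y in `]x, +oo[) (expR (- (l * y)))%:E)%E; last first.
  rewrite integral_expR_tail// -EFinM; congr EFin; field.
  by rewrite gt_eqF.
rewrite -ge0_integralZl//=.
- apply: eq_integral => y; rewrite inE/= in_itv/= andbT => xy.
  by rewrite exponential_pdfE ?mulNr// (le_trans x0)// ltW.
- by apply/measurable_EFinP; apply: measurable_expRNM.
- by rewrite lee_fin ltW.
Qed.

(** Right rays form a generating pi-system, and the rays [](- n.+1%:R), +oo[], each of mass 1,
    exhaust the line; a measure is thus determined by its tails. *)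
Lemma exponential_law_unique (nu : {measure set (measurableTypeR R) -> \bar R}) :
  (forall x, x < 0 -> nu `]x, +oo[%classic = 1%E) ->
  (forall x, 0 <= x -> nu `]x, +oo[%classic = (expR (- (l * x)))%:E) ->
  forall A, measurable A -> nu A = Q A.
Proof.
move=> nu1 nue.
have Q1 x : x < 0 -> Q `]x, +oo[%classic = 1%E.
  move=> x0; apply/eqP; rewrite eq_le probability_le1//=.
  have <- : Q `](x / 2), +oo[%classic = 1%E.
    rewrite QE// -(@integral_exponential_pdf R l)// [LHS]integral_mkcond.
    apply: eq_integral => y _; rewrite patchE; case: ifPn => //.
    rewrite mem_setE in_itv/= andbT -leNgt => yx.
    by rewrite lt0_exponential_pdf// (le_lt_trans yx)// ltr_pdivrMr// mul0r.
  apply: le_measure; rewrite ?inE//.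
  by move=> y /=; rewrite !in_itv/= !andbT; apply: le_lt_trans; rewrite ler_pdivlMr//; lra.
apply: (@measure_unique _ R (measurableTypeR R) (@RGenOInfty.G R) (fun n => `](- n.+1%:R), +oo[%classic)).
- exact: RGenOInfty.measurableE.
- move=> A B [a ->] [b ->]; exists (Num.max a b).
  apply/seteqP; split => x /=; rewrite !in_itv/= !andbT gt_max; first by move=> [-> ->].
  by move=> /andP[].
- by move=> n; exists (- n.+1%:R).
- apply/seteqP; split => // x _.
  by exists (Num.truncn (- x)) => //=; rewrite in_itv/= andbT ltrNl truncnS_gt.
- move=> A [a ->]; have [a0|a0] := leP 0 a; last first.
    by transitivity (1%E : \bar R); [exact: nu1|apply/esym; exact: Q1].
  transitivity ((expR (- (l * a)))%:E); first exact: nue.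
  by apply/esym; exact: exponential_law_tail.
- move=> n; apply: (@le_lt_trans _ _ (1%E : \bar R)); last exact: ltry.
  by rewrite le_eqVlt; apply/orP; left; apply/eqP; apply: nu1; rewrite oppr_lt0.
Qed.

End exponential_law.

Section inverse_subordinator.
Context {R : realType} d (Omega : measurableType d) (P : probability Omega R).
Variables (S : R -> {RV P >-> R}) (sigma : {measure set R -> \bar R}) (G : R -> R -> R).
Local Notation mu := (@lebesgue_measure R).
Hypothesis subS : subordinator S sigma.
Hypothesis densG : forall t, 0 < t -> inverse_density S t (G t).

Local Notation E := (inverse_subordinator S).

Let S_nd r t w : 0 <= r -> r <= t -> S r w <= S t w.
Proof. by move=> r0 rt; rewrite -subr_ge0; exact: (subordinator_ge0 subS). Qed.

Let E_le r q w : 0 <= q -> r <= S q w -> (E r w <= q%:E)%E.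
Proof. by move=> q0 rq; apply: ge_ereal_inf; exists q%:E => //; exists q. Qed.

Let le_E r q w : S q w < r -> (q%:E <= E r w)%E.
Proof.
move=> Sr; apply: le_ereal_inf_tmp => _ [t [t0 rt] <-]; rewrite lee_fin leNgt.
by apply/negP => /ltW /(S_nd w t0) /(le_trans rt); rewrite leNgt Sr.
Qed.

Let E_ge0 r w : (0 <= E r w)%E.
Proof. by apply: le_ereal_inf_tmp => _ [t [t0 _] <-]; rewrite lee_fin. Qed.

(** Monotone paths reduce the infimum to rational times: E_r(w) < a exactly when r <= S_q(w) for
    some rational q with 0 <= q < a. Measurability in the pair (r, w) is what Tonelli uses later. *)
Let measurable_E : measurable_fun setT (fun p : R * Omega => E p.1 p.2).
Proof.
apply: (measurability _ (ErealGenInftyO.measurableE R)) => // _ [_ [a ->] <-]; rewrite setTI.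
pose B (q : rat) := if (0 <= q) && (ratr q < a) then [set p : R * Omega | p.1 <= S (ratr q) p.2] else set0.
rewrite (_ : _ @^-1` _ = \bigcup_q B q).
  apply: bigcupT_measurable_rat => q; rewrite /B; case: ifP => // _.
  rewrite (_ : [set _ | _] = (fun p : R * Omega => p.1 <= S (ratr q) p.2) @^-1` [set true]); last first.
    by apply/seteqP; split.
  rewrite -[X in measurable X]setTI; apply: measurable_fun_ler => //.
  exact: measurableT_comp.
apply/seteqP; split => [[r w]|[r w] [q _]] /=.
  rewrite in_itv/= => /ereal_inf_lt[_ [t [t0 rt] <-]]; rewrite lte_fin => /rat_in_itvoo[q].
  rewrite in_itv/= => /andP[tq qa]; exists q => //; rewrite /B.
  have q0 : 0 <= q by rewrite -(ler0q R) (le_trans t0)// ltW.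
  by rewrite q0 qa/=; apply: (le_trans rt); apply: S_nd => //; exact: ltW.
rewrite /B; case: ifP => [/andP[q0 qa]/= rS|//]; rewrite in_itv/=.
by apply: (@le_lt_trans _ _ (ratr q)%:E); rewrite ?lte_fin//; apply: E_le => //; rewrite ler0q.
Qed.

(** [fine] sends +oo to 0. For r > 0 this changes E_r only on an event of probability 0, since the
    law of E_r has a density on []0, +oo[]. *)
Let e (p : R * Omega) : R := fine (E p.1 p.2).

Let measurable_e : measurable_fun setT e.
Proof. by apply: measurableT_comp measurable_E; exact: fine_measurable. Qed.

Let e_ge0 p : 0 <= e p. Proof. exact: fine_ge0. Qed.

(** Without path regularity, {S_y < r} is only known to contain {E_r > y} and to be contained in
    {E_r >= y}. The density of E_r gives these two events the same probability. *)
Let P_tail r y : 0 < r -> 0 <= y -> P [set w | y < e (r, w)] = P [set w | S y w < r].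
Proof.
move=> r0 y0; have [mG G0 GE] := densG r0.
have m1 : measurable [set x : \bar R | y%:E < x]%E.
  rewrite (_ : [set _ | _] = `]y%:E, +oo[%classic); first exact: emeasurable_itv.
  by apply/seteqP; split => x /=; rewrite in_itv/= andbT.
have m2 : measurable [set x : \bar R | y%:E <= x]%E.
  rewrite (_ : [set _ | _] = `[y%:E, +oo[%classic); first exact: emeasurable_itv.
  by apply/seteqP; split => x /=; rewrite in_itv/= andbT.
have m3 : measurable (fine @^-1` `]y, +oo[ : set (\bar R)).
  by rewrite -[X in measurable X]setTI; apply: fine_measurable.
have H1 : P [set w | y < e (r, w)] = P (E r @^-1` [set x | y%:E < x]%E).
  transitivity (P (E r @^-1` (fine @^-1` `]y, +oo[))).
    by congr (P _); apply/seteqP; split => w /=; rewrite in_itv/= andbT.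
  rewrite !GE//; congr (\int[mu]_(_ in _) _)%E; apply/seteqP; split => x /=; rewrite ?in_itv/= ?andbT ?lte_fin//.
have H2 : P (E r @^-1` [set x | y%:E < x]%E) = P (E r @^-1` [set x | y%:E <= x]%E).
  rewrite !GE// (_ : _ `&` _ = `]y, +oo[%classic); last first.
    apply/seteqP; split => x /=; rewrite !in_itv/= !andbT lte_fin; first by case.
    by move=> yx; split => //; exact: le_lt_trans yx.
  have [->|yn0] := eqVneq y 0.
    congr (\int[mu]_(_ in _) _)%E; apply/seteqP; split => x /=; rewrite !in_itv/= !andbT lee_fin; last by case.
    by move=> x0; split => //; exact: ltW.
  rewrite integral_itv_obnd_cbnd; last first.
    apply/measurable_EFinP; apply: measurable_funS mG => // x /=.
    by rewrite !in_itv/= !andbT; exact: le_lt_trans.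
  congr (\int[mu]_(_ in _) _)%E; apply/seteqP; split => x /=; rewrite !in_itv/= !andbT lee_fin; last by case.
  by move=> yx; split => //; apply: lt_le_trans yx; rewrite lt_neqAle eq_sym yn0.
have mS : measurable [set w | S y w < r].
  rewrite (_ : [set _ | _] = S y @^-1` `]-oo, r[); last by apply/seteqP; split => w /=; rewrite in_itv.
  by rewrite -[X in measurable X]setTI; exact: measurable_funP.
have mE B : measurable B -> measurable (E r @^-1` B).
  move=> mB; rewrite -[X in measurable X]setTI.
  by apply: (measurableT_comp measurable_E (pair1_measurable r)).
apply/eqP; rewrite eq_le; apply/andP; split.
  rewrite H1; apply: le_measure; rewrite ?inE//; first exact: mE.
  by move=> w /=; apply: contraPP => /negP; rewrite -leNgt => /(E_le y0); rewrite leNgt => /negP.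
rewrite H1 H2; apply: le_measure; rewrite ?inE//; first exact: mE.
by move=> w /=; exact: le_E.
Qed.

Section law.
Variables (l : R).
Hypotheses (l0 : 0 < l) (Phi0 : 0 < laplace_exponent sigma l).
Local Notation Phi := (laplace_exponent sigma l).

(* At an independent exponential time T of rate l the inverse subordinator is
   exponential of rate Phi(l): P(E_T > y) = P(S_y < T) = E(exp(-l S_y)). *)
Lemma integral_inverse_exponential (v : R -> \bar R) :
  measurable_fun setT v -> (forall x, (0 <= v x)%E) ->
  (\int[mu]_(r in `]0%R, +oo[) (\int[P]_w v (e (r, w)) * (l * expR (- (l * r)))%:E) =
   \int[mu]_(x in `]0%R, +oo[) (v x * (Phi * expR (- (Phi * x)))%:E))%E.
Proof.
move=> mv v0.
have [Q QE] := exponential_law l0.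
have [Q' Q'E] := exponential_law Phi0.
pose nu0 : {measure set (measurableTypeR R) -> \bar R} := pushforward (Q \x P)%E (e : measurableTypeR R * Omega -> measurableTypeR R).
pose nu := nu0 measurable_e.
have nuE A : measurable A -> nu A = (\int[mu]_(r in `]0%R, +oo[) (P [set w | A (e (r, w))] * (l * expR (- (l * r)))%:E))%E.
  move=> mA.
  have mA' : measurable (e @^-1` A) by rewrite -[X in measurable X]setTI; exact: measurable_e.
  transitivity (\int[Q]_r P (xsection (e @^-1` A) r))%E => //.
  rewrite (integral_exponential_law l0 QE)//; last exact: measurable_fun_xsection.
  apply: eq_integral => r _; congr (P _ * _)%E.
  by apply/seteqP; split => w; rewrite /xsection/= inE.
have nuQ' A : measurable A -> nu A = Q' A.
  apply: (exponential_law_unique Phi0 Q'E) => x x0.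
    rewrite -[LHS]/((Q \x P)%E (e @^-1` `]x, +oo[)) (_ : _ @^-1` _ = setT) ?probability_setT//.
    by apply/seteqP; split => // p _ /=; rewrite in_itv/= andbT (lt_le_trans x0).
  rewrite nuE//.
  transitivity (\int[mu]_(r in `]0%R, +oo[) (P [set w | S x w < r]%R * (l * expR (- (l * r)))%:E))%E.
    apply: eq_integral => r; rewrite inE/= in_itv/= andbT => r0; rewrite -P_tail//.
    by congr (P _ * _)%E; apply/seteqP; split => w /=; rewrite in_itv/= andbT.
  pose B := [set p : R * Omega | S x p.2 < p.1].
  have mB : measurable B.
    rewrite (_ : B = (fun p : R * Omega => S x p.2 < p.1) @^-1` [set true]); last first.
      by apply/seteqP; split.
    rewrite -[X in measurable X]setTI; apply: measurable_fun_ltr => //.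
    exact: measurableT_comp.
  transitivity (\int[Q]_r P (xsection B r))%E.
    rewrite (integral_exponential_law l0 QE)//; last exact: measurable_fun_xsection.
    apply: eq_integral => r _; congr (P _ * _)%E.
    by apply/seteqP; split => w; rewrite /xsection/= inE.
  transitivity (\int[P]_w Q (ysection B w))%E.
    have := @indic_fubini_tonelli _ _ _ _ R Q P B mB.
    rewrite indic_fubini_tonelli_FE// indic_fubini_tonelli_GE//.
  have := subordinator_laplace subS x0 l0; rewrite unlock (mulrC Phi) => <-.
  apply: eq_integral => w _; rewrite -(exponential_law_tail l0 QE)//.
    by congr (Q _); apply/seteqP; split => r; rewrite /ysection/= inE in_itv/= andbT.
  by have := subordinator0 subS w; move=> <-; exact: S_nd.
rewrite -(integral_exponential_law Phi0 Q'E)//.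
transitivity (\int[nu]_x v x)%E; last first.
  by apply: eq_measure_integral => A mA _; exact: nuQ'.
rewrite -[RHS]/(\int[pushforward (Q \x P)%E (e : measurableTypeR R * Omega -> measurableTypeR R)]_x v x)%E.
rewrite ge0_integral_pushforward//= preimage_setT fubini_tonelli1//; last first.
  exact: measurableT_comp.
rewrite (integral_exponential_law l0 QE)//.
- by apply: measurable_fun_fubini_tonelli_F => //; exact: measurableT_comp.
- by move=> x; apply: integral_ge0.
Qed.

End law.

Lemma integral_inverse_density (v : R -> \bar R) r : 0 < r ->
  measurable_fun setT v -> (forall x, (0 <= v x)%E) ->
  (\int[P]_w v (e (r, w)) = \int[mu]_(x in `]0%R, +oo[) (v x * (G r x)%:E))%E.
Proof.
move=> r0 mv v0; have [mG G0 GE] := densG r0.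
have mer : measurable_fun setT (fun w => e (r, w) : measurableTypeR R).
  exact: (measurableT_comp measurable_e (pair1_measurable r)).
pose nu0 : {measure set (measurableTypeR R) -> \bar R} := pushforward P (fun w => e (r, w) : measurableTypeR R).
pose nu := nu0 mer.
pose g := G r \_ `]0, +oo[.
have mg : measurable_fun setT g by apply/(measurable_restrictT _ _).1.
have g0 x : 0 <= g x by rewrite /g patchE mem_setE in_itv/= andbT; case: ifP => // /G0.
transitivity (\int[nu]_x v x)%E.
  rewrite -[RHS]/(\int[pushforward P (fun w => e (r, w) : measurableTypeR R)]_x v x)%E.
  by rewrite ge0_integral_pushforward.
rewrite (@ge0_integral_density _ _ _ mu nu g)//.
  rewrite [RHS]integral_mkcond; apply: eq_integral => x _.
  by rewrite /g !patchE; case: ifP => // _; rewrite mule0.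
move=> A mA; transitivity (P (E r @^-1` (fine @^-1` A))) => //.
rewrite GE; last by rewrite -[X in measurable X]setTI; apply: fine_measurable.
rewrite [LHS]integral_mkcond [RHS]integral_mkcond; apply: eq_integral => x _.
rewrite !patchE in_setI (_ : (x \in EFin @^-1` (fine @^-1` A)) = (x \in A)).
  by rewrite /g patchE; case: (x \in A); case: (x \in _).
by apply/idP/idP; rewrite !inE.
Qed.

Variables (v : R -> R) (M : R).
Hypotheses (mv : measurable_fun (`]0, +oo[ : set R) v)
  (v0 : forall x, 0 < x -> 0 <= v x) (vM : forall x, 0 < x -> v x <= M).

Let v' : R -> \bar R := (EFin \o v) \_ `]0, +oo[.

Let mv' : measurable_fun setT v'.
Proof. by apply/(measurable_restrictT _ _).1 => //; exact/measurable_EFinP. Qed.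

Let v'0 x : (0 <= v' x)%E.
Proof. by rewrite /v' patchE mem_setE in_itv/= andbT; case: ifP => // /v0. Qed.

Let subE r : 0 < r -> (\int[P]_w v' (e (r, w)) = \int[mu]_(x in `]0%R, +oo[) (v x * G r x)%:E)%E.
Proof.
move=> r0; rewrite integral_inverse_density//; apply: eq_integral => x x0.
by rewrite /v' patchE x0 EFinM.
Qed.

Let M0 : 0 <= M. Proof. exact: le_trans (v0 ltr01) (vM ltr01). Qed.

Let sub_le r : 0 < r -> (\int[P]_w v' (e (r, w)) <= M%:E)%E.
Proof.
move=> r0; rewrite -[leRHS]mule1 -(probability_setT P) -integral_cst//.
apply: ge0_le_integral => //.
- by apply: (measurableT_comp mv'); exact: (measurableT_comp measurable_e (pair1_measurable r)).
- move=> w _; rewrite /v' patchE mem_setE in_itv/= andbT; case: ifP => [/vM|_]; by rewrite lee_fin.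
Qed.

Lemma subordinatedE r : 0 < r -> (subordinated v G r)%:E = (\int[P]_w v' (e (r, w)))%E.
Proof.
move=> r0; rewrite /subordinated /Rintegral -subE// fineK// ge0_fin_numE ?integral_ge0//.
by rewrite (le_lt_trans (sub_le r0))// ltry.
Qed.

Lemma subordinated_ge0 r : 0 < r -> 0 <= subordinated v G r.
Proof. by move=> r0; rewrite -lee_fin subordinatedE// integral_ge0. Qed.

Lemma subordinated_le r : 0 < r -> subordinated v G r <= M.
Proof. by move=> r0; rewrite -lee_fin subordinatedE// sub_le. Qed.

(** Measurability in [r] is read off from the expectation of v(E_r), where the integrand is jointly
    measurable; the integral against [G r] gives no access to it. *)
Lemma measurable_subordinated : measurable_fun (`]0, +oo[ : set R) (subordinated v G).
Proof.
apply/measurable_EFinP.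
apply: (eq_measurable_fun (fun r => \int[P]_w v' (e (r, w)))%E).
  by move=> r; rewrite inE/= in_itv/= andbT => r0; rewrite -subordinatedE.
apply: measurable_funTS.
apply: (measurable_fun_fubini_tonelli_F (fun p => v' (e p))) => //.
exact: measurableT_comp.
Qed.

(** The identity at exponential times carries the normalising factors [l] and Phi of the two
    exponential densities; their ratio is the prefactor. *)
Lemma laplace_subordinated l : 0 < l -> 0 < laplace_exponent sigma l ->
  (\int[mu]_(r in `]0%R, +oo[) (expR (- (l * r)) * subordinated v G r)%:E =
  (laplace_exponent sigma l / l)%:E *
  \int[mu]_(x in `]0%R, +oo[) (expR (- (laplace_exponent sigma l * x)) * v x)%:E)%E.
Proof.
move=> l0 Phi0.
have := integral_inverse_exponential l0 Phi0 mv' v'0.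
set Phi := laplace_exponent sigma l in Phi0 *.
have -> : (\int[mu]_(r in `]0%R, +oo[) (\int[P]_w v' (e (r, w)) * (l * expR (- (l * r)))%:E) =
  l%:E * \int[mu]_(r in `]0%R, +oo[) (expR (- (l * r)) * subordinated v G r)%:E)%E.
  rewrite -ge0_integralZl//=.
  - apply: eq_integral => r; rewrite inE/= in_itv/= andbT => r0.
    by rewrite -subordinatedE// -!EFinM; congr EFin; ring.
  - apply/measurable_EFinP; apply: measurable_funM; [exact: measurable_expRNM|exact: measurable_subordinated].
  - by move=> r /=; rewrite in_itv/= andbT lee_fin => /subordinated_ge0 r0; rewrite mulr_ge0 ?expR_ge0.
  - by rewrite lee_fin ltW.
have -> : (\int[mu]_(x in `]0%R, +oo[) (v' x * (Phi * expR (- (Phi * x)))%:E) =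
  Phi%:E * \int[mu]_(x in `]0%R, +oo[) (expR (- (Phi * x)) * v x)%:E)%E.
  rewrite -ge0_integralZl//=.
  - apply: eq_integral => r r0.
    by rewrite /v' patchE r0 -!EFinM; congr EFin; ring.
  - by apply/measurable_EFinP; apply: measurable_funM => //; exact: measurable_expRNM.
  - by move=> r /=; rewrite in_itv/= andbT lee_fin => /v0 r0; rewrite mulr_ge0 ?expR_ge0.
  - by rewrite lee_fin ltW.
move=> /(congr1 (fun z => (l^-1)%:E * z)%E); rewrite !muleA -!EFinM mulVf ?gt_eqF// mul1e => ->.
by rewrite mulrC.
Qed.

End inverse_subordinator.

(** * Long-time averages of subordinated functions *)

Section subordinated_average.
Context {R : realType}.
Local Notation mu := (@lebesgue_measure R).

Lemma cvg_at_right0 (T : Type) (F : set_system T) (FF : Filter F) (f : T -> R) :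
  f x @[x --> F] --> (0 : R) -> (\forall x \near F, 0 < f x) -> f x @[x --> F] --> 0^'+.
Proof.
move=> /cvgrPdist_lt f0 fp A [e /= e0 eA].
apply: filterS2 (f0 e e0) fp => x xe xp.
by apply: eA.
Qed.

Lemma cvg_divr_pinfty (c : R) : 0 < c -> c / t @[t --> +oo] --> 0^'+.
Proof.
move=> c0 A [e /= e0 eA]; exists (c / e); split; first exact: num_real.
move=> t ct; have t0 : 0 < t by rewrite (lt_trans _ ct)// divr_gt0.
apply: eA; rewrite /= ?divr_gt0// sub0r normrN gtr0_norm ?divr_gt0//.
by rewrite ltr_pdivrMr// mulrC -ltr_pdivrMr.
Qed.

Lemma cvg_laplace0 (v : R -> R) : mu.-integrable `]0, +oo[ (EFin \o v) ->
  \int[mu]_(x in `]0, +oo[) (expR (- (p * x)) * v x) @[p --> 0^'+] --> \int[mu]_(x in `]0, +oo[) v x.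
Proof.
move=> iv; have mv : measurable_fun (`]0, +oo[ : set R) v by apply/measurable_EFinP; exact: measurable_int iv.
apply/cvg_at_rightP => p [p0 cp].
have mf n : measurable_fun (`]0, +oo[ : set R) (fun x => (expR (- (p n * x)) * v x)%:E).
  by apply/measurable_EFinP; apply: measurable_funM => //; exact: measurable_expRNM.
have ian := integrable_abse iv.
have [] := @dominated_convergence _ _ _ mu (`]0%R, +oo[ : set R) (measurable_itv _)
  (fun n x => (expR (- (p n * x)) * v x)%:E) (EFin \o v) (abse \o (EFin \o v)) mf.
- exact/measurable_EFinP.
- apply: aeW => x _; apply/fine_cvgP; split; first exact: nearW.
  rewrite -[X in _ --> X]mul1r; apply: cvgMl.
  have -> : 1 = expR (- (0 * x)) :> R by rewrite mul0r oppr0 expR0.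
  apply: (@cvg_comp _ _ _ (fun n => - (p n * x)) expR); last exact: continuous_expR.
  by apply: cvgN; apply: cvgMl.
- exact: ian.
- apply: aeW => x n; rewrite /= in_itv/= andbT => x0.
  by rewrite lee_fin normrM ger0_norm ?expR_ge0// ler_piMl// expRN_le1// mulr_ge0// ltW.
move=> _ _ H; apply: fine_cvg.
by rewrite EFin_Rintegral.
Qed.

Context d (Omega : measurableType d) (P : probability Omega R).
Variables (S : R -> {RV P >-> R}) (sigma : {measure set R -> \bar R}) (k : R -> R) (G : R -> R -> R)
  (rho : R) (v : R -> R) (M : R).
Hypotheses (subS : subordinator S sigma) (sigma_k : kernel_of sigma k)
  (densG : forall t, 0 < t -> inverse_density S t (G t))
  (lk0 : l * laplace k l @[l --> 0^'+] --> (0 : R)) (rho0 : 0 <= rho)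
  (svL : slowly_varying (fun x => x `^ (- rho) * laplace k x^-1))
  (v0 : forall x, 0 < x -> 0 <= v x) (vM : forall x, 0 < x -> v x <= M)
  (iv : mu.-integrable `]0, +oo[ (EFin \o v)).

Let laplace_gt0 l : 0 < l -> 0 < laplace k l.
Proof.
move=> l0; have [/(_ l^-1) + _ _] := svL; rewrite invr_gt0 invrK => /(_ l0).
by rewrite pmulr_rgt0// powR_gt0// invr_gt0.
Qed.

(** Slow variation is applied with the factor [c^-1], because c / t is the inverse of c^-1 t. *)
Let laplace_regvar c : 0 < c -> laplace k (c / t) / laplace k t^-1 @[t --> +oo] --> c `^ (- rho).
Proof.
move=> c0; have ci0 : 0 < c^-1 by rewrite invr_gt0.
have [_ _ /(_ _ ci0) H] := svL.
have H' : c `^ (- rho) * ((c^-1 * x) `^ (- rho) * laplace k (c^-1 * x)^-1 /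
    (x `^ (- rho) * laplace k x^-1)) @[x --> +oo] --> c `^ (- rho) * 1.
  by apply: cvgMr; exact: H.
rewrite mulr1 in H'; apply: cvg_trans H'; apply: near_eq_cvg.
near=> t.
have t0 : 0 < t by [].
rewrite invfM invrK powRM ?ltW//.
have E : c `^ (- rho) * c^-1 `^ (- rho) = 1.
  by rewrite -powRM ?ltW// mulfV ?gt_eqF// powR1.
have tp : t `^ (- rho) != 0 by rewrite gt_eqF// powR_gt0.
have kp : laplace k t^-1 != 0 by rewrite gt_eqF// laplace_gt0// invr_gt0.
rewrite !mulrA E mul1r; field.
by rewrite tp kp.
Unshelve. all: by end_near. Qed.

Lemma subordinated_average :
  (t^-1 * \int[mu]_(r in `]0, t]) subordinated v G r) / (t^-1 * laplace k t^-1) @[t --> +oo]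
    --> (\int[mu]_(x in `]0, +oo[) v x) / Gamma (rho + 1).
Proof.
have mv : measurable_fun (`]0, +oo[ : set R) v by apply/measurable_EFinP; exact: measurable_int iv.
have H : (\int[mu]_(r in `]0, t]) subordinated v G r) / laplace k t^-1 @[t --> +oo]
    --> (\int[mu]_(x in `]0, +oo[) v x) / Gamma (rho + 1).
  apply: (@karamata _ _ _ M) => //.
  - exact: (measurable_subordinated subS densG mv v0 vM).
  - exact: (subordinated_ge0 subS densG mv v0 vM).
  - exact: (subordinated_le subS densG mv v0 vM).
  - by apply: Rintegral_ge0 => x; rewrite /= in_itv/= andbT; exact: v0.
  move=> c c0.
  (* Chain of limits: c / t tends to 0 from the right, hence so does Phi = l K(l) at l = c / t, and
     the Laplace transform of [v] at Phi tends to the integral of [v]. *)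
  have H1 := cvg_comp _ _ (cvg_divr_pinfty c0) (cvg_comp _ _ (cvg_at_right0 _ lk0 _) (cvg_laplace0 iv)).
  have lkp : \forall x \near 0^'+, 0 < x * laplace k x.
    by near=> x; rewrite mulr_gt0// laplace_gt0.
  have {}H1 := H1 _ lkp.
  apply: cvg_trans (H1 _); apply: near_eq_cvg; near=> t.
  have t0 : 0 < t by [].
  have ct : 0 < c / t by rewrite divr_gt0.
  (* The prefactor Phi(l) / l is K(l), so division by K(c / t) leaves exactly the Laplace transform
     of [v] at Phi. *)
  have Phi : laplace_exponent sigma (c / t) = c / t * laplace k (c / t).
    by rewrite (laplace_tail sigma_k ct) [RHS]mulrC divfK ?gt_eqF.
  have Phi0 : 0 < laplace_exponent sigma (c / t) by rewrite Phi mulr_gt0// laplace_gt0.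
  rewrite /= [in RHS]/Rintegral (laplace_subordinated subS densG mv v0 vM ct Phi0) Phi.
  rewrite (mulrC (c / t)) mulfK ?gt_eqF//.
  set I := (\int[mu]_(x in _) _)%E.
  have : laplace k (c / t) != 0 by rewrite gt_eqF// laplace_gt0.
  rewrite /Rintegral (_ : (\int[mu]_(x in `]0%R, +oo[) _)%E = I); last first.
    by rewrite /I; under eq_integral do rewrite (mulrC (laplace k _)).
  have If : I \is a fin_num.
    apply: integrable_fin_num => //; apply: (le_integrable _ _ _ iv) => //.
      by apply/measurable_EFinP; apply: measurable_funM => //; exact: measurable_expRNM.
    move=> x /=; rewrite in_itv/= andbT => x0.
    rewrite lee_fin normrM ger0_norm ?expR_ge0// ler_piMl// expRN_le1// mulr_ge0 ?(ltW x0)//.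
    by rewrite mulr_ge0 ?(ltW ct)// ltW// laplace_gt0.
  by rewrite -(fineK If)/= => kp; field.
apply: cvg_trans H; apply: near_eq_cvg; near=> t.
have t0 : 0 < t by [].
have kp : laplace k t^-1 != 0 by rewrite gt_eqF// laplace_gt0// invr_gt0.
by field; rewrite kp gt_eqF.
Unshelve. all: by end_near. Qed.

End subordinated_average.

(** * Fourier transforms of Gaussians *)

Section gaussian1.
Context {R : realType}.
Local Notation mu := (@lebesgue_measure R).

Lemma ge0_integral_reflect (f : R -> \bar R) : measurable_fun setT f -> (forall x, (0 <= f x)%E) ->
  (\int[mu]_x f (- x)%R = \int[mu]_x f x)%E.
Proof.
move=> mf f0.
have mN : measurable_fun setT (-%R : measurableTypeR R -> measurableTypeR R).
  by apply: continuous_measurable_fun => x; apply: continuousN; exact: cvg_id.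
rewrite [RHS](@eq_measure_integral _ _ _ _ (pushforward mu (-%R : measurableTypeR R -> measurableTypeR R))); last first.
  by move=> A mA _; apply/esym; exact: lebesgue_measureN.
by rewrite ge0_integral_pushforward.
Qed.

Variable t : R.
Hypothesis t0 : 0 < t.

Local Notation g := (fun a : R => expR (- (t * a ^+ 2))).

Let mg : measurable_fun setT g.
Proof.
apply: measurableT_comp => //; apply: measurableT_comp => //.
by apply: measurable_funM => //; exact: measurable_funX.
Qed.

Lemma integral_gaussian : (\int[mu]_a (g a)%:E = (Num.sqrt (pi / t))%:E)%E.
Proof.
have st : 0 < Num.sqrt t by rewrite sqrtr_gt0.
have := @integralT_gauss R.
rewrite (ge0_integral_scale st); last 2 first.
- by apply/measurable_EFinP; exact: measurable_gauss_fun.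
- by move=> x; rewrite lee_fin gauss_fun_ge0.
have -> : (\int[mu]_x (gauss_fun (Num.sqrt t * x))%:E = \int[mu]_a (g a)%:E)%E.
  by apply: eq_integral => x _; rewrite /gauss_fun exprMn sqr_sqrtr// ltW.
case: (\int[mu]_a _)%E => [I| |].
- move=> [H]; congr EFin; rewrite sqrtrM ?pi_ge0// -H sqrtrV ?ltW//.
  by rewrite mulrC mulKf ?gt_eqF.
- by rewrite gt0_muley ?lte_fin.
- by rewrite gt0_muleNy ?lte_fin.
Qed.

Let ig : mu.-integrable setT (EFin \o g).
Proof.
by apply: ge0_integrable_lty => //; rewrite integral_gaussian ltry.
Qed.

Lemma integrable_gaussian_bounded (h : R -> R) (C : R) : measurable_fun setT h ->
  (forall a, `|h a| <= C) -> mu.-integrable setT (EFin \o (fun a => h a * g a)).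
Proof.
move=> mh hC; have := @integrableZl _ _ _ mu _ measurableT C _ ig.
apply: le_integrable => //.
  by apply/measurable_EFinP; exact: measurable_funM.
move=> a _ /=; rewrite lee_fin !normrM (ger0_norm (expR_ge0 _)) ler_wpM2r ?expR_ge0//.
exact: le_trans (hC a) (ler_norm _).
Qed.

End gaussian1.

Section gaussian1_fourier.
Context {R : realType}.
Local Notation mu := (@lebesgue_measure R).
Variable t : R.
Hypothesis t0 : 0 < t.

Local Notation g := (fun a : R => expR (- (t * a ^+ 2))).

Let mg : measurable_fun setT g.
Proof.
apply: measurableT_comp => //; apply: measurableT_comp => //.
by apply: measurable_funM => //; exact: measurable_funX.
Qed.

(** Half of the exponent is spent on absorbing |a|. The constant 1 + 2 / t makes (1 + 2 / t) (1 + t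
    a^2 / 2) dominate 1 + a^2, which in turn dominates |a|. *)
Let g_half a : `|a| * g a <= (1 + 2 / t) * expR (- (t / 2 * a ^+ 2)).
Proof.
have -> : g a = expR (- (t / 2 * a ^+ 2)) * expR (- (t / 2 * a ^+ 2)).
  by rewrite -expRD; congr expR; field.
rewrite mulrA ler_wpM2r ?expR_ge0// expRN ler_pdivrMr ?expR_gt0//.
have H1 : `|a| <= 1 + a ^+ 2.
  rewrite -(real_normK (num_real a)) -subr_ge0.
  have -> : 1 + `|a| ^+ 2 - `|a| = (`|a| - 2^-1) ^+ 2 + 3 / 4 by field.
  by rewrite addr_ge0// ?sqr_ge0// divr_ge0.
apply: (le_trans H1); apply: (@le_trans _ _ ((1 + 2 / t) * (1 + t / 2 * a ^+ 2))).
  have -> : (1 + 2 / t) * (1 + t / 2 * a ^+ 2) = 1 + a ^+ 2 + (2 / t + t / 2 * a ^+ 2).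
    by field; rewrite gt_eqF.
  rewrite lerDl; apply: addr_ge0; first by apply: divr_ge0 => //; exact: ltW.
  by apply: mulr_ge0; [apply: divr_ge0 => //; exact: ltW|exact: sqr_ge0].
by rewrite ler_wpM2l ?addr_ge0 ?divr_ge0 ?(ltW t0)// expR_ge1Dx.
Qed.

Let t20 : 0 < t / 2. Proof. by rewrite divr_gt0. Qed.

Let iag (h : R -> R) : measurable_fun setT h -> (forall a, `|h a| <= `|a|) ->
  mu.-integrable setT (EFin \o (fun a => h a * g a)).
Proof.
move=> mh ha.
have := @integrable_gaussian_bounded R _ t20 (cst (1 + 2 / t)) `|1 + 2 / t| (measurable_cst _) (fun=> lexx _).
apply: le_integrable => //.
  by apply/measurable_EFinP; exact: measurable_funM.
move=> a _ /=; rewrite lee_fin normrM (ger0_norm (expR_ge0 _)) [leRHS]ger0_norm; last first.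
  by rewrite mulr_ge0 ?expR_ge0// addr_ge0// divr_ge0// ltW.
by apply: le_trans (g_half a); rewrite ler_wpM2r ?expR_ge0.
Qed.

Let mcos x : measurable_fun setT (fun a : R => cos (x * a)).
Proof.
apply: (measurableT_comp (continuous_measurable_fun (@continuous_cos R))).
exact: measurable_funM.
Qed.

Let msin x : measurable_fun setT (fun a : R => sin (x * a)).
Proof.
apply: (measurableT_comp (continuous_measurable_fun (@continuous_sin R))).
exact: measurable_funM.
Qed.

Let ic x : mu.-integrable setT (EFin \o (fun a => cos (x * a) * g a)).
Proof. by apply: (integrable_gaussian_bounded t0 (C := 1)) => // a; exact: cos_max. Qed.

Let isn x : mu.-integrable setT (EFin \o (fun a => sin (x * a) * g a)).
Proof. by apply: (integrable_gaussian_bounded t0 (C := 1)) => // a; exact: sin_max. Qed.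

Let ias x : mu.-integrable setT (EFin \o (fun a => (- a * sin (x * a)) * g a)).
Proof.
apply: iag; first by apply: measurable_funM.
by move=> a; rewrite normrM normrN ler_piMr// sin_max.
Qed.

Let g0 : mu.-integrable setT (EFin \o g).
Proof.
by have := ic 0; rewrite (_ : (fun a => cos (0 * a) * _) = g)//; apply/funext => a; rewrite mul0r cos0 mul1r.
Qed.

Let J x := \int[mu]_a (cos (x * a) * g a).
Let J1 x := \int[mu]_a ((- a * sin (x * a)) * g a).

Let dJ (x : R) : is_derive x 1 J (J1 x).
Proof.
pose f := fun x a : R => cos (x * a) * g a.
pose H := fun a => `|a| * g a.
have pf (y a : R) : is_derive y 1 (f^~ a) ((- a * sin (y * a)) * g a).
  rewrite /f; apply: trigger_derive; rewrite /GRing.scale/=.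
  ring.
have pE (y a : R) : partial1of2 f y a = (- a * sin (y * a)) * g a.
  by rewrite partial1of2E derive_val.
have Ia : `](x - 1), (x + 1)[%classic x by rewrite /= in_itv/= ltrBlDr !ltrDl ltr01.
have intf y : `](x - 1), (x + 1)[%classic y -> mu.-integrable setT (EFin \o f y) by move=> _; exact: ic.
have derf (y a : R) : `](x - 1), (x + 1)[%classic y -> setT a -> derivable (f^~ a) y 1.
  by move=> _ _; exact: ex_derive.
have H0 a : 0 <= H a by rewrite mulr_ge0 ?expR_ge0.
have iH : mu.-integrable setT (EFin \o H).
  by apply: iag => //; move=> a; rewrite normr_id.
have Hub (y a : R) : `](x - 1), (x + 1)[%classic y -> setT a -> `|partial1of2 f y a| <= H a.
  move=> _ _; rewrite pE normrM (ger0_norm (expR_ge0 _)) ler_wpM2r ?expR_ge0//.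
  by rewrite normrM normrN ler_piMr// sin_max.
have D1 := derivable_under_integral measurableT Ia intf derf H0 iH Hub.
have D2 := differentiation_under_integral measurableT Ia intf derf H0 iH Hub.
have -> : J1 x = \int[mu]_(y in setT) (partial1of2 f x y).
  by apply: eq_Rintegral => a _; rewrite pE.
rewrite -D2 derive1E; exact: DeriveDef.
Qed.

(* The integral over R of the derivative of sin(x a) exp(-t a^2) vanishes. *)
Let parts (x : R) : x * J x + 2 * t * J1 x = 0.
Proof.
pose H a := sin (x * a) * g a.
pose h a := x * (cos (x * a) * g a) + 2 * t * ((- a * sin (x * a)) * g a).
have dH (a : R) : is_derive a 1 H (h a).
  apply: trigger_derive; rewrite /h /GRing.scale/=.
  ring.
have ih : mu.-integrable setT (EFin \o h).
  apply: integrable_funrD => //.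
    exact: (@integrableZl _ _ _ mu _ measurableT x _ (ic x)).
  exact: (@integrableZl _ _ _ mu _ measurableT (2 * t) _ (ias x)).
have <- : \int[mu]_a h a = x * J x + 2 * t * J1 x.
  rewrite RintegralD//.
  - by rewrite RintegralZl// RintegralZl.
  - exact: (@integrableZl _ _ _ mu _ measurableT x _ (ic x)).
  - exact: (@integrableZl _ _ _ mu _ measurableT (2 * t) _ (ias x)).
have mh : measurable_fun setT h by apply/measurable_EFinP; exact: measurable_int ih.
have ch : continuous h.
  move=> a; apply/differentiable_continuous; apply/derivable1_diffP; rewrite /h.
  exact: ex_derive.
have FTC n : (\int[mu]_(a in `[(- n.+1%:R)%R, n.+1%:R]) (h a)%:E = (H n.+1%:R - H (- n.+1%:R))%:E)%E.
  rewrite (@continuous_FTC2 _ h H)//.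
  - by rewrite gtrN// ltr0n.
  - exact: continuous_subspaceT.
  - split.
    + by move=> a _; exact: ex_derive.
    + by apply: cvg_at_right_filter; apply: differentiable_continuous; apply/derivable1_diffP; exact: ex_derive.
    + by apply: cvg_at_left_filter; apply: differentiable_continuous; apply/derivable1_diffP; exact: ex_derive.
  - by move=> a _; rewrite derive1E derive_val.
have mi n : measurable_fun setT (fun a : R => (h a * \1_(`[(- n.+1%:R)%R, n.+1%:R]%classic) a)%:E).
  by apply/measurable_EFinP; apply: measurable_funM => //; exact: measurable_indic.
have [] := @dominated_convergence _ _ _ mu setT measurableT
  (fun n a => (h a * \1_(`[(- n.+1%:R)%R, n.+1%:R]%classic) a)%:E) (EFin \o h) (abse \o (EFin \o h)) mi.
- exact/measurable_EFinP.
- apply: aeW => a _; apply: cvg_near_cst.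
  near=> n; rewrite indicE mem_set ?mulr1//= in_itv/= -ler_norml.
  near: n; exists (Num.truncn `|a|) => // n /= na.
  by rewrite (le_trans (ltW (truncnS_gt _)))// ler_nat ltnS.
- exact: integrable_abse ih.
- apply: aeW => a n _; rewrite lee_fin normrM ler_piMr// indicE.
  by case: (_ \in _); rewrite ?normr1 ?normr0.
move=> _ _ L.
have L0 : (\int[mu]_a (h a * \1_(`[(- n.+1%:R)%R, n.+1%:R]%classic) a)%:E)%E @[n --> \oo] --> 0%E.
  have -> : (fun n => \int[mu]_a (h a * \1_(`[(- n.+1%:R)%R, n.+1%:R]%classic) a)%:E)%E =
      (fun n => (H n.+1%:R - H (- n.+1%:R))%:E).
    apply/funext => n; rewrite -FTC [RHS]integral_mkcond; apply: eq_integral => a _.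
    by rewrite patchE indicE; case: ifP; rewrite ?mulr1 ?mulr0.
  apply/fine_cvgP; split; first exact: nearW.
  apply: (@squeeze_cvgr _ _ _ _ (fun n => - (2 * expR (- t) ^+ n.+1)) (fun n => 2 * expR (- t) ^+ n.+1)).
  - near=> n; rewrite -ler_norml.
    rewrite (le_trans (ler_normB _ _))// mulr_natl mulr2n.
    have Hn (y : R) : `|y| = n.+1%:R -> `|H y| <= expR (- t) ^+ n.+1.
      move=> yn; rewrite /H normrM (ger0_norm (expR_ge0 _)).
      apply: (@le_trans _ _ (g y)); first by rewrite ler_piMl ?expR_ge0 ?sin_max.
      rewrite -expRM_natl ler_expR mulrN lerN2 -[in leRHS](real_normK (num_real y)) yn mulrC.
      by rewrite ler_wpM2l ?(ltW t0)// expr2 ler_peMr// ler1n.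
    by apply: lerD; apply: Hn; rewrite ?normrN ger0_norm.
  - rewrite -[X in _ --> X]oppr0 -(mulr0 2); apply: cvgN; apply: cvgMr.
    rewrite (cvg_shiftS (fun n => expR (- t) ^+ n)); apply: cvg_expr.
    by rewrite ger0_norm ?expR_ge0// expRN_lt1.
  - rewrite -(mulr0 2); apply: cvgMr.
    rewrite (cvg_shiftS (fun n => expR (- t) ^+ n)); apply: cvg_expr.
    by rewrite ger0_norm ?expR_ge0// expRN_lt1.
by have := cvg_unique _ L L0; rewrite /Rintegral => ->.
Unshelve. all: by end_near. Qed.

(** Since J' = J1, [parts] is the differential equation x J + 2 t J' = 0. Hence J(x) exp(x^2 / (4
    t)) has derivative 0 and keeps its value at 0, the Gaussian integral. *)
Lemma Rintegral_cos_gaussian x :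
  \int[mu]_a (cos (x * a) * g a) = Num.sqrt (pi / t) * expR (- (x ^+ 2 / (4 * t))).
Proof.
pose K y := J y * expR (y ^+ 2 / (4 * t)).
have dK (y : R) : is_derive y 1 K 0.
  have dy := dJ y.
  have p := parts y.
  have -> : 0 = J y *: (expR (y ^+ 2 / (4 * t)) * (2 * y / (4 * t))) + expR (y ^+ 2 / (4 * t)) *: J1 y.
    have -> : J1 y = - (y * J y) / (2 * t).
      apply: (mulfI (_ : 2 * t != 0)); first by rewrite mulf_neq0// gt_eqF.
      rewrite [RHS]mulrC divfK ?mulf_neq0 ?gt_eqF//.
      by apply/eqP; rewrite -subr_eq0 opprK addrC p.
    by rewrite /GRing.scale/=; field; rewrite gt_eqF.
  apply: is_deriveM.
  apply: trigger_derive; rewrite /GRing.scale/=.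
  by field; rewrite gt_eqF.
have K0 : K 0 = Num.sqrt (pi / t).
  rewrite /K expr0n/= mul0r expR0 mulr1 /J /Rintegral.
  transitivity (fine (\int[mu]_a (g a)%:E)%E); last by rewrite integral_gaussian.
  by congr fine; apply: eq_integral => a _; rewrite mul0r cos0 mul1r.
have := is_derive_0_is_cst x 0 dK; rewrite K0 /K => <-.
by rewrite expRN mulfK// gt_eqF// expR_gt0.
Qed.

Lemma Rintegral_sin_gaussian x : \int[mu]_a (sin (x * a) * g a) = 0.
Proof.
(* [ge0_integral_reflect] takes nonnegative integrands, so 1 is added to the sine; the Gaussian
   integral cancels afterwards. *)
have H : (\int[mu]_a ((1 + sin (x * (- a))) * g (- a))%:E = \int[mu]_a ((1 + sin (x * a)) * g a)%:E)%E.
  rewrite (ge0_integral_reflect (f := fun a => ((1 + sin (x * a)) * g a)%:E))//.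
  - apply/measurable_EFinP; apply: measurable_funM => //; exact: measurable_funD.
have E1 : \int[mu]_a ((1 + sin (x * a)) * g a) = \int[mu]_a g a + \int[mu]_a (sin (x * a) * g a).
  by rewrite -RintegralD//; apply: eq_Rintegral => a _; rewrite mulrDl mul1r.
have E2 : \int[mu]_a ((1 + sin (x * (- a))) * g (- a)) = \int[mu]_a g a - \int[mu]_a (sin (x * a) * g a).
  by rewrite -RintegralB//; apply: eq_Rintegral => a _; rewrite sqrrN mulrN sinN mulrDl mul1r mulNr.
have : \int[mu]_a g a - \int[mu]_a (sin (x * a) * g a) = \int[mu]_a g a + \int[mu]_a (sin (x * a) * g a).
  by rewrite -E1 -E2 /Rintegral H.
by move=> /addrI /esym/eqP; rewrite -subr_eq0 opprK -mulr2n mulrn_eq0/= => /eqP.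
Qed.

Lemma integral_gaussian_phase p q th x :
  (\int[mu]_a ((p + q * cos (th + x * a)) * g a)%:E =
   ((p + q * cos th * expR (- (x ^+ 2 / (4 * t)))) * Num.sqrt (pi / t))%:E)%E.
Proof.
have E : (fun a => (p + q * cos (th + x * a)) * g a) =
    (fun a => p * g a + (q * cos th * (cos (x * a) * g a) - q * sin th * (sin (x * a) * g a))).
  by apply/funext => a; rewrite cosD; ring.
have i1 : mu.-integrable setT (EFin \o (fun a => p * g a)).
  exact: (@integrableZl _ _ _ mu _ measurableT _ _ g0).
have i2 : mu.-integrable setT (EFin \o (fun a => q * cos th * (cos (x * a) * g a))).
  exact: (@integrableZl _ _ _ mu _ measurableT _ _ (ic x)).
have i3 : mu.-integrable setT (EFin \o (fun a => q * sin th * (sin (x * a) * g a))).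
  exact: (@integrableZl _ _ _ mu _ measurableT _ _ (isn x)).
have i4 := integrable_funrB measurableT i2 i3.
have i5 := integrable_funrD measurableT i1 i4.
rewrite -EFin_Rintegral//; last by rewrite E.
congr EFin; rewrite [LHS](congr1 (fun f => Rintegral mu setT f) E).
rewrite RintegralD// RintegralB// RintegralZl// RintegralZl// RintegralZl//.
rewrite Rintegral_cos_gaussian Rintegral_sin_gaussian /Rintegral integral_gaussian//=.
by ring.
Qed.

End gaussian1_fourier.

(** * Iterated integrals and Gaussians in several variables *)

Section rV_integral.
Context {R : realType}.
Local Notation mu := (@lebesgue_measure R).

Lemma ge0_integral_rV_cons n (f : 'rV[R]_n.+1 -> \bar R) :
  measurable_fun setT f -> (forall x, (0 <= f x)%E) ->
  (\int[lebesgue_rV n.+1]_x f x =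
   \int[mu]_a \int[lebesgue_rV n]_x f (rV_cons (a, x)))%E.
Proof.
move=> mf f0.
have mc : measurable_fun setT (@rV_cons R n : measurableTypeR R * 'rV[R]_n -> 'rV[R]_n.+1).
  exact: measurable_rV_cons.
rewrite -[LHS]/(\int[pushforward (mu \x lebesgue_rV n)%E
  (@rV_cons R n : measurableTypeR R * 'rV[R]_n -> 'rV[R]_n.+1)]_x f x)%E.
rewrite (ge0_integral_pushforward mc)//= preimage_setT fubini_tonelli1//.
exact: (measurableT_comp mf mc).
Qed.

Lemma dotp_cons n (x : 'rV[R]_n.+1) (a : R) (y : 'rV[R]_n) :
  dotp x (rV_cons (a, y)) = x ord0 ord0 * a + dotp (rV_behead x) y.
Proof.
rewrite /dotp big_ord_recl /rV_cons !mxE unlift_none/=; congr (_ + _).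
by apply: eq_bigr => i _; rewrite !mxE liftK.
Qed.

Lemma rV_behead_cons n (a : R) (y : 'rV[R]_n) : rV_behead (rV_cons (a, y)) = y.
Proof. by apply/rowP => j; rewrite !mxE liftK. Qed.

Lemma dotp_cons_cons n (a : R) (y : 'rV[R]_n) :
  dotp (rV_cons (a, y)) (rV_cons (a, y)) = a ^+ 2 + dotp y y.
Proof. by rewrite dotp_cons rV_behead_cons mxE unlift_none expr2. Qed.

Lemma dotp_behead n (x : 'rV[R]_n.+1) :
  dotp x x = x ord0 ord0 ^+ 2 + dotp (rV_behead x) (rV_behead x).
Proof.
rewrite /dotp big_ord_recl expr2; congr (_ + _).
by apply: eq_bigr => i _; rewrite !mxE.
Qed.

Lemma dotp_ge0 n (x : 'rV[R]_n) : 0 <= dotp x x.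
Proof. by apply: sumr_ge0 => i _; rewrite -expr2 sqr_ge0. Qed.

Lemma measurable_dotp d (T : measurableType d) n (f g : T -> 'rV[R]_n) :
  measurable_fun setT f -> measurable_fun setT g -> measurable_fun setT (fun x => dotp (f x) (g x)).
Proof.
move=> mf mg; rewrite /dotp; apply: measurable_sum => i.
by apply: measurable_funM; [exact: (measurable_fun_rVP _).1 mf i|exact: (measurable_fun_rVP _).1 mg i].
Qed.

Lemma measurable_dotpr n (x : 'rV[R]_n) : measurable_fun setT (fun y : 'rV[R]_n => dotp x y).
Proof. by apply: measurable_dotp. Qed.

Lemma measurable_dotp_diag n : measurable_fun setT (fun y : 'rV[R]_n => dotp y y).
Proof. by apply: measurable_dotp. Qed.

Lemma measurable_gaussian_rV n (t : R) : measurable_fun setT (fun y : 'rV[R]_n => expR (- (t * dotp y y))).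
Proof.
apply: measurableT_comp => //; apply: measurableT_comp => //.
by apply: measurable_funM => //; exact: measurable_dotp_diag.
Qed.

Lemma measurable_cos_phase d (T : measurableType d) (p q : R) (f : T -> R) :
  measurable_fun setT f -> measurable_fun setT (fun y => p + q * cos (f y)).
Proof.
move=> mf; apply: measurable_funD => //; apply: measurable_funM => //.
exact: (measurableT_comp (continuous_measurable_fun (@continuous_cos R))).
Qed.

Lemma cos_phase_ge0 (p q y : R) : `|q| <= p -> 0 <= p + q * cos y.
Proof.
move=> qp; rewrite -lerBlDl sub0r lerNl.
apply: le_trans (ler_norm _) _; rewrite normrN normrM; apply: le_trans qp.
by rewrite ler_piMr// cos_max.
Qed.

(** The form p + q cos(th + .) is stable under integrating out coordinates: seen from the inner
    integral, the first coordinate only shifts the phase, and the result has the same form in that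
    coordinate with new p and q. The condition |q| <= p keeps the integrand nonnegative, as Tonelli
    demands. *)
Lemma integral_gaussian_phase_rV n (t p q th : R) (x : 'rV[R]_n) : 0 < t -> `|q| <= p ->
  (\int[lebesgue_rV n]_y ((p + q * cos (th + dotp x y)) * expR (- (t * dotp y y)))%:E =
   ((p + q * cos th * expR (- (dotp x x / (4 * t)))) * Num.sqrt (pi / t) ^+ n)%:E)%E.
Proof.
move=> t0.
have mF m (p' q' th' : R) (y : 'rV[R]_m) : measurable_fun setT
    (fun z : 'rV[R]_m => ((p' + q' * cos (th' + dotp y z)) * expR (- (t * dotp z z)))%:E).
  apply/measurable_EFinP; apply: measurable_funM; last exact: measurable_gaussian_rV.
  apply: measurable_cos_phase; apply: measurable_funD => //; exact: measurable_dotpr.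
have F0 m (p' q' th' : R) (y z : 'rV[R]_m) : `|q'| <= p' ->
    (0 <= ((p' + q' * cos (th' + dotp y z)) * expR (- (t * dotp z z)))%:E)%E.
  by move=> pq; rewrite lee_fin mulr_ge0 ?expR_ge0 ?cos_phase_ge0.
elim: n p q th x => [|n IHn] p q th x pq.
  have dot0 (u w : 'rV[R]_0) : dotp u w = 0 by rewrite /dotp big_ord0.
  rewrite /= integral_dirac//; last exact: mF.
  rewrite diracT mul1e !dot0 addr0 mulr0 oppr0 expR0 mulr1 expr0 mulr1.
  by rewrite mul0r oppr0 expR0 mulr1.
rewrite ge0_integral_rV_cons//; last by move=> y; exact: F0.
set x0 := x ord0 ord0; set x' := rV_behead x; set s := Num.sqrt (pi / t).
have s0 : 0 <= s by exact: sqrtr_ge0.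
transitivity (\int[mu]_a ((p * s ^+ n + (q * expR (- (dotp x' x' / (4 * t))) * s ^+ n) * cos (th + x0 * a)) *
    expR (- (t * a ^+ 2)))%:E)%E.
  apply: eq_integral => a _.
  transitivity (\int[lebesgue_rV n]_y ((expR (- (t * a ^+ 2)))%:E *
      ((p + q * cos ((th + x0 * a) + dotp x' y)) * expR (- (t * dotp y y)))%:E))%E.
    apply: eq_integral => y _; rewrite dotp_cons dotp_cons_cons -EFinM; congr EFin.
    by rewrite mulrDr opprD expRD addrA; ring.
  rewrite ge0_integralZl//; last by move=> y _; exact: F0.
    by rewrite IHn// -EFinM; congr EFin; ring.
  exact: mF.
rewrite integral_gaussian_phase//; congr EFin.
rewrite dotp_behead -/x0 -/x' (mulrDl (x0 ^+ 2)) opprD expRD /s.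
move: (expR (- (x0 ^+ 2 / (4 * t)))) (expR (- (dotp x' x' / (4 * t)))) (cos th) => A B D.
by move: (Num.sqrt (pi / t)) => r; rewrite exprS; ring.
Qed.

Lemma integral_gaussian_rV n (t : R) : 0 < t ->
  (\int[lebesgue_rV n]_y (expR (- (t * dotp y y)))%:E = (Num.sqrt (pi / t) ^+ n)%:E)%E.
Proof.
move=> t0; have := @integral_gaussian_phase_rV n t 1 0 0 0 t0.
rewrite normr0 => /(_ ler01); rewrite !mul0r addr0 mul1r => <-.
by apply: eq_integral => y _; rewrite mul0r addr0 mul1r.
Qed.

Lemma integrable_exp_powR1 (c s : R) : 0 < c -> 0 < s ->
  (\int[mu]_a (expR (- (c * (a ^+ 2) `^ s)))%:E < +oo)%E.
Proof.
move=> c0 s0.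
have mf : measurable_fun setT (fun a : R => expR (- (c * (a ^+ 2) `^ s))).
  apply: measurableT_comp => //; apply: measurableT_comp => //.
  by apply: measurable_funM => //; apply: (measurableT_comp (measurable_powR _)); exact: measurable_funX.
(* As s n >= 1, the power ((a^2)^s)^n dominates a^2 once a^2 > 1, so the term of order n of the
   exponential series yields a bound by a multiple of 1 / (1 + a^2). In [K], the summand 1 takes
   care of a^2 <= 1. *)
pose n := (Num.truncn s^-1).+1.
have ns : 1 <= s * n%:R by rewrite mulrC -ler_pdivrMr// div1r ltW// truncnS_gt.
pose K := 1 + n`!%:R / c ^+ n.
have K0 : 0 < K by rewrite addr_gt0// divr_gt0// ?exprn_gt0// ltr0n fact_gt0.
have bound a : expR (- (c * (a ^+ 2) `^ s)) <= 2 * K * (oneDsqr a)^-1.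
  have a20 : 0 <= a ^+ 2 by exact: sqr_ge0.
  rewrite ler_pdivlMr; last by rewrite (lt_le_trans ltr01)// oneDsqr_ge1.
  have u0 : 0 <= c * (a ^+ 2) `^ s by rewrite mulr_ge0 ?powR_ge0// ltW.
  have [a1|a1] := leP (a ^+ 2) 1.
    apply: (@le_trans _ _ (1 * 2)); last first.
      by rewrite mul1r ler_peMr// lerDl divr_ge0// exprn_ge0// ltW.
    apply: ler_pM; rewrite ?expR_ge0 ?expRN_le1//.
    by rewrite /oneDsqr; lra.
  rewrite expRN mulrC ler_pdivrMr ?expR_gt0//.
  apply: (@le_trans _ _ (2 * (a ^+ 2))); first by rewrite /oneDsqr; lra.
  rewrite -mulrA ler_pM2l//.
  apply: (@le_trans _ _ (n`!%:R / c ^+ n * ((c * (a ^+ 2) `^ s) ^+ n / n`!%:R))).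
    rewrite exprMn -[X in c ^+ n * X](powR_mulrn n (powR_ge0 _ _)) -powRrM.
    have -> : n`!%:R / c ^+ n * (c ^+ n * (a ^+ 2) `^ (s * n%:R) / n`!%:R) = (a ^+ 2) `^ (s * n%:R).
      have cn : c ^+ n != 0 by rewrite expf_neq0// gt_eqF.
      have fn : n`!%:R != 0 :> R by rewrite pnatr_eq0 -lt0n fact_gt0.
      by field; rewrite cn fn.
    rewrite -[leLHS]powRr1//; apply: ler_powR => //; exact: ltW.
  apply: ler_pM.
  - by rewrite divr_ge0// exprn_ge0// ltW.
  - by rewrite divr_ge0// exprn_ge0.
  - by rewrite lerDr.
  - have := expR_ge1Dxn n.-1 u0; rewrite prednK// => /(le_trans _); apply.
    by rewrite lerDr.
apply: (@le_lt_trans _ _ (\int[mu]_a (2 * K * (oneDsqr a)^-1)%:E)%E).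
  apply: ge0_le_integral => //=.
  - by apply/measurable_EFinP; exact: mf.
  - apply/measurable_EFinP; apply: measurable_funM => //.
    exact: continuous_measurable_fun (@continuous_oneDsqrV R).
  - by move=> a _; rewrite lee_fin.
have mV : measurable_fun setT (fun a : R => (oneDsqr a)^-1).
  exact: continuous_measurable_fun (@continuous_oneDsqrV R).
have V0 a : 0 <= (oneDsqr a)^-1 :> R by rewrite invr_ge0 (le_trans ler01)// oneDsqr_ge1.
under eq_integral do rewrite EFinM.
rewrite ge0_integralZl//=; last 2 first.
- by apply/measurable_EFinP; exact: mV.
- by rewrite lee_fin mulr_ge0// ltW.
apply: lte_mul_pinfty => //; first by rewrite lee_fin mulr_ge0// ltW.
rewrite ge0_symfun_integralT//; last 2 first.
- exact: continuous_oneDsqrV.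
- by move=> a; rewrite /= /oneDsqr sqrrN.
by rewrite -set_itvcy integral0y_oneDsqr -EFinM ltry.
Qed.

(** The power (a^2 + |y|^2)^s is at least the mean of (a^2)^s and (|y|^2)^s. At the price of halving
    [c], the integrand is bounded by a product in [a] and [y]; hence the induction over all [c]. *)
Lemma integral_exp_powR_lty n (c s : R) : 0 < c -> 0 < s ->
  (\int[lebesgue_rV n]_y (expR (- (c * (dotp y y) `^ s)))%:E < +oo)%E.
Proof.
move=> + s0; have mF m c' : measurable_fun setT (fun y : 'rV[R]_m => (expR (- (c' * (dotp y y) `^ s)))%:E).
  apply/measurable_EFinP; apply: measurableT_comp => //; apply: measurableT_comp => //.
  apply: measurable_funM => //; apply: (measurableT_comp (measurable_powR _)).
  exact: measurable_dotp_diag.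
elim: n c => [|n IHn] c c0.
  rewrite /= integral_dirac//; last exact: mF.
  by rewrite diracT mul1e ltry.
rewrite ge0_integral_rV_cons//.
have c20 : 0 < c / 2 by rewrite divr_gt0.
apply: (@le_lt_trans _ _ (\int[mu]_a ((expR (- (c / 2 * (a ^+ 2) `^ s)))%:E *
    \int[lebesgue_rV n]_y (expR (- (c / 2 * (dotp y y) `^ s)))%:E))%E).
  have m1 : measurable_fun setT (fun a : R => (expR (- (c / 2 * (a ^+ 2) `^ s)))%:E).
    apply/measurable_EFinP; apply: measurableT_comp => //; apply: measurableT_comp => //.
    by apply: measurable_funM => //; apply: (measurableT_comp (measurable_powR _)); exact: measurable_funX.
  apply: ge0_le_integral => //.
  - by move=> a _; apply: integral_ge0.
  - apply: (measurable_fun_fubini_tonelli_F (fun p => (expR (- (c * (dotp (rV_cons p) (rV_cons p)) `^ s)))%:E)) => //.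
    exact: (measurableT_comp (mF _ _) (@measurable_rV_cons R n)).
  - by apply: emeasurable_funM.
  move=> a _; rewrite -ge0_integralZl//.
  apply: ge0_le_integral => //.
  - exact: (measurableT_comp (measurableT_comp (mF _ _) (@measurable_rV_cons R n)) (pair1_measurable a)).
  - by apply: measurable_funeM; exact: mF.
  move=> y _; rewrite -EFinM lee_fin -expRD ler_expR -opprD lerN2 dotp_cons_cons -mulrDr.
  have A0 : 0 <= a ^+ 2 by rewrite sqr_ge0.
  have B0 := dotp_ge0 y.
  have H1 : (a ^+ 2) `^ s <= (a ^+ 2 + dotp y y) `^ s.
    by rewrite ge0_ler_powR ?nnegrE ?addr_ge0 ?(ltW s0)// lerDl.
  have H2 : (dotp y y) `^ s <= (a ^+ 2 + dotp y y) `^ s.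
    by rewrite ge0_ler_powR ?nnegrE ?addr_ge0 ?(ltW s0)// lerDr.
    rewrite -mulrA ler_pM2l//; lra.
  exact: mF.
rewrite ge0_integralZr//.
- rewrite lte_mul_pinfty ?integral_ge0//; last exact: IHn.
  by rewrite ge0_fin_numE ?integral_ge0// integrable_exp_powR1.
- apply/measurable_EFinP; apply: measurableT_comp => //; apply: measurableT_comp => //.
  by apply: measurable_funM => //; apply: (measurableT_comp (measurable_powR _)); exact: measurable_funX.
- by apply: integral_ge0.
Qed.

End rV_integral.

(** * Fourier transforms of nonnegative measures *)

Section monotone_limit.
Context d (T : measurableType d) (R : realType) (mu : {measure set T -> \bar R}).

Lemma ge0_cvg_integral (f_ : nat -> T -> \bar R) (f : T -> \bar R) :
  (forall n, measurable_fun setT (f_ n)) -> (forall n x, (0 <= f_ n x)%E) ->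
  (forall x, {homo f_ ^~ x : n m / (n <= m)%N >-> (n <= m)%E}) ->
  (forall x, f_ n x @[n --> \oo] --> f x) ->
  (\int[mu]_x f_ n x)%E @[n --> \oo] --> (\int[mu]_x f x)%E.
Proof.
move=> mf f0 nd cf.
have := @cvg_monotone_convergence _ _ _ mu setT measurableT f_ mf (fun n x _ => f0 n x) (fun x _ => nd x).
by under [X in _ --> X -> _]eq_integral do rewrite (cvg_lim _ (cf _))//.
Qed.

End monotone_limit.

Section posdef.
Context {R : realType} (N : nat).
Local Notation mu := (@lebesgue_measure R).
Local Notation gauss t := (fun xi : 'rV[R]_N => expR (- (t * dotp xi xi))).

(* The Fourier transform of P, smoothed by a Gaussian, is nonnegative; adding 1
   to the cosine keeps all integrands nonnegative. *)
Definition posdef (P : 'rV[R]_N -> R) := [/\ measurable_fun setT P, forall xi, 0 <= P xi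
  & forall (t : R) (x : 'rV[R]_N), 0 < t ->
  (\int[lebesgue_rV N]_xi (gauss t xi * P xi)%:E <=
   \int[lebesgue_rV N]_xi ((1 + cos (dotp x xi)) * (gauss t xi * P xi))%:E)%E].

Lemma onem_cos_ge0 (y : R) : 0 <= 1 + cos y.
Proof. by rewrite -lerBlDl sub0r cos_geN1. Qed.

Lemma measurable_onem_cos (x : 'rV[R]_N) : measurable_fun setT (fun xi : 'rV[R]_N => 1 + cos (dotp x xi)).
Proof.
apply: measurable_funD => //.
apply: (measurableT_comp (continuous_measurable_fun (@continuous_cos R))).
exact: measurable_dotpr.
Qed.

Let mgP P t : measurable_fun setT P -> measurable_fun setT (fun xi => gauss t xi * P xi).
Proof. by move=> mP; apply: measurable_funM => //; exact: measurable_gaussian_rV. Qed.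

Let mcgP P t x : measurable_fun setT P ->
  measurable_fun setT (fun xi => (1 + cos (dotp x xi)) * (gauss t xi * P xi)).
Proof. by move=> mP; apply: measurable_funM; [exact: measurable_onem_cos|exact: mgP]. Qed.

Lemma posdef1 : posdef (cst 1).
Proof.
split => // t x t0.
under eq_integral do rewrite mulr1.
under [leRHS]eq_integral do rewrite mulr1.
rewrite integral_gaussian_rV//.
have := @integral_gaussian_phase_rV R N t 1 1 0 x t0.
rewrite normr1 => /(_ (lexx _)) H.
have -> : (\int[lebesgue_rV N]_xi ((1 + cos (dotp x xi)) * gauss t xi)%:E =
  \int[lebesgue_rV N]_y ((1 + 1 * cos (0 + dotp x y)) * expR (- (t * dotp y y)))%:E)%E.
  by apply: eq_integral => y _; rewrite mul1r add0r.
rewrite H lee_fin cos0 !mul1r ler_peMl ?exprn_ge0 ?sqrtr_ge0//.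
by rewrite lerDl expR_ge0.
Qed.

Lemma posdefD P P' : posdef P -> posdef P' -> posdef (fun xi => P xi + P' xi).
Proof.
move=> [mP P0 HP] [mP' P0' HP']; split.
- exact: measurable_funD.
- by move=> xi; rewrite addr_ge0.
move=> t x t0.
under eq_integral do rewrite mulrDr EFinD.
under [leRHS]eq_integral do rewrite mulrDr mulrDr EFinD.
rewrite ge0_integralD//; last 4 first.
- by move=> y _; rewrite lee_fin mulr_ge0 ?expR_ge0.
- by apply/measurable_EFinP; exact: mgP.
- by move=> y _; rewrite lee_fin mulr_ge0 ?expR_ge0.
- by apply/measurable_EFinP; exact: mgP.
rewrite ge0_integralD//; last 4 first.
- by move=> y _; rewrite lee_fin mulr_ge0 ?onem_cos_ge0// mulr_ge0 ?expR_ge0.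
- by apply/measurable_EFinP; exact: mcgP.
- by move=> y _; rewrite lee_fin mulr_ge0 ?onem_cos_ge0// mulr_ge0 ?expR_ge0.
- by apply/measurable_EFinP; exact: mcgP.
by apply: leeD; [exact: HP|exact: HP'].
Qed.

Lemma posdefZ c P : 0 <= c -> posdef P -> posdef (fun xi => c * P xi).
Proof.
move=> c0 [mP P0 HP]; split.
- exact: measurable_funM.
- by move=> xi; rewrite mulr_ge0.
move=> t x t0.
under eq_integral do rewrite mulrCA EFinM.
under [leRHS]eq_integral => xi _.
  rewrite (_ : (1 + cos (dotp x xi)) * _ = c * ((1 + cos (dotp x xi)) * (gauss t xi * P xi))).
    rewrite EFinM; over.
  by ring.
rewrite ge0_integralZl//; last 2 first.
- by apply/measurable_EFinP; exact: mgP.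
- by move=> y _; rewrite lee_fin mulr_ge0 ?expR_ge0.
rewrite ge0_integralZl//; last 2 first.
- by apply/measurable_EFinP; exact: mcgP.
- by move=> y _; rewrite lee_fin mulr_ge0 ?onem_cos_ge0// mulr_ge0 ?expR_ge0.
by apply: lee_wpmul2l => //; exact: HP.
Qed.

Lemma posdef_nondecreasing (P_ : nat -> 'rV[R]_N -> R) (P : 'rV[R]_N -> R) :
  (forall n, posdef (P_ n)) -> measurable_fun setT P ->
  (forall xi, nondecreasing_seq (P_ ^~ xi)) -> (forall xi, P_ n xi @[n --> \oo] --> P xi) ->
  posdef P.
Proof.
move=> pd mP nd cP; split => //.
- move=> xi; rewrite -(cvg_lim _ (cP xi))//; apply: limr_ge; first exact: cvgP (cP xi).
  by apply: nearW => n; have [_ + _] := pd n; exact.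
move=> t x t0.
have L : (\int[lebesgue_rV N]_xi (gauss t xi * P_ n xi)%:E)%E @[n --> \oo] -->
    (\int[lebesgue_rV N]_xi (gauss t xi * P xi)%:E)%E.
  apply: ge0_cvg_integral => //.
  - by move=> n; apply/measurable_EFinP; apply: mgP; have [] := pd n.
  - by move=> n xi; rewrite lee_fin mulr_ge0 ?expR_ge0//; have [_ + _] := pd n; exact.
  - by move=> xi m n mn; rewrite lee_fin ler_wpM2l ?expR_ge0//; exact: nd.
  - move=> xi; apply/fine_cvgP; split; first exact: nearW.
    by apply: cvgMr; exact: cP.
have Rr : (\int[lebesgue_rV N]_xi ((1 + cos (dotp x xi)) * (gauss t xi * P_ n xi))%:E)%E @[n --> \oo] -->
    (\int[lebesgue_rV N]_xi ((1 + cos (dotp x xi)) * (gauss t xi * P xi))%:E)%E.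
  apply: ge0_cvg_integral => //.
  - by move=> n; apply/measurable_EFinP; apply: mcgP; have [] := pd n.
  - by move=> n xi; rewrite lee_fin mulr_ge0 ?onem_cos_ge0// mulr_ge0 ?expR_ge0//; have [_ + _] := pd n; exact.
  - by move=> xi m n mn; rewrite lee_fin ler_wpM2l ?onem_cos_ge0// ler_wpM2l ?expR_ge0//; exact: nd.
  - move=> xi; apply/fine_cvgP; split; first exact: nearW.
    by apply: cvgMr; apply: cvgMr; exact: cP.
rewrite -(cvg_lim _ L)// -(cvg_lim _ Rr)//; apply: lee_lim; [exact: cvgP L|exact: cvgP Rr|].
by apply: nearW => n; have [_ _] := pd n; exact.
Qed.

(** Serves to remove the cut-off in [posdef_stable], where the approximants decrease and are bounded
    by 1; the Gaussian factor supplies the integrable bound. *)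
Lemma posdef_dominated (P_ : nat -> 'rV[R]_N -> R) (P : 'rV[R]_N -> R) :
  (forall n, posdef (P_ n)) -> measurable_fun setT P ->
  (forall n xi, P_ n xi <= 1) -> (forall xi, P_ n xi @[n --> \oo] --> P xi) ->
  posdef P.
Proof.
move=> pd mP P1 cP.
have P0 n xi : 0 <= P_ n xi by have [_ + _] := pd n; exact.
split => //.
- move=> xi; rewrite -(cvg_lim _ (cP xi))//; apply: limr_ge; first exact: cvgP (cP xi).
  exact: nearW.
move=> t x t0.
have ig : (lebesgue_rV N).-integrable setT (EFin \o gauss t).
  apply: ge0_integrable_lty => //; first exact: measurable_gaussian_rV.
  by rewrite integral_gaussian_rV// ltry.
have ig2 := @integrableZl _ _ _ (lebesgue_rV N) _ measurableT 2 _ ig.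
have [] := @dominated_convergence _ _ _ (lebesgue_rV N) setT measurableT
  (fun n xi => (gauss t xi * P_ n xi)%:E) (fun xi => (gauss t xi * P xi)%:E) (EFin \o gauss t).
- by move=> n; apply/measurable_EFinP; apply: mgP; have [] := pd n.
- by apply/measurable_EFinP; exact: mgP.
- apply: aeW => xi _; apply/fine_cvgP; split; first exact: nearW.
  by apply: cvgMr; exact: cP.
- exact: ig.
- apply: aeW => xi n _; rewrite lee_fin ger0_norm ?mulr_ge0 ?expR_ge0//.
  by rewrite ler_piMr ?expR_ge0.
move=> _ _ L.
have [] := @dominated_convergence _ _ _ (lebesgue_rV N) setT measurableT
  (fun n xi => ((1 + cos (dotp x xi)) * (gauss t xi * P_ n xi))%:E)
  (fun xi => ((1 + cos (dotp x xi)) * (gauss t xi * P xi))%:E) (fun xi => 2%:E * (EFin \o gauss t) xi)%E.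
- by move=> n; apply/measurable_EFinP; apply: mcgP; have [] := pd n.
- by apply/measurable_EFinP; exact: mcgP.
- apply: aeW => xi _; apply/fine_cvgP; split; first exact: nearW.
  by apply: cvgMr; apply: cvgMr; exact: cP.
- exact: ig2.
- apply: aeW => xi n _; rewrite -EFinM lee_fin ger0_norm ?mulr_ge0 ?onem_cos_ge0 ?mulr_ge0 ?expR_ge0//.
  apply: ler_pM; rewrite ?onem_cos_ge0 ?mulr_ge0 ?expR_ge0//.
  + by rewrite (_ : 2 = 1 + 1)// lerD2l cos_le1.
  + by rewrite ler_piMr ?expR_ge0.
move=> _ _ Rr.
rewrite -(cvg_lim _ L)// -(cvg_lim _ Rr)//; apply: lee_lim; [exact: cvgP L|exact: cvgP Rr|].
by apply: nearW => n; have [_ _] := pd n; exact.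
Qed.

Section mixture.
Variables (w : R -> R) (m : R).
Hypotheses (mw : measurable_fun setT w) (w0 : forall y, 0 <= w y) (wneg : forall y, y <= 0 -> w y = 0)
  (wm : (\int[mu]_y (w y)%:E = m%:E)%E).

(** At a = |xi|^2 this is a mixture of centred Gaussians in xi with weights [w]. *)
Definition laplace_mix (a : R) : R := \int[mu]_y (w y * expR (- (y * a))).

Let integrand0 y a : 0 <= w y * expR (- (y * a)). Proof. by rewrite mulr_ge0 ?expR_ge0. Qed.

Let mexp a : measurable_fun setT (fun y : R => expR (- (y * a))).
Proof. by apply: measurableT_comp => //; apply: measurableT_comp => //; exact: measurable_funM. Qed.

Let iw a : 0 <= a -> mu.-integrable setT (EFin \o (fun y => w y * expR (- (y * a)))).
Proof.
move=> a0; have iw : mu.-integrable setT (EFin \o w).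
  by apply: ge0_integrable_lty => //; rewrite wm ltry.
apply: le_integrable iw => //.
  by apply/measurable_EFinP; apply: (measurable_funM mw (mexp a)).
move=> y _ /=; rewrite lee_fin !ger0_norm//.
have [y0|y0] := leP y 0; first by rewrite wneg// mul0r.
by rewrite ler_piMr// expRN_le1// mulr_ge0// ltW.
Qed.

Lemma laplace_mixE a : 0 <= a -> ((laplace_mix a)%:E = \int[mu]_y (w y * expR (- (y * a)))%:E)%E.
Proof. by move=> a0; rewrite EFin_Rintegral//; exact: iw. Qed.

Lemma laplace_mix_ge0 a : 0 <= laplace_mix a.
Proof. exact: Rintegral_ge0. Qed.

Lemma laplace_mix_le a : 0 <= a -> laplace_mix a <= m.
Proof.
move=> a0; rewrite -lee_fin laplace_mixE// -wm; apply: ge0_le_integral => //.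
- by move=> y _; rewrite lee_fin.
- by apply/measurable_EFinP; apply: (measurable_funM mw (mexp a)).
- by apply/measurable_EFinP.
move=> y _; rewrite lee_fin.
have [y0|y0] := leP y 0; first by rewrite wneg// mul0r.
by rewrite ler_piMr// expRN_le1// mulr_ge0// ltW.
Qed.

Let mexpQ : measurable_fun setT (fun p : 'rV[R]_N * R => expR (- (p.2 * dotp p.1 p.1))).
Proof.
apply: measurableT_comp => //; apply: measurableT_comp => //; apply: measurable_funM => //.
by apply: measurable_dotp.
Qed.

Lemma measurable_laplace_mix : measurable_fun setT (fun xi : 'rV[R]_N => laplace_mix (dotp xi xi)).
Proof.
apply/measurable_EFinP.
rewrite (_ : (EFin \o _) = (fun xi => \int[mu]_y (w y * expR (- (y * dotp xi xi)))%:E)%E); last first.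
  by apply/funext => xi /=; rewrite laplace_mixE// dotp_ge0.
apply: (measurable_fun_fubini_tonelli_F (m2 := mu) (fun p : 'rV[R]_N * measurableTypeR R => (w p.2 * expR (- (p.2 * dotp p.1 p.1)))%:E)).
  apply/measurable_EFinP; apply: measurable_funM => //.
  exact: (measurableT_comp mw).
by move=> p; rewrite lee_fin.
Qed.

Let mix_swap (g P : 'rV[R]_N -> R) t : measurable_fun setT g -> (forall xi, 0 <= g xi) ->
  measurable_fun setT P -> (forall xi, 0 <= P xi) ->
  (\int[lebesgue_rV N]_xi (g xi * (gauss t xi * (laplace_mix (dotp xi xi) * P xi)))%:E =
   \int[mu]_y ((w y)%:E * \int[lebesgue_rV N]_xi (g xi * (gauss (t + y) xi * P xi))%:E))%E.
Proof.
move=> mg g0 mP P0.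
pose f (p : 'rV[R]_N * R) := (w p.2 * (g p.1 * (expR (- ((t + p.2) * dotp p.1 p.1)) * P p.1)))%:E.
have mf : measurable_fun setT f.
  apply/measurable_EFinP; apply: measurable_funM; first exact: (measurableT_comp mw).
  apply: measurable_funM; first exact: (measurableT_comp mg).
  apply: measurable_funM; last exact: (measurableT_comp mP).
  apply: measurableT_comp => //; apply: measurableT_comp => //; apply: measurable_funM.
    exact: measurable_funD.
  by apply: measurable_dotp.
have f0 p : (0 <= f p)%E by rewrite lee_fin !mulr_ge0 ?expR_ge0.
transitivity (\int[lebesgue_rV N]_xi \int[mu]_y f (xi, y))%E.
  apply: eq_integral => xi _.
  transitivity ((g xi * (gauss t xi * P xi))%:E * (laplace_mix (dotp xi xi))%:E)%E.
    by rewrite -EFinM; congr EFin; ring.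
  rewrite laplace_mixE ?dotp_ge0// -ge0_integralZl//; last 3 first.
  - by apply/measurable_EFinP; apply: (measurable_funM mw (mexp _)).
  - by move=> y _; rewrite lee_fin.
  - by rewrite lee_fin !mulr_ge0 ?expR_ge0.
  apply: eq_integral => y _; rewrite -EFinM /f/=; congr EFin.
  by rewrite mulrDl opprD expRD; ring.
rewrite fubini_tonelli//; apply: eq_integral => y _.
rewrite -ge0_integralZl//.
- apply/measurable_EFinP; apply: measurable_funM => //; exact: mgP.
- by move=> xi _; rewrite lee_fin !mulr_ge0 ?expR_ge0.
- by rewrite lee_fin.
Qed.

(** Each Gaussian of the mixture merges with the smoothing one, [t] becoming [t + y]; the inequality
    for [P] at [t + y] is then integrated against [w]. This is where [posdef] is needed for every t
    > 0 and not just for one. *)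
Lemma posdef_mix P : posdef P -> posdef (fun xi => laplace_mix (dotp xi xi) * P xi).
Proof.
move=> [mP P0 HP]; split.
- by apply: measurable_funM => //; exact: measurable_laplace_mix.
- by move=> xi; rewrite mulr_ge0 ?laplace_mix_ge0.
move=> t x t0.
rewrite [leLHS](_ : _ = \int[lebesgue_rV N]_xi (1 * (gauss t xi * (laplace_mix (dotp xi xi) * P xi)))%:E)%E; last first.
  by apply: eq_integral => xi _; rewrite mul1r.
have mc := measurable_onem_cos x; have c0 xi := onem_cos_ge0 (dotp x xi).
rewrite (mix_swap (g := cst 1))// (mix_swap (g := fun xi => 1 + cos (dotp x xi)))//.
have mG (g : 'rV[R]_N -> R) : measurable_fun setT g -> (forall xi, 0 <= g xi) ->
    measurable_fun setT (fun y => (w y)%:E * \int[lebesgue_rV N]_xi (g xi * (gauss (t + y) xi * P xi))%:E)%E.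
  move=> mg g0; apply: emeasurable_funM; first exact/measurable_EFinP.
  apply: (measurable_fun_fubini_tonelli_F (fun p : measurableTypeR R * 'rV[R]_N => (g p.2 * (expR (- ((t + p.1) * dotp p.2 p.2)) * P p.2))%:E)).
    apply/measurable_EFinP; apply: measurable_funM; first exact: (measurableT_comp mg).
    apply: measurable_funM; last exact: (measurableT_comp mP).
    apply: measurableT_comp => //; apply: measurableT_comp => //; apply: measurable_funM.
      exact: measurable_funD.
    by apply: measurable_dotp.
  by move=> p; rewrite lee_fin !mulr_ge0 ?expR_ge0.
apply: ge0_le_integral => //.
- move=> y _; apply: mule_ge0; first by rewrite lee_fin.
  by apply: integral_ge0 => xi _; rewrite lee_fin !mulr_ge0 ?expR_ge0.
- exact: mG.
- by apply: mG; [exact: measurable_onem_cos|exact: (fun xi => onem_cos_ge0 (dotp x xi))].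
move=> y _; have [y0|y0] := leP y 0; first by rewrite wneg// !mul0e.
apply: lee_wpmul2l; first by rewrite lee_fin.
have ty : 0 < t + y by rewrite addr_gt0.
by under eq_integral do rewrite mul1r; exact: HP.
Qed.

(** Up to the factor exp(-m), the characteristic function of a compound Poisson law. Powers of the
    mixture come from [posdef_mix], and the partial sums of the exponential series increase because
    all terms are nonnegative. *)
Lemma posdef_exp_mix : posdef (fun xi => expR (laplace_mix (dotp xi xi))).
Proof.
have pw i : posdef (fun xi => laplace_mix (dotp xi xi) ^+ i).
  elim: i => [|i IHi].
    by rewrite (_ : (fun _ => _) = cst 1); [exact: posdef1|apply/funext => xi; rewrite expr0].
  rewrite (_ : (fun _ => _) = (fun xi => laplace_mix (dotp xi xi) * laplace_mix (dotp xi xi) ^+ i)).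
    exact: posdef_mix.
  by apply/funext => xi; rewrite exprS.
have ps n : posdef (fun xi => series (exp_coeff (laplace_mix (dotp xi xi))) n).
  elim: n => [|n IHn].
    rewrite (_ : (fun _ => _) = (fun xi => 0 * cst 1 xi)); first by apply: posdefZ => //; exact: posdef1.
    by apply/funext => xi; rewrite /series/= big_geq// mul0r.
  rewrite (_ : (fun _ => _) = (fun xi => series (exp_coeff (laplace_mix (dotp xi xi))) n +
    (n`!%:R)^-1 * laplace_mix (dotp xi xi) ^+ n)).
    by apply: posdefD => //; apply: posdefZ.
  by apply/funext => xi; rewrite /series/= big_nat_recr//= /exp_coeff/= mulrC.
apply: (posdef_nondecreasing ps).
- by apply: measurableT_comp => //; exact: measurable_laplace_mix.
- move=> xi; apply/nondecreasing_seqP => n; rewrite /series/= big_nat_recr//= lerDl.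
  by rewrite /exp_coeff/= divr_ge0// exprn_ge0// laplace_mix_ge0.
- move=> xi; exact: is_cvg_series_exp_coeff.
Qed.

End mixture.

End posdef.

(** * Symbol of the fractional Laplacian *)

Section powR_integrals.
Context {R : realType}.
Local Notation mu := (@lebesgue_measure R).

Lemma ge0_integral_bigcup_le d (T : measurableType d) (nu : {measure set T -> \bar R})
    (F : nat -> set T) (f : T -> \bar R) (C : \bar R) :
  nondecreasing_seq F -> (forall n, measurable (F n)) -> measurable_fun (\bigcup_n F n) f ->
  (forall x, (\bigcup_n F n) x -> (0 <= f x)%E) ->
  (forall n, (\int[nu]_(x in F n) f x <= C)%E) -> (\int[nu]_(x in \bigcup_n F n) f x <= C)%E.
Proof.
move=> nd mF mf f0 FC.
have L : (\int[nu]_(x in F n) f x)%E @[n --> \oo] --> (\int[nu]_(x in \bigcup_n F n) f x)%E.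
  apply: ge0_nondecreasing_set_cvg_integral => //.
    by move=> n; apply: measurable_funS mf; [exact: bigcupT_measurable|exact: bigcup_sup].
  by move=> n x Fx; apply: f0; exists n.
rewrite -(cvg_lim _ L)//; apply: lime_le; first exact: cvgP L.
exact: nearW.
Qed.

Lemma continuous_powR_itv (r a x : R) : 0 < a -> a <= x -> {for x, continuous (fun y : R => y `^ r)}.
Proof.
move=> a0 ax; apply: differentiable_continuous; apply/derivable1_diffP.
by have [] := is_derive1_powR r (lt_le_trans a0 ax).
Qed.

Lemma integral_powR_itvcc (r a b : R) : r != 0 -> 0 < a -> a <= b ->
  (\int[mu]_(x in `[a, b]) (x `^ (r - 1))%:E = ((b `^ r - a `^ r) / r)%:E)%E.
Proof.
move=> r0 a0; rewrite le_eqVlt => /predU1P[<-|ab].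
  by rewrite set_itv1 integral_set1 subrr mul0r.
pose F := fun x : R => r^-1 * x `^ r.
have dF (x : R) : 0 < x -> is_derive x 1 F (x `^ (r - 1)).
  move=> x0; have d := is_derive1_powR r x0.
  apply: (is_derive_eq (is_deriveZ _ _)).
  by rewrite /GRing.scale/= mulrA mulVf// mul1r.
have cF (x : R) : 0 < x -> {for x, continuous F}.
  by move=> x0; apply: differentiable_continuous; apply/derivable1_diffP; have [] := dF x x0.
have b0 := lt_trans a0 ab.
rewrite (continuous_FTC2 (F := F))//.
- by rewrite -EFinB /F; congr EFin; ring.
- apply/continuous_within_itvP => //; split.
  + move=> x; rewrite in_itv/= => /andP[ax _]; apply: (continuous_powR_itv a0 (ltW ax)).
  + by apply: cvg_at_right_filter; exact: (continuous_powR_itv a0).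
  + by apply: cvg_at_left_filter; apply: (continuous_powR_itv a0); exact: ltW.
- split.
  + by move=> x; rewrite in_itv/= => /andP[ax _]; have [] := dF x (lt_trans a0 ax).
  + by apply: cvg_at_right_filter; exact: cF.
  + by apply: cvg_at_left_filter; exact: cF.
- move=> x; rewrite in_itv/= => /andP[ax _].
  by have d := dF x (lt_trans a0 ax); rewrite derive1E; exact: derive_val.
Qed.

Lemma integral_powR_itv01_le (r : R) : 0 < r ->
  (\int[mu]_(x in `]0%R, 1%R]) (x `^ (r - 1))%:E <= r^-1%:E)%E.
Proof.
move=> r0; rewrite itv_open_bnd_bigcup.
apply: ge0_integral_bigcup_le => //.
- move=> m n mn; rewrite subsetEset => x /=; rewrite !in_itv/= => /andP[h ->]; rewrite andbT.
  by apply: le_trans h; rewrite !add0r lef_pV2 ?posrE// ler_nat.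
- apply: measurable_funTS; apply/measurable_EFinP; exact: measurable_powR.
- by move=> x _; rewrite lee_fin powR_ge0.
move=> n; rewrite add0r.
rewrite integral_powR_itvcc ?gt_eqF ?invr_gt0// ?invf_le1 ?ler1n//.
by rewrite lee_fin powR1 ler_piMl ?invr_ge0 ?(ltW r0)// lerBlDr lerDl powR_ge0.
Qed.

Lemma integral_powR_itv1y_le (r : R) : 0 < r ->
  (\int[mu]_(x in `[1%R, +oo[) (x `^ (- r - 1))%:E <= r^-1%:E)%E.
Proof.
move=> r0; rewrite itv_bndy_bigcup_BRight.
apply: ge0_integral_bigcup_le => //.
- move=> m n mn; rewrite subsetEset => x /=; rewrite !in_itv/= => /andP[-> h] /=.
  by apply: le_trans h _; rewrite lerD2l ler_nat.
- apply: measurable_funTS; apply/measurable_EFinP; exact: measurable_powR.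
- by move=> x _; rewrite lee_fin powR_ge0.
move=> n; rewrite integral_powR_itvcc ?oppr_eq0 ?gt_eqF// ?lerDl//.
rewrite lee_fin powR1 invrN mulrN -mulNr opprB.
by rewrite ler_piMl ?invr_ge0 ?(ltW r0)// lerBlDr lerDl powR_ge0.
Qed.

End powR_integrals.

Section stable.
Context {R : realType} (s : R).
Hypothesis s01 : 0 < s < 1.
Local Notation mu := (@lebesgue_measure R).
Let s0 : 0 < s. Proof. by case/andP: s01. Qed.
Let s1 : s < 1. Proof. by case/andP: s01. Qed.

Local Notation w := (fun x : R => x `^ (- 1 - s)).

Let mf a D : measurable_fun D (fun x : R => ((1 - expR (- (x * a))) * w x)%:E).
Proof.
apply: measurable_funTS; apply/measurable_EFinP; apply: measurable_funM; last exact: measurable_powR.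
apply: measurable_funB => //; apply: measurableT_comp => //; apply: measurableT_comp => //.
exact: measurable_funM.
Qed.

Let f0 a x : 0 <= a -> 0 < x -> 0 <= (1 - expR (- (x * a))) * w x.
Proof. by move=> a0 x0; rewrite mulr_ge0 ?powR_ge0// subr_ge0 expRN_le1// mulr_ge0// ltW. Qed.

(** The normalising constant Gamma(1 - s) / s of the Lévy density of a^s. The factor [x * 1] keeps
    it literally the case a = 1 of the integrals below. *)
Definition stable_const : R := \int[mu]_(x in `]0, +oo[) ((1 - expR (- (x * 1))) * w x).

(** Near 0, the bound 1 - exp(-x) <= x leaves x^(-s), integrable as s < 1. Beyond 1, the bound by 1
    leaves x^(-1-s), integrable as s > 0. *)
Let B_lty : (\int[mu]_(x in `]0%R, +oo[) ((1 - expR (- (x * 1))) * w x)%:E < +oo)%E.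
Proof.
rewrite (_ : `]0%R, +oo[%classic = `]0, 1] `|` `]1, +oo[); last first.
  by rewrite -itv_bndbnd_setU// bnd_simp.
rewrite ge0_integral_setU//=; last 2 first.
- move=> x [|] /=; rewrite in_itv/=; first by move=> /andP[x0 _]; rewrite lee_fin; apply: f0.
  by rewrite andbT => x1; rewrite lee_fin; apply: f0 => //; exact: lt_trans x1.
- apply/disj_setPS => x [] /=; rewrite !in_itv/= andbT => /andP[_ xle] /lt_le_trans => /(_ _ xle).
  by rewrite ltxx.
2: exact: mf.
apply: lte_add_pinfty.
  apply: le_lt_trans (ltry (1 - s)^-1).
  have s1' : 0 < 1 - s by rewrite subr_gt0.
  apply: le_trans (integral_powR_itv01_le s1').
  apply: ge0_le_integral => //=.
  - by move=> x; rewrite in_itv/= => /andP[x0 _]; rewrite lee_fin; apply: f0.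
  - exact: mf.
  - by apply: measurable_funTS; apply/measurable_EFinP; exact: measurable_powR.
  move=> x; rewrite in_itv/= => /andP[x0 _]; rewrite lee_fin.
  have -> : x `^ (1 - s - 1) = x * x `^ (- 1 - s).
    by rewrite -[X in X * _](powRr1 (ltW x0)) -powRD ?(gt_eqF x0) ?implybT//; congr powR; ring.
  rewrite ler_wpM2r ?powR_ge0// mulr1 lerBlDr -lerBlDl.
  by have := expR_ge1Dx (- x).
apply: le_lt_trans (ltry s^-1).
apply: le_trans (integral_powR_itv1y_le s0).
rewrite [leRHS](_ : _ = \int[mu]_(x in `]1%R, +oo[) (x `^ (- s - 1))%:E)%E; last first.
  by rewrite -integral_itv_obnd_cbnd//; apply: measurable_funTS; apply/measurable_EFinP; exact: measurable_powR.
apply: ge0_le_integral => //=.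
- by move=> x; rewrite in_itv/= andbT => x1; rewrite lee_fin; apply: f0 => //; exact: lt_trans x1.
- exact: mf.
- by apply: measurable_funTS; apply/measurable_EFinP; exact: measurable_powR.
move=> x _; rewrite lee_fin (addrC (- 1)) ler_piMl ?powR_ge0// lerBlDr lerDl expR_ge0//.
Qed.

Lemma stable_constE : (stable_const%:E = \int[mu]_(x in `]0%R, +oo[) ((1 - expR (- (x * 1))) * w x)%:E)%E.
Proof.
rewrite /stable_const /Rintegral fineK// ge0_fin_numE; first exact: B_lty.
by apply: integral_ge0 => x /=; rewrite in_itv/= andbT => x0; rewrite lee_fin f0.
Qed.

Lemma stable_const_gt0 : 0 < stable_const.
Proof.
rewrite -lte_fin stable_constE.
apply: (@lt_le_trans _ _ (\int[mu]_(x in `[1%R, 2%R]) ((1 - expR (-1)) * 2 `^ (- 1 - s))%:E)%E).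
  rewrite integral_cst//= lebesgue_measure_itv/= lte_fin ltr1n -EFinD -EFinM lte_fin.
  by rewrite mulr_gt0 ?mulr_gt0 ?powR_gt0 ?subr_gt0 ?expRN_lt1 ?ltr1n.
apply: (@le_trans _ _ (\int[mu]_(x in `[1%R, 2%R]) ((1 - expR (- (x * 1))) * w x)%:E)%E).
  apply: ge0_le_integral => //=.
  - exact: mf.
  move=> x; rewrite in_itv/= => /andP[x1 x2]; rewrite lee_fin.
  have x0 : 0 < x by exact: lt_le_trans x1.
  apply: ler_pM; rewrite ?powR_ge0// ?subr_ge0 ?expRN_le1//.
      by rewrite lerD2l lerN2 ler_expR lerN2 mulr1.
  have H : 0 <= 1 + s by rewrite addr_ge0// ltW.
  rewrite (_ : -1 - s = - (1 + s)); last by rewrite opprD.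
  rewrite !powRN lef_pV2 ?posrE ?powR_gt0//.
  by rewrite ge0_ler_powR// nnegrE ltW.
apply: ge0_subset_integral => //=.
- exact: mf.
- by move=> x; rewrite in_itv/= andbT => x0; rewrite lee_fin f0.
- by move=> x /=; rewrite !in_itv/= => /andP[x1 _]; rewrite andbT; exact: lt_le_trans x1.
Qed.

(** The substitution of x / a for x extracts the factor a^s. *)
Lemma integral_stable a : 0 <= a ->
  (\int[mu]_(x in `]0%R, +oo[) ((1 - expR (- (x * a))) * w x)%:E = (a `^ s * stable_const)%:E)%E.
Proof.
rewrite le_eqVlt => /predU1P[<-|a0].
  rewrite powR0 ?gt_eqF// mul0r; apply: integral0_eq => x _.
  by rewrite mulr0 oppr0 expR0 subrr mul0r.
rewrite (ge0_integral_scaley (c := a^-1)) ?invr_gt0//; last first.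
  by move=> x x0; rewrite lee_fin f0// ltW.
have -> : (\int[mu]_(x in `]0%R, +oo[) ((1 - expR (- (a^-1 * x * a))) * w (a^-1 * x))%:E =
    \int[mu]_(x in `]0%R, +oo[) ((a * a `^ s)%:E * ((1 - expR (- (x * 1))) * w x)%:E))%E.
  apply: eq_integral => x; rewrite inE/= in_itv/= andbT => x0.
  rewrite -!EFinM; congr EFin.
  rewrite mulrAC mulVf ?gt_eqF// mul1r mulr1 powRM ?invr_ge0 ?(ltW a0) ?(ltW x0)//.
  have -> : a^-1 `^ (-1 - s) = a * a `^ s.
    rewrite -powR_inv1 ?ltW// -powRrM -[X in _ = X * _](powRr1 (ltW a0)) -powRD ?(gt_eqF a0) ?implybT//.
    by congr powR; ring.
  by rewrite mulrCA.
rewrite ge0_integralZl//=; last 3 first.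
- exact: mf.
- by move=> x; rewrite in_itv/= andbT => x0; rewrite lee_fin f0.
- by rewrite lee_fin mulr_ge0 ?powR_ge0// ltW.
rewrite -stable_constE -!EFinM; congr EFin; field.
by rewrite gt_eqF.
Qed.

Let C0 := stable_const_gt0.

(** The Lévy density of a^s, cut off near 0 where it is not integrable. The cut density has finite
    mass, so that 1 - exp(-x a) can be integrated term by term and the exponential of the mixture
    splits off. *)
Definition stable_cut n : R -> R := (fun x => stable_const^-1 * w x) \_ (`]n.+1%:R^-1, +oo[ : set R).

Lemma measurable_stable_cut n : measurable_fun setT (stable_cut n).
Proof.
apply/(measurable_restrictT _ _).1 => //; apply: measurable_funTS.
by apply: measurable_funM => //; exact: measurable_powR.
Qed.

Lemma stable_cut_ge0 n x : 0 <= stable_cut n x.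
Proof. by rewrite /stable_cut patchE; case: ifP => // _; rewrite mulr_ge0 ?invr_ge0 ?(ltW C0)// powR_ge0. Qed.

Lemma stable_cut0 n x : x <= 0 -> stable_cut n x = 0.
Proof.
move=> x0; rewrite /stable_cut patchE mem_setE in_itv/= andbT ltNge (le_trans x0)//=.
Qed.

Lemma integral_stable_cut n (g : R -> R) :
  (\int[mu]_x (stable_cut n x * g x)%:E = \int[mu]_(x in `](n.+1%:R^-1)%R, +oo[) (stable_const^-1 * w x * g x)%:E)%E.
Proof.
rewrite [RHS]integral_mkcond; apply: eq_integral => x _.
by rewrite /stable_cut !patchE; case: ifP => // _; rewrite mul0r.
Qed.

Lemma cvg_stable_cut a : 0 <= a ->
  (\int[mu]_x (stable_cut n x * (1 - expR (- (x * a))))%:E)%E @[n --> \oo] --> (a `^ s)%:E.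
Proof.
move=> a0; rewrite (_ : (fun n => _) = (fun n => \int[mu]_(x in `](0 + n.+1%:R^-1)%R, +oo[)
  (stable_const^-1 * w x * (1 - expR (- (x * a))))%:E)%E); last first.
  by apply/funext => n; rewrite integral_stable_cut add0r.
have mf' D : measurable_fun D (fun x => (stable_const^-1 * w x * (1 - expR (- (x * a))))%:E).
  apply: measurable_funTS; apply/measurable_EFinP; apply: measurable_funM.
    by apply: measurable_funM => //; exact: measurable_powR.
  apply: measurable_funB => //; apply: measurableT_comp => //; apply: measurableT_comp => //.
  exact: measurable_funM.
have cup : `]0, +oo[%classic = \bigcup_n `](0 + n.+1%:R^-1), +oo[%classic :> set R.
  rewrite itvoyEbigcup; apply/seteqP; split => x [n _] /=; rewrite in_itv/= andbT => xn; last first.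
    by exists n => //=; rewrite in_itv/= andbT ltW.
  exists n.+1 => //=; rewrite in_itv/= andbT; apply: lt_le_trans xn.
  by rewrite ltrD2l ltf_pV2 ?posrE// ltr_nat.
have -> : (a `^ s)%:E = (\int[mu]_(x in \bigcup_n `](0 + n.+1%:R^-1)%R, +oo[%classic)
  (stable_const^-1 * w x * (1 - expR (- (x * a))))%:E)%E.
  rewrite -cup; transitivity (\int[mu]_(x in `]0%R, +oo[) ((stable_const^-1)%:E * ((1 - expR (- (x * a))) * w x)%:E))%E.
    rewrite ge0_integralZl//=; last 3 first.
    - exact: mf.
    - by move=> x; rewrite in_itv/= andbT => x0; rewrite lee_fin f0.
    - by rewrite lee_fin invr_ge0 ltW.
    rewrite integral_stable// -EFinM; congr EFin; field.
    by rewrite gt_eqF.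
  by apply: eq_integral => x _; rewrite -EFinM; congr EFin; ring.
apply: ge0_nondecreasing_set_cvg_integral => //.
- move=> m n mn; rewrite subsetEset => x /=; rewrite !in_itv/= !andbT; apply: le_lt_trans.
  by rewrite lerD2l lef_pV2 ?posrE// ler_nat.
- by move=> n; exact: mf'.
- move=> n x /=; rewrite in_itv/= andbT add0r => nx; rewrite lee_fin -mulrA (mulrC (w x)).
  by rewrite mulr_ge0 ?invr_ge0 ?(ltW C0)// f0// (lt_trans _ nx).
Qed.

(** On x > d = 1 / (n + 1) one has 1 <= (1 - exp(-x)) / (1 - exp(-d)), which reduces the claim to
    [integral_stable] at a = 1. *)
Lemma integral_stable_cut_lty n : (\int[mu]_x (stable_cut n x)%:E < +oo)%E.
Proof.
have m1 : measurable_fun setT (fun x : R => expR (- (x * 1))).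
  apply: measurableT_comp => //; apply: measurableT_comp => //; exact: measurable_funM.
pose d : R := n.+1%:R^-1.
have d0 : 0 < d by rewrite invr_gt0.
have e0 : 0 < 1 - expR (- d) by rewrite subr_gt0 expRN_lt1.
apply: (@le_lt_trans _ _ ((1 - expR (- d))^-1%:E * (stable_const^-1%:E *
    \int[mu]_(x in `]0%R, +oo[) ((1 - expR (- (x * 1))) * w x)%:E))%E); last first.
  by rewrite integral_stable// -!EFinM ltry.
have i0 : (0 <= stable_const^-1%:E)%E by rewrite lee_fin invr_ge0 ltW.
have j0 : (0 <= ((1 - expR (- d))^-1)%:E)%E by rewrite lee_fin invr_ge0 ltW.
have k0 x : x \in `]0, +oo[ -> (0 <= ((1 - expR (- (x * 1))) * w x)%:E)%E.
  by rewrite in_itv/= andbT => x0; rewrite lee_fin f0.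
rewrite -ge0_integralZl//=; last exact: mf.
rewrite -ge0_integralZl//=; last 2 first.
- by apply: measurable_funeM; exact: mf.
- by move=> x x0; rewrite mule_ge0// k0.
rewrite [leRHS]integral_mkcond; apply: ge0_le_integral => //=.
- by move=> x _; rewrite lee_fin stable_cut_ge0.
- by apply/measurable_EFinP; exact: measurable_stable_cut.
- apply/(measurable_restrictT _ _).1 => //; apply: measurable_funeM; apply: measurable_funeM; exact: mf.
move=> x _; rewrite /stable_cut !patchE !mem_setE !in_itv/= !andbT.
case: ltP => [dx|_]; last first.
  by case: ifP => // x0; rewrite !mule_ge0// k0// in_itv/= x0.
rewrite (lt_trans d0 dx) -!EFinM lee_fin mulrCA ler_wpM2l ?invr_ge0 ?(ltW C0)//.
rewrite mulrA ler_peMl ?powR_ge0// mulrC ler_pdivlMr// mul1r lerD2l lerN2 ler_expR lerN2 mulr1.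
exact: ltW.
Qed.

Definition stable_mass n : R := \int[mu]_x stable_cut n x.

Lemma stable_massE n : (\int[mu]_x (stable_cut n x)%:E = (stable_mass n)%:E)%E.
Proof.
rewrite /stable_mass /Rintegral fineK// ge0_fin_numE; first exact: integral_stable_cut_lty.
by apply: integral_ge0 => x _; rewrite lee_fin stable_cut_ge0.
Qed.

Lemma cvg_stable_mix a : 0 <= a -> stable_mass n - laplace_mix (stable_cut n) a @[n --> \oo] --> a `^ s.
Proof.
move=> a0; suff H : (fun n => \int[mu]_x (stable_cut n x * (1 - expR (- (x * a))))%:E)%E = 
    EFin \o (fun n => stable_mass n - laplace_mix (stable_cut n) a).
  by have := cvg_stable_cut a0; rewrite H => /fine_cvgP[_].
apply/funext => n /=.
have mc := measurable_stable_cut n; have c0 := stable_cut_ge0 n; have cn := @stable_cut0 n.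
have me : measurable_fun setT (fun x : R => expR (- (x * a))).
  apply: measurableT_comp => //; apply: measurableT_comp => //; exact: measurable_funM.
rewrite EFinB -stable_massE (laplace_mixE mc c0 cn (stable_massE n))//.
apply/esym/eqP; rewrite sube_eq; last 2 first.
- by rewrite ge0_fin_numE ?integral_stable_cut_lty// integral_ge0// => x _; rewrite lee_fin.
- by rewrite -(laplace_mixE mc c0 cn (stable_massE n))// fin_num_adde_defl.
rewrite -ge0_integralD//; last 4 first.
- move=> x _; rewrite lee_fin; have [x0|x0] := leP x 0; first by rewrite cn// mul0r.
  by rewrite mulr_ge0// subr_ge0 expRN_le1// mulr_ge0// ltW.
- by apply/measurable_EFinP; apply: (measurable_funM mc); apply: measurable_funB.
- by move=> x _; rewrite lee_fin mulr_ge0// expR_ge0.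
- by apply/measurable_EFinP; apply: (measurable_funM mc me).
by apply/eqP/eq_integral => x _; rewrite -EFinD; congr EFin; ring.
Qed.

(** By [cvg_stable_mix], exp(-a^s) is the limit of exp(-m_n) exp(mix_n(a)), where m_n is the mass of
    the cut density and mix_n its mixture; since mix_n <= m_n, these approximants are at most 1. *)
Lemma posdef_stable N : posdef (fun xi : 'rV[R]_N => expR (- (dotp xi xi) `^ s)).
Proof.
have mp : measurable_fun setT (fun xi : 'rV[R]_N => expR (- (dotp xi xi) `^ s)).
  apply: measurableT_comp => //; apply: measurableT_comp => //.
  apply: (measurableT_comp (measurable_powR _)); exact: measurable_dotp_diag.
apply: (posdef_dominated (P_ := fun n xi => expR (- stable_mass n) * expR (laplace_mix (stable_cut n) (dotp xi xi)))) => //.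
- move=> n; apply: posdefZ; first exact: expR_ge0.
  exact: (posdef_exp_mix _ (measurable_stable_cut n) (stable_cut_ge0 n) (@stable_cut0 n) (stable_massE n)).
- move=> n xi; rewrite -expRD -[leRHS]expR0 ler_expR addrC subr_le0.
  by apply: (laplace_mix_le (measurable_stable_cut n) (stable_cut_ge0 n) (@stable_cut0 n) (stable_massE n)); exact: dotp_ge0.
move=> xi; under eq_fun do rewrite -expRD addrC -opprB.
apply: (@cvg_comp _ _ _ _ expR); last exact: continuous_expR.
by apply: cvgN; apply: cvg_stable_mix; exact: dotp_ge0.
Qed.

End stable.

(** * The fractional heat kernel *)

Lemma Lfun_oo_ae_le d (T : measurableType d) (R : realType) (mu : {measure set T -> \bar R}) (f : T -> R) :
  f \in Lfun mu +oo -> exists2 M, 0 <= M & {ae mu, forall x, `|f x| <= M}.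
Proof.
rewrite inE => /andP[_]; rewrite inE/= /finite_norm unlock/=.
case: ifPn => [mu0|]; last first.
  (* On a space of measure zero the whole space is an admissible exceptional set. *)
  rewrite -leNgt => mu0 _; exists 0 => //; exists setT; split => //.
  by apply/eqP; rewrite eq_le mu0 measure_ge0.
move=> foo; have := ess_sup_inf.ess_sup_ge mu (abse \o (EFin \o f)).
set M := ess_sup_inf.ess_sup _ _ in foo *; move=> fM; exists (Num.max (fine M) 0); first by rewrite le_max lexx orbT.
apply: filterS fM => x /= xM; rewrite le_max; apply/orP; left.
rewrite -lee_fin fineK// fin_numE (lt_eqF foo) andbT.
by apply/eqP => MN; rewrite MN leeNy_eq in xM.
Qed.

Lemma cvg_expRN_harmonic (R : realType) (q : R) : expR (- (n.+1%:R^-1 * q)) @[n --> \oo] --> (1 : R).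
Proof.
have H : - (n.+1%:R^-1 * q) @[n --> \oo] --> - (0 * q).
  by apply: cvgN; apply: cvgMl; exact: cvg_harmonic.
rewrite mul0r oppr0 in H.
by have := cvg_comp _ _ H (@continuous_expR R 0); rewrite expR0; exact.
Qed.

Section profile.
Context {R : realType} (s : R) (N : nat).
Hypothesis s01 : 0 < s < 1.
Let s0 : 0 < s. Proof. by case/andP: s01. Qed.
Local Notation nu := (@lebesgue_rV R N).
Local Notation p := (fun xi : 'rV[R]_N => expR (- (dotp xi xi) `^ s)).

Definition fourier_symbol (x : 'rV[R]_N) : R := \int[nu]_xi (cos (dotp x xi) * p xi).
Definition symbol_mass : R := \int[nu]_xi p xi.

Let mp : measurable_fun setT p. Proof. by have [] := posdef_stable s01 N. Qed.

Let mc x : measurable_fun setT (fun xi : 'rV[R]_N => cos (dotp x xi)).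
Proof.
by apply: (measurableT_comp (continuous_measurable_fun (@continuous_cos R))); exact: measurable_dotpr.
Qed.

Let ip : nu.-integrable setT (EFin \o p).
Proof.
apply: ge0_integrable_lty => //.
have := @integral_exp_powR_lty R N 1 s ltr01 s0; apply: le_lt_trans.
by under [leRHS]eq_integral do rewrite mul1r.
Qed.

Let icp x : nu.-integrable setT (EFin \o (fun xi => cos (dotp x xi) * p xi)).
Proof.
apply: (le_integrable _ _ _ ip) => //.
  by apply/measurable_EFinP; apply: (measurable_funM (mc x) mp).
move=> xi _ /=; rewrite lee_fin normrM (ger0_norm (expR_ge0 _)) ler_piMl ?expR_ge0//.
exact: cos_max.
Qed.

Lemma symbol_massE : (\int[nu]_xi (p xi)%:E = symbol_mass%:E)%E.
Proof. by rewrite EFin_Rintegral. Qed.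

Lemma symbol_mass_ge0 : 0 <= symbol_mass.
Proof. by apply: Rintegral_ge0 => xi _; exact: expR_ge0. Qed.

Lemma integral_onem_cos_symbol x :
  (\int[nu]_xi ((1 + cos (dotp x xi)) * p xi)%:E = (symbol_mass + fourier_symbol x)%:E)%E.
Proof.
rewrite EFinD /symbol_mass /fourier_symbol (EFin_Rintegral measurableT ip) (EFin_Rintegral measurableT (icp x)).
rewrite -(integralD _ ip (icp x))//.
by apply: eq_integral => xi _; rewrite -EFinD mulrDl mul1r.
Qed.

(** Letting the smoothing parameter 1 / (n + 1) of [posdef] tend to 0 gives [symbol_mass <=
    symbol_mass + fourier_symbol x], and the mass is finite. *)
Lemma fourier_symbol_ge0 x : 0 <= fourier_symbol x.
Proof.
have [_ _ pd] := posdef_stable s01 N.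
pose g n (xi : 'rV[R]_N) := expR (- (n.+1%:R^-1 * dotp xi xi)).
have mg n : measurable_fun setT (g n) by exact: measurable_gaussian_rV.
have g0 n xi : 0 <= g n xi by exact: expR_ge0.
have gnd xi m n : (m <= n)%N -> g m xi <= g n xi.
  move=> mn; rewrite ler_expR lerN2 ler_wpM2r ?dotp_ge0//.
  by rewrite lef_pV2 ?posrE// ler_nat.
have g1 xi : g n xi @[n --> \oo] --> (1 : R) by exact: cvg_expRN_harmonic.
have cv (h : 'rV[R]_N -> R) : measurable_fun setT h -> (forall xi, 0 <= h xi) ->
    (\int[nu]_xi (h xi * (g n xi * p xi))%:E)%E @[n --> \oo] --> (\int[nu]_xi (h xi * p xi)%:E)%E.
  move=> mh h0; apply: ge0_cvg_integral.
  - by move=> n; apply/measurable_EFinP; apply: (measurable_funM mh); apply: (measurable_funM (mg n) mp).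
  - by move=> n xi; rewrite lee_fin mulr_ge0// mulr_ge0// expR_ge0.
  - by move=> xi m n mn; rewrite lee_fin ler_wpM2l// ler_wpM2r ?expR_ge0// gnd.
  - move=> xi; apply/fine_cvgP; split; first exact: nearW.
    apply: cvgMr; have H : g n xi * p xi @[n --> \oo] --> 1 * p xi by apply: cvgMl; exact: g1.
    by rewrite mul1r in H.
have L := cv (cst 1) (@measurable_cst _ _ _ _ _ _) (fun=> ler01).
have Rr := cv _ (measurable_onem_cos x) (fun xi => onem_cos_ge0 (dotp x xi)).
have : (\int[nu]_xi (1 * p xi)%:E <= \int[nu]_xi ((1 + cos (dotp x xi)) * p xi)%:E)%E.
  rewrite -(cvg_lim _ L)// -(cvg_lim _ Rr)//; apply: lee_lim; [exact: cvgP L|exact: cvgP Rr|].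
  apply: nearW => n; under eq_integral do rewrite mul1r.
  by apply: pd; rewrite invr_gt0.
under eq_integral do rewrite mul1r.
by rewrite symbol_massE integral_onem_cos_symbol lee_fin lerDl.
Qed.

Lemma fourier_symbol_le x : fourier_symbol x <= symbol_mass.
Proof.
apply: le_Rintegral => // xi _.
by rewrite ler_piMl ?expR_ge0// cos_le1.
Qed.

Lemma measurable_fourier_symbol : measurable_fun setT fourier_symbol.
Proof.
(* Adding the mass turns the integrand into (1 + cos) p, which is nonnegative, so that Tonelli gives
   measurability in the parameter. *)
rewrite (_ : fourier_symbol = (fun x => (symbol_mass + fourier_symbol x) - symbol_mass)); last first.
  by apply/funext => x; rewrite addrAC subrr add0r.
apply: measurable_funB => //; apply/measurable_EFinP.
rewrite (_ : EFin \o _ = (fun x => \int[nu]_xi ((1 + cos (dotp x xi)) * p xi)%:E)%E); last first.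
  by apply/funext => x; rewrite integral_onem_cos_symbol.
apply: (measurable_fun_fubini_tonelli_F
  (fun z : 'rV[R]_N * 'rV[R]_N => ((1 + cos (dotp z.1 z.2)) * p z.2)%:E)).
  apply/measurable_EFinP; apply: measurable_funM; last exact: (measurableT_comp mp).
  apply: measurable_funD => //; apply: (measurableT_comp (continuous_measurable_fun (@continuous_cos R))).
  by apply: measurable_dotp.
by move=> z; rewrite lee_fin mulr_ge0 ?expR_ge0// onem_cos_ge0.
Qed.

Lemma frac_profileE x : frac_profile s x = (2 * pi) ^- N * fourier_symbol x.
Proof.
rewrite /frac_profile /Cintegral/=; congr (_ * _); apply: eq_Rintegral => xi _.
rewrite mulr0 subr0; congr (_ * expR (- _)).
by rewrite /enorm -powR12_sqrt ?dotp_ge0// -powRrM; congr powR; field.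
Qed.

Let gauss (d : R) (y : 'rV[R]_N) := expR (- (d * dotp y y)).

Let dotpZl (c : R) (x y : 'rV[R]_N) : dotp (c *: x) y = c * dotp x y.
Proof. by rewrite /dotp mulr_sumr; apply: eq_bigr => i _; rewrite !mxE mulrA. Qed.

Let dotpB (x y z : 'rV[R]_N) : dotp (x - y) z = dotp x z - dotp y z.
Proof. by rewrite /dotp -sumrB; apply: eq_bigr => i _; rewrite !mxE mulrBl. Qed.

Let dotpC (x y : 'rV[R]_N) : dotp x y = dotp y x.
Proof. by apply: eq_bigr => i _; rewrite mulrC. Qed.

Let measurable_scale_sub c (x : 'rV[R]_N) : measurable_fun setT (fun y : 'rV[R]_N => c *: (x - y)).
Proof.
apply/measurable_fun_rVP => i; rewrite (_ : (fun _ => _) = (fun y : 'rV[R]_N => c * (x ord0 i - y ord0 i))).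
  by apply: measurable_funM => //; apply: measurable_funB => //; exact: measurable_rV_coord.
by apply/funext => y; rewrite !mxE.
Qed.

Let mk c x : measurable_fun setT (fun y : 'rV[R]_N => fourier_symbol (c *: (x - y))).
Proof. exact: (measurableT_comp measurable_fourier_symbol (measurable_scale_sub c x)). Qed.

(** Exchanging the integrals, the Gaussian in y becomes S^N times a Gaussian in xi, and its symbol
    and cosine factors are bounded by 1. The widths of the two Gaussians are reciprocal, so the
    product of their integrals is (2 pi / c)^N whatever [d] is. *)
Let integral_symbol_gaussian_le c d x : 0 < c -> 0 < d ->
  (\int[nu]_y ((symbol_mass + fourier_symbol (c *: (x - y))) * gauss d y)%:E <=
   (symbol_mass * Num.sqrt (pi / d) ^+ N + (2 * pi / c) ^+ N)%:E)%E.
Proof.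
move=> c0 d0.
pose f (z : 'rV[R]_N * 'rV[R]_N) := ((1 + cos (dotp (c *: (x - z.1)) z.2)) * p z.2 * gauss d z.1)%:E.
have mf : measurable_fun setT f.
  apply/measurable_EFinP; apply: measurable_funM; last first.
    exact: (measurableT_comp (measurable_gaussian_rV d) measurable_fst).
  apply: measurable_funM; last exact: (measurableT_comp mp).
  apply: measurable_funD => //; apply: (measurableT_comp (continuous_measurable_fun (@continuous_cos R))).
  apply: measurable_dotp => //.
  exact: (measurableT_comp (measurable_scale_sub c x) measurable_fst).
have f0 z : (0 <= f z)%E by rewrite lee_fin !mulr_ge0 ?expR_ge0// onem_cos_ge0.
have -> : (\int[nu]_y ((symbol_mass + fourier_symbol (c *: (x - y))) * gauss d y)%:E =
    \int[nu]_y \int[nu]_xi f (y, xi))%E.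
  apply: eq_integral => y _; rewrite EFinM -integral_onem_cos_symbol -ge0_integralZr//; last 2 first.
  - by apply/measurable_EFinP; apply: (measurable_funM (measurable_onem_cos _) mp).
  - by rewrite lee_fin expR_ge0.
rewrite fubini_tonelli//.
set S := Num.sqrt (pi / d).
have S0 : 0 <= S ^+ N by rewrite exprn_ge0// sqrtr_ge0.
apply: (@le_trans _ _ (\int[nu]_xi ((p xi)%:E * (S ^+ N)%:E + (expR (- (c ^+ 2 / (4 * d) * dotp xi xi)))%:E * (S ^+ N)%:E))%E).
  apply: ge0_le_integral => //.
  - by move=> xi _; apply: integral_ge0.
  - exact: measurable_fun_fubini_tonelli_G.
  - apply: emeasurable_funD; apply/measurable_EFinP; apply: measurable_funM => //.
    exact: measurable_gaussian_rV.
  move=> xi _.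
  have -> : (\int[nu]_y f (y, xi) = \int[nu]_y ((p xi)%:E *
      ((1 + 1 * cos (dotp (c *: x) xi + dotp (- c *: xi) y)) * expR (- (d * dotp y y)))%:E))%E.
    apply: eq_integral => y _; rewrite -EFinM /f/=; congr EFin.
    rewrite !dotpZl dotpB mulNr (dotpC xi) mulrBr mul1r /gauss.
    by move: (cos _) (expR (- (d * _))) (p xi) => A B C; ring.
  rewrite ge0_integralZl//; last first.
    apply/measurable_EFinP; apply: measurable_funM; last exact: measurable_gaussian_rV.
    by apply: measurable_cos_phase; apply: measurable_funD => //; exact: measurable_dotpr.
  rewrite integral_gaussian_phase_rV ?normr1// -!EFinM -EFinD lee_fin mulrA -mulrDl.
  rewrite ler_wpM2r// mulrDr mulr1 lerD2l mul1r !dotpZl (dotpC xi (- c *: xi)) dotpZl.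
  have -> : - c * (- c * dotp xi xi) / (4 * d) = c ^+ 2 / (4 * d) * dotp xi xi.
    by field; rewrite gt_eqF.
  set q := expR (- (c ^+ 2 / _ * _)).
  have q0 : 0 <= q by exact: expR_ge0.
  apply: (@le_trans _ _ (1 * (1 * q))); last by rewrite !mul1r.
  apply: (@le_trans _ _ (p xi * (1 * q))); first by rewrite ler_wpM2l ?expR_ge0// ler_wpM2r// cos_le1.
  by rewrite ler_wpM2r ?mul1r// expRN_le1// powR_ge0.
have cd : 0 < c ^+ 2 / (4 * d) by rewrite divr_gt0 ?exprn_gt0 ?mulr_gt0.
rewrite ge0_integralD//; last 4 first.
- by move=> xi _; rewrite -EFinM lee_fin mulr_ge0 ?expR_ge0.
- by apply/measurable_EFinP; apply: measurable_funM.
- by move=> xi _; rewrite -EFinM lee_fin mulr_ge0 ?expR_ge0.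
- by apply/measurable_EFinP; apply: measurable_funM => //; exact: measurable_gaussian_rV.
rewrite ge0_integralZr//; last exact/measurable_EFinP.
rewrite ge0_integralZr//; last by apply/measurable_EFinP; exact: measurable_gaussian_rV.
rewrite symbol_massE integral_gaussian_rV// -!EFinM -EFinD lee_fin lerD2l.
rewrite -exprMn /S -sqrtrM ?(divr_ge0 (pi_ge0 R) (ltW cd))//.
have -> : pi / (c ^+ 2 / (4 * d)) * (pi / d) = (2 * pi / c) ^+ 2.
  by field; rewrite !gt_eqF.
by rewrite sqrtr_sqr ger0_norm// divr_ge0 ?mulr_ge0 ?pi_ge0// ltW.
Qed.

(** The term containing [symbol_mass] may blow up as [d] tends to 0, so it is cancelled for each
    fixed d > 0; only then does monotone convergence remove the Gaussian. This is the half of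
    Fourier inversion at 0 that bounds the kernel's integral by the symbol's value 1 there. *)
Lemma integral_fourier_symbol_le c x : 0 < c ->
  (\int[nu]_y (fourier_symbol (c *: (x - y)))%:E <= ((2 * pi / c) ^+ N)%:E)%E.
Proof.
move=> c0.
have mg d : measurable_fun setT (gauss d) by exact: measurable_gaussian_rV.
have G d : 0 < d -> (\int[nu]_y (fourier_symbol (c *: (x - y)) * gauss d y)%:E <= ((2 * pi / c) ^+ N)%:E)%E.
  move=> d0; have := integral_symbol_gaussian_le x c0 d0.
  have -> : (\int[nu]_y ((symbol_mass + fourier_symbol (c *: (x - y))) * gauss d y)%:E =
    (symbol_mass * Num.sqrt (pi / d) ^+ N)%:E + \int[nu]_y (fourier_symbol (c *: (x - y)) * gauss d y)%:E)%E.
    rewrite EFinM -integral_gaussian_rV// -ge0_integralZl//; last 2 first.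
    - by apply/measurable_EFinP; exact: mg.
    - by rewrite lee_fin symbol_mass_ge0.
    rewrite -ge0_integralD//; last 4 first.
    - by move=> y _; rewrite -EFinM lee_fin mulr_ge0 ?expR_ge0// symbol_mass_ge0.
    - by apply/measurable_EFinP; apply: measurable_funM => //; exact: mg.
    - by move=> y _; rewrite lee_fin mulr_ge0 ?expR_ge0// fourier_symbol_ge0.
    - by apply/measurable_EFinP; apply: (measurable_funM (mk c x) (mg d)).
    by apply: eq_integral => y _; rewrite -EFinM -EFinD mulrDl.
  by rewrite EFinD leeD2lE.
have L : (\int[nu]_y (fourier_symbol (c *: (x - y)) * gauss n.+1%:R^-1 y)%:E)%E @[n --> \oo] -->
    (\int[nu]_y (fourier_symbol (c *: (x - y)))%:E)%E.
  apply: ge0_cvg_integral.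
  - by move=> n; apply/measurable_EFinP; apply: (measurable_funM (mk c x) (mg _)).
  - by move=> n y; rewrite lee_fin mulr_ge0 ?expR_ge0// fourier_symbol_ge0.
  - move=> y m n mn; rewrite lee_fin ler_wpM2l ?fourier_symbol_ge0// ler_expR lerN2 ler_wpM2r ?dotp_ge0//.
    by rewrite lef_pV2 ?posrE// ler_nat.
  - move=> y; apply/fine_cvgP; split; first exact: nearW.
    have H : fourier_symbol (c *: (x - y)) * gauss n.+1%:R^-1 y @[n --> \oo] --> fourier_symbol (c *: (x - y)) * 1.
      by apply: cvgMr; exact: cvg_expRN_harmonic.
    by rewrite mulr1 in H.
rewrite -(cvg_lim _ L)//; apply: lime_le; first exact: cvgP L.
by apply: nearW => n; apply: G; rewrite invr_gt0.
Qed.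

End profile.

(** * Bounds and time integrability of the heat evolution *)

Section heat.
Context {R : realType} (s : R) (N : nat).
Hypothesis s01 : 0 < s < 1.
Let s0 : 0 < s. Proof. by case/andP: s01. Qed.
Local Notation mu := (@lebesgue_measure R).
Local Notation nu := (@lebesgue_rV R N).

Let pi20 : 0 < (2 * pi) ^- N :> R.
Proof. by rewrite invr_gt0 exprn_gt0// mulr_gt0// pi_gt0. Qed.

Lemma frac_kernel_ge0 (x : 'rV[R]_N) t : 0 <= frac_kernel s x t.
Proof.
rewrite /frac_kernel frac_profileE// mulr_ge0 ?powR_ge0// mulr_ge0 ?(ltW pi20)//.
exact: fourier_symbol_ge0.
Qed.

Lemma frac_kernel_le (x : 'rV[R]_N) t :
  frac_kernel s x t <= (2 * pi) ^- N * symbol_mass s N * t `^ (- (N%:R / (2 * s))).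
Proof.
rewrite /frac_kernel frac_profileE// mulrC ler_wpM2r ?powR_ge0// ler_wpM2l ?(ltW pi20)//.
exact: fourier_symbol_le.
Qed.

Lemma measurable_frac_kernel (x : 'rV[R]_N) :
  measurable_fun setT (fun z : R * 'rV[R]_N => frac_kernel s (x - z.2) z.1).
Proof.
rewrite (_ : (fun z => _) = (fun z : R * 'rV[R]_N => z.1 `^ (- (N%:R / (2 * s))) *
    ((2 * pi) ^- N * fourier_symbol s (z.1 `^ (- (2 * s)^-1) *: (x - z.2))))); last first.
  by apply/funext => z; rewrite /frac_kernel frac_profileE.
apply: measurable_funM; first exact: (measurableT_comp (measurable_powR _) measurable_fst).
apply: measurable_funM => //.
have mz : measurable_fun setT (fun z : R * 'rV[R]_N => z.1 `^ (- (2 * s)^-1) *: (x - z.2)).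
  apply/measurable_fun_rVP => i.
  rewrite (_ : (fun _ => _) = (fun z : R * 'rV[R]_N => z.1 `^ (- (2 * s)^-1) * (x ord0 i - z.2 ord0 i))).
    apply: measurable_funM; first exact: (measurableT_comp (measurable_powR _) measurable_fst).
    apply: measurable_funB => //.
    exact: (measurableT_comp (measurable_rV_coord i) measurable_snd).
  by apply/funext => z; rewrite !mxE.
exact: (measurableT_comp (measurable_fourier_symbol s01) mz).
Qed.

Lemma measurable_frac_kernelr (x : 'rV[R]_N) t :
  measurable_fun setT (fun y : 'rV[R]_N => frac_kernel s (x - y) t).
Proof. exact: (measurableT_comp (measurable_frac_kernel x) (pair1_measurable t)). Qed.

(** With c = t^(-1/(2 s)), the prefactor of the kernel is c^N, which cancels the (2 pi / c)^N of the
    bound on the symbol together with (2 pi)^-N. *)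
Lemma integral_frac_kernel_le1 (x : 'rV[R]_N) t : 0 < t ->
  (\int[nu]_y (frac_kernel s (x - y) t)%:E <= 1)%E.
Proof.
move=> t0; pose c := t `^ (- (2 * s)^-1).
have c0 : 0 < c by exact: powR_gt0.
have -> : (\int[nu]_y (frac_kernel s (x - y) t)%:E =
    (t `^ (- (N%:R / (2 * s))) * (2 * pi) ^- N)%:E * \int[nu]_y (fourier_symbol s (c *: (x - y)))%:E)%E.
  rewrite -ge0_integralZl//; last 3 first.
  - have mz : measurable_fun setT (fun y : 'rV[R]_N => c *: (x - y)).
      apply/measurable_fun_rVP => i; rewrite (_ : (fun _ => _) = (fun y : 'rV[R]_N => c * (x ord0 i - y ord0 i))).
        by apply: measurable_funM => //; apply: measurable_funB => //; exact: measurable_rV_coord.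
      by apply/funext => y; rewrite !mxE.
    by apply/measurable_EFinP; exact: (measurableT_comp (measurable_fourier_symbol s01) mz).
  - by move=> y _; rewrite lee_fin fourier_symbol_ge0.
  - by rewrite lee_fin mulr_ge0 ?powR_ge0// ltW.
  by apply: eq_integral => y _; rewrite -EFinM /frac_kernel frac_profileE// mulrA.
apply: le_trans (lee_wpmul2l _ (integral_fourier_symbol_le s01 x c0)) _.
  by rewrite lee_fin mulr_ge0 ?powR_ge0// ltW.
rewrite -EFinM lee_fin.
have -> : t `^ (- (N%:R / (2 * s))) = c ^+ N.
  rewrite -powR_mulrn ?powR_ge0// -powRrM; congr powR; field; exact: lt0r_neq0.
rewrite expr_div_n; move: (c ^+ N) (expf_neq0 N (lt0r_neq0 c0)) => a a0.
have p0 : (2 * pi) ^+ N != 0 :> R by rewrite expf_neq0// mulf_neq0// lt0r_neq0// pi_gt0.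
by move: ((2 * pi) ^+ N) p0 => b b0; rewrite le_eqVlt; apply/orP; left; apply/eqP; field; rewrite a0.
Qed.

Variables (phi : 'rV[R]_N -> R).
Hypotheses (phi_ge0 : {ae nu, forall y, 0 <= phi y}) (phi_L1 : phi \in Lfun nu 1)
  (phi_Loo : phi \in Lfun nu +oo).

(** Sign and bound of [phi] hold only almost everywhere, whereas the Tonelli arguments below use
    them at every point. Truncating |phi| at [M] changes [phi] on a null set, which [frac_heat] does
    not see. *)
Lemma Lfun_nonneg_representative : exists (psi : 'rV[R]_N -> R) (M A : R), [/\ measurable_fun setT psi,
  forall y, 0 <= psi y <= M, {ae nu, forall y, phi y = psi y} &
  (\int[nu]_y (psi y)%:E <= A%:E)%E].
Proof.
have /Lfun1_integrable iphi := phi_L1.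
have mphi : measurable_fun setT phi by apply/measurable_EFinP; exact: measurable_int iphi.
have [M M0 phiM] := Lfun_oo_ae_le phi_Loo.
have mn : measurable_fun setT (fun y => `|phi y|) by exact: measurableT_comp.
have fi : (\int[nu]_y `|phi y|%:E)%E \is a fin_num.
  by rewrite ge0_fin_numE ?integral_ge0//; have /integrableP[_] := iphi.
exists (fun y => Num.min `|phi y| M), M, (fine (\int[nu]_y `|phi y|%:E)%E); split.
- exact: measurable_minr.
- by move=> y; rewrite le_min normr_ge0 M0/= ge_min lexx orbT.
- apply: filterS2 phi_ge0 phiM => y y0 yM.
  by rewrite (min_idPl yM) ger0_norm.
- rewrite fineK//; apply: ge0_le_integral => //.
  + by move=> y _; rewrite lee_fin le_min normr_ge0.
  + by apply/measurable_EFinP; exact: measurable_minr.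
  + exact/measurable_EFinP.
  + by move=> y _; rewrite lee_fin ge_min lexx.
Qed.

Lemma frac_heat_bounds : exists M C, forall x, 
  [/\ measurable_fun setT (frac_heat s phi x), forall t, 0 <= frac_heat s phi x t,
    forall t, 0 < t -> frac_heat s phi x t <= M & 
    forall t, frac_heat s phi x t <= C * t `^ (- (N%:R / (2 * s)))].
Proof.
have [psi [M [A [mpsi psiM phiE psiA]]]] := Lfun_nonneg_representative.
have psi0 y : 0 <= psi y by have /andP[] := psiM y.
pose B := (2 * pi) ^- N * symbol_mass s N.
have B0 : 0 <= B by rewrite mulr_ge0 ?(ltW pi20)// symbol_mass_ge0.
have mphi : measurable_fun setT phi.
  by have /Lfun1_integrable iphi := phi_L1; apply/measurable_EFinP; exact: measurable_int iphi.
exists M, (B * A) => x.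
have mKpsi t : measurable_fun setT (fun y : 'rV[R]_N => (frac_kernel s (x - y) t * psi y)%:E).
  by apply/measurable_EFinP; apply: (measurable_funM (measurable_frac_kernelr x t) mpsi).
have Kpsi0 t y : (0 <= (frac_kernel s (x - y) t * psi y)%:E)%E.
  by rewrite lee_fin mulr_ge0// frac_kernel_ge0.
pose V t := (\int[nu]_y (frac_kernel s (x - y) t * psi y)%:E)%E.
have V0 t : (0 <= V t)%E by exact: integral_ge0.
have vE t : frac_heat s phi x t = fine (V t).
  rewrite /frac_heat /Rintegral; congr fine; apply: ae_eq_integral => //.
  - by apply/measurable_EFinP; apply: (measurable_funM (measurable_frac_kernelr x t) mphi).
  - by apply: filterS phiE => y -> _.
have VC t : (V t <= (B * A * t `^ (- (N%:R / (2 * s))))%:E)%E.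
  rewrite mulrAC EFinM; apply: (@le_trans _ _ ((B * t `^ (- (N%:R / (2 * s))))%:E * \int[nu]_y (psi y)%:E)%E).
    rewrite -ge0_integralZl//; last 3 first.
    - exact/measurable_EFinP.
    - by move=> y _; rewrite lee_fin.
    - by rewrite lee_fin mulr_ge0// powR_ge0.
    apply: ge0_le_integral => //.
    + by apply: measurable_funeM; exact/measurable_EFinP.
    + by move=> y _; rewrite -EFinM lee_fin ler_wpM2r// frac_kernel_le.
  by apply: lee_wpmul2l => //; rewrite lee_fin mulr_ge0// powR_ge0.
have Vfin t : V t \is a fin_num by rewrite ge0_fin_numE// (le_lt_trans (VC t))// ltry.
split.
- rewrite (_ : frac_heat s phi x = fine \o V); last by apply/funext => t; exact: vE.
  apply: measurableT_comp => //.
  apply: (measurable_fun_fubini_tonelli_F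
    (fun z : measurableTypeR R * 'rV[R]_N => (frac_kernel s (x - z.2) z.1 * psi z.2)%:E)) => //.
  apply/measurable_EFinP; apply: measurable_funM; first exact: measurable_frac_kernel.
  exact: (measurableT_comp mpsi).
- by move=> t; rewrite vE fine_ge0.
- move=> t t0; rewrite vE -lee_fin fineK//.
  have M0 : 0 <= M by have /andP[+ /(le_trans _)] := psiM 0; move=> h; apply.
  apply: (@le_trans _ _ (M%:E * \int[nu]_y (frac_kernel s (x - y) t)%:E)%E).
    rewrite -ge0_integralZl//; last 2 first.
    - by apply/measurable_EFinP; exact: measurable_frac_kernelr.
    - by move=> y _; rewrite lee_fin frac_kernel_ge0.
    apply: ge0_le_integral => //.
    + by apply: measurable_funeM; apply/measurable_EFinP; exact: measurable_frac_kernelr.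
    + move=> y _; rewrite -EFinM lee_fin mulrC ler_wpM2r ?frac_kernel_ge0//.
      by have /andP[] := psiM y.
  rewrite -[leRHS]mule1; apply: lee_wpmul2l => //; exact: integral_frac_kernel_le1.
- by move=> t; rewrite vE -lee_fin fineK.
Qed.

Lemma integrable_frac_heat (x : 'rV[R]_N) : 2 * s < N%:R ->
  mu.-integrable `]0, +oo[ (EFin \o frac_heat s phi x).
Proof.
move=> sN; have [M [C H]] := frac_heat_bounds; have [mv v0 vM vC] := H x.
apply: ge0_integrable_lty => //; first exact: measurable_funTS.
rewrite (_ : `]0%R, +oo[%classic = `]0, 1] `|` `]1, +oo[); last first.
  by rewrite -itv_bndbnd_setU// bnd_simp.
have mvE D : measurable_fun D (fun t => (frac_heat s phi x t)%:E).
  by apply: measurable_funTS; exact/measurable_EFinP.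
rewrite ge0_integral_setU//=; last 3 first.
- exact: mvE.
- by move=> t _; rewrite lee_fin.
- apply/disj_setPS => t [] /=; rewrite !in_itv/= andbT => /andP[_ tle] /lt_le_trans => /(_ _ tle).
  by rewrite ltxx.
apply: lte_add_pinfty.
  apply: (@le_lt_trans _ _ (\int[mu]_(t in `]0%R, 1%R]) (M%:E))%E).
    apply: ge0_le_integral => //=.
    - by move=> t _; rewrite lee_fin.
    - exact: mvE.
    - by move=> t; rewrite in_itv/= => /andP[t0 _]; rewrite lee_fin vM.
  by rewrite integral_cst//= lebesgue_measure_itv/= lte_fin ltr01 -EFinD -EFinM ltry.
(* The excess of the decay exponent over 1; it is positive exactly because 2 s < N, and this makes
   t^(-r-1) integrable at infinity. *)
pose r := N%:R / (2 * s) - 1.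
have r0 : 0 < r by rewrite subr_gt0 ltr_pdivlMr ?mul1r// mulr_gt0.
have rE : - (N%:R / (2 * s)) = - r - 1 by rewrite /r; ring.
have mp : measurable_fun setT (fun t : R => t `^ (- r - 1)) by exact: measurable_powR.
have C0 : 0 <= C by have := le_trans (v0 1) (vC 1); rewrite powR1 mulr1.
apply: (@le_lt_trans _ _ (C%:E * \int[mu]_(t in `[1%R, +oo[) (t `^ (- r - 1))%:E)%E); last first.
  apply: lte_mul_pinfty => //.
  exact: le_lt_trans (integral_powR_itv1y_le r0) (ltry _).
rewrite -integral_itv_obnd_cbnd//; last by apply: measurable_funTS; exact/measurable_EFinP.
rewrite -ge0_integralZl//=; last 2 first.
- by apply: measurable_funTS; exact/measurable_EFinP.
- by move=> t _; rewrite lee_fin powR_ge0.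
apply: ge0_le_integral => //=.
- by move=> t _; rewrite lee_fin.
- exact: mvE.
- by apply: measurable_funeM; apply: measurable_funTS; exact/measurable_EFinP.
- by move=> t _; rewrite -EFinM lee_fin -rE.
Qed.

End heat.

Unset Implicit Arguments.

Theorem theorem1p2 (R : realType) (N : nat) (s : R) (phi : 'rV[R]_N -> R)
    (hNs : ((2 <= N)%N /\ 0 < s < 1) \/ (N = 1%N /\ 0 < s < 1 / 2))
    (phi_ge0 : {ae lebesgue_rV N, forall y, 0 <= phi y})
    (phi_L1 : phi \in Lfun (lebesgue_rV N) 1)
    (phi_Loo : phi \in Lfun (lebesgue_rV N) +oo) :
  let v := frac_heat s phi in
  [/\ forall x t, 0 < t -> 0 <= v x t,
      forall x, lebesgue_measure.-integrable `]0, +oo[ (EFin \o v x)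
    & forall (d : measure_display) (Omega : measurableType d)
        (P : probability Omega R) (S : R -> {RV P >-> R})
        (sigma : {measure set R -> \bar R}) (k : R -> R) (G : R -> R -> R)
        (rho : R),
      subordinator S sigma ->
      kernel_of sigma k ->
      (forall t, 0 < t -> 0 <= k t) ->
      L1loc_pos k ->
      (forall t, 0 < t -> inverse_density S t (G t)) ->
      l * laplace k l @[l --> 0^'+] --> (0 : R) ->
      0 <= rho ->
      slowly_varying (fun x => x `^ (- rho) * laplace k x^-1) ->
      forall x,
        (t^-1 * \int[lebesgue_measure]_(r in `]0, t]) subordinated (v x) G r)
          / (t^-1 * laplace k t^-1) @[t --> +oo]
        --> (\int[lebesgue_measure]_(tau in `]0, +oo[) v x tau)
              / Gamma (rho + 1)].
Proof.
have s01 : 0 < s < 1.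
  case: hNs => [[]|[_ /andP[s0 s2]]]//; rewrite s0 (lt_trans s2)//.
  by rewrite ltr_pdivrMr// mul1r ltr1n.
have sN : 2 * s < N%:R.
  case: hNs => [[N2 /andP[_ s1]]|[-> /andP[_ s2]]].
    by apply: (@lt_le_trans _ _ 2); rewrite ?ler_nat// -[ltRHS]mulr1 ltr_pM2l.
  by rewrite mulrC -ltr_pdivlMr.
have [M [C v_bounds]] := frac_heat_bounds s01 phi_ge0 phi_L1 phi_Loo.
move=> v; split.
- by move=> x t _; have [_ v0 _ _] := v_bounds x; exact: v0.
- by move=> x; exact: integrable_frac_heat.
move=> d Omega P S sigma k G rho subS sigma_k _ _ densG lk0 rho0 svL x.
have [_ v0 vM _] := v_bounds x.
apply: (subordinated_average subS sigma_k densG lk0 rho0 svL (fun t _ => v0 t) vM).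
exact: integrable_frac_heat.
Qed.
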